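(* Let $D\subset\mathbb{R}^2$ be a strictly convex domain with smooth boundary $\partial D$ of everywhere strictly positive curvature. If the symplectic billiard in $D$ is without conjugate points, then $D$ is an ellipse (circles included).
   Context: $\omega$ is the standard area form on $\mathbb{R}^2$: $\omega(u,v)=u_1v_2-u_2v_1$. $D$ contains the origin. Let $\mathbb{T}=\mathbb{R}/\ell\mathbb{Z}$ and let $\gamma:\mathbb{T}\to\partial D$ be a smooth regular parametrization of $\partial D$, oriented counter-clockwise. For every $t$ there is a unique point $\gamma(t^* )\in\partial D$, $\gamma(t^* )\neq\gamma(t)$, with $\omega(\gamma'(t),\gamma'(t^* ))=0$. Phase-space: $\mathcal{P}=\{(\gamma(t),\gamma(s))\in\partial D\times\partial D:\ \gamma(t)<\gamma(s)<\gamma(t^* )\}$, where the inequalities refer to the cyclic counter-clockwise order on $\partial D$ (i.e. $\gamma(s)$ lies in the open arc going counter-clockwise from $\gamma(t)$ to $\gamma(t^* )$). Symplectic billiard map: $\Phi:\mathcal{P}\to\mathcal{P}$, $(\gamma(t_1),\gamma(t_2))\mapsto(\gamma(t_2),\gamma(t_3))$, where $\gamma(t_3)\in\partial D$ is the unique point, different from $\gamma(t_1)$, with $\omega(\gamma'(t_2),\gamma(t_3)-\gamma(t_1))=0$. Generating function: $L(t_1,t_2)=\omega(\gamma(t_1),\gamma(t_2))$; $L_i$, $L_{ij}$ denote its partial derivatives with respect to the $i$-th, and the $i$-th and $j$-th, arguments. A symplectic billiard configuration is a bi-infinite sequence $\{t_n\}_{n\in\mathbb{Z}}$ with $(\gamma(t_n),\gamma(t_{n+1}))\in\mathcal{P}$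 and $\Phi(\gamma(t_{n-1}),\gamma(t_n))=(\gamma(t_n),\gamma(t_{n+1}))$ for all $n$; equivalently $L_1(t_n,t_{n+1})+L_2(t_{n-1},t_n)=0$ for all $n\in\mathbb{Z}$. A Jacobi field along a configuration $\{t_n\}$ is a sequence $\{\xi_n\}_{n\in\mathbb{Z}}$, $\xi_n\in T_{\gamma(t_n)}\partial D\cong\mathbb{R}$ (identified with $\mathbb{R}$ through the parametrization $\gamma$), such that for all $n\in\mathbb{Z}$ $$L_{12}(t_{n-1},t_n)\xi_{n-1}+[L_{22}(t_{n-1},t_n)+L_{11}(t_n,t_{n+1})]\xi_n+L_{12}(t_n,t_{n+1})\xi_{n+1}=0.$$ For $M<N$, two points $t_M,t_N$ of a configuration are called conjugate if there is a non-zero Jacobi field along the configuration vanishing at $t_M$ and $t_N$ (i.e. $\xi_M=\xi_N=0$). The symplectic billiard is without conjugate points if no billiard configuration has conjugate points. *)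

(* Defs.v *)
From Stdlib Require Import Reals ZArith.
From Coquelicot Require Import Coquelicot.

Open Scope R_scope.

Notation point := (R * R)%type.

Definition omega (u v : point) : R := fst u * snd v - snd u * fst v.

(** ** Planar domains *)

(* Same double-negated form of adherence as in Coquelicot's [closed]. *)
Definition closure (D : point -> Prop) (p : point) : Prop :=
  ~ locally p (fun q => ~ D q).

Definition boundary (D : point -> Prop) (p : point) : Prop :=
  closure D p /\ ~ locally p D.

(* [D] being open, it is its own interior; connectedness follows from
   convexity. *)
Definition strictly_convex_domain (D : point -> Prop) : Prop :=
  open D /\
  (exists p, D p) /\
  (forall (p q : point) (a : R),
     closure D p -> closure D q -> p <> q -> 0 < a < 1 ->
     D (plus (scal (1 - a) p) (scal a q))).

(* Open region bounded by an ellipse with centre [c], semi-axes [a], [b] and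
   axes rotated by [theta]. *)
Definition is_ellipse (D : point -> Prop) : Prop :=
  exists (c : point) (a b theta : R), 0 < a /\ 0 < b /\
    forall p : point,
      D p <->
      ((cos theta * (fst p - fst c) + sin theta * (snd p - snd c)) / a) ^ 2 +
      ((- sin theta * (fst p - fst c) + cos theta * (snd p - snd c)) / b) ^ 2
      < 1.

(** ** Closed curves

    A curve on [R / ell Z] is an [ell]-periodic function on [R]. *)

Definition deriv_curve (n : nat) (gamma : R -> point) (t : R) : point :=
  (Derive_n (fun s => fst (gamma s)) n t, Derive_n (fun s => snd (gamma s)) n t).

Definition smooth_curve (gamma : R -> point) : Prop :=
  forall (n : nat) (t : R),
    ex_derive_n (fun s => fst (gamma s)) n t /\
    ex_derive_n (fun s => snd (gamma s)) n t.

Definition velocity (gamma : R -> point) : R -> point := deriv_curve 1 gamma.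

Definition acceleration (gamma : R -> point) : R -> point := deriv_curve 2 gamma.

Definition same_param (ell s t : R) : Prop := exists k : Z, s = t + IZR k * ell.

Definition rot90 (v : point) : point := (- snd v, fst v).

Record boundary_param (D : point -> Prop) (ell : R) (gamma : R -> point) : Prop := {
  bp_smooth : smooth_curve gamma;
  bp_regular : forall t, velocity gamma t <> (0, 0);
  bp_inj : forall s t, gamma s = gamma t <-> same_param ell s t;
  bp_image : forall p, boundary D p <-> exists t, gamma t = p;
  (* counter-clockwise: the left normal points into [D] *)
  bp_ccw : forall t,
    at_right 0 (fun e => D (plus (gamma t) (scal e (rot90 (velocity gamma t)))))
}.

(* [norm] on [R * R] is the Euclidean norm. *)
Definition curvature (gamma : R -> point) (t : R) : R :=
  omega (velocity gamma t) (acceleration gamma t) / norm (velocity gamma t) ^ 3.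

(** ** The symplectic billiard *)

(* [gamma u] is the point with tangent parallel to that at [gamma t], i.e.
   [u] represents [t^*]. *)
Definition opposite (gamma : R -> point) (t u : R) : Prop :=
  gamma u <> gamma t /\ omega (velocity gamma t) (velocity gamma u) = 0.

(* [s] lies in the open arc going counter-clockwise from [t] to [u] on
   [R / ell Z]. *)
Definition ccw_between (ell t s u : R) : Prop :=
  exists s' u' : R, same_param ell s' s /\ same_param ell u' u /\
    t < s' < u' /\ u' < t + ell.

Definition phase_space (ell : R) (gamma : R -> point) (x : point * point) : Prop :=
  exists t s u : R, x = (gamma t, gamma s) /\
    opposite gamma t u /\ ccw_between ell t s u.

(* Graph of the symplectic billiard map [Phi]. *)
Definition billiard_map (ell : R) (gamma : R -> point) (x y : point * point) : Prop :=
  phase_space ell gamma x /\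
  exists t1 t2 t3 : R,
    x = (gamma t1, gamma t2) /\ y = (gamma t2, gamma t3) /\
    gamma t3 <> gamma t1 /\
    omega (velocity gamma t2) (minus (gamma t3) (gamma t1)) = 0.

(* Points of the circle [R / ell Z] are given by arbitrary real
   representatives [t n]. *)
Definition configuration (ell : R) (gamma : R -> point) (t : Z -> R) : Prop :=
  forall n : Z,
    phase_space ell gamma (gamma (t n), gamma (t (n + 1)%Z)) /\
    billiard_map ell gamma (gamma (t (n - 1)%Z), gamma (t n))
                           (gamma (t n), gamma (t (n + 1)%Z)).

Definition gen_fun (gamma : R -> point) (t1 t2 : R) : R :=
  omega (gamma t1) (gamma t2).

Definition L11 (gamma : R -> point) : R -> R -> R :=
  partial_derive 2 0 (gen_fun gamma).
Definition L12 (gamma : R -> point) : R -> R -> R :=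
  partial_derive 1 1 (gen_fun gamma).
Definition L22 (gamma : R -> point) : R -> R -> R :=
  partial_derive 0 2 (gen_fun gamma).

Definition jacobi_field (gamma : R -> point) (t xi : Z -> R) : Prop :=
  forall n : Z,
    L12 gamma (t (n - 1)%Z) (t n) * xi (n - 1)%Z +
    (L22 gamma (t (n - 1)%Z) (t n) + L11 gamma (t n) (t (n + 1)%Z)) * xi n +
    L12 gamma (t n) (t (n + 1)%Z) * xi (n + 1)%Z = 0.

Definition conjugate (gamma : R -> point) (t : Z -> R) (M N : Z) : Prop :=
  exists xi : Z -> R, jacobi_field gamma t xi /\
    (exists n, xi n <> 0) /\ xi M = 0 /\ xi N = 0.

Definition without_conjugate_points (ell : R) (gamma : R -> point) : Prop :=
  forall t : Z -> R, configuration ell gamma t ->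
  forall M N : Z, (M < N)%Z -> ~ conjugate gamma t M N.

(* Main.v *)
Require Import Defs.
From Stdlib Require Import Reals ZArith Lra Lia Psatz ClassicalEpsilon.
From Stdlib Require Ranalysis5.
From Coquelicot Require Import Coquelicot.
Open Scope R_scope.

(** Hopf's integral argument. Parametrise the boundary by the angle [theta] of its
    tangent and let [rho] be the radius of curvature. A configuration becomes a
    sequence [theta_n] with [0 < theta_(n+1) - theta_n < PI], and, for fields measured
    in arc length, Jacobi's equation becomes
      [sin (theta_n - theta_(n-1)) eta_(n-1) + sin (theta_(n+1) - theta_n) eta_(n+1)
         = r_n eta_n].
    The field with [eta_0 = 0], [eta_1 = 1] never vanishes again, depends continuously
    on the initial condition, and satisfies [eta_n -> n] when consecutive points
    coalesce ([jfield_lim]); so it stays positive ([jfield_pos]), and the tridiagonal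
    quadratic form of the second variation is nonnegative on every orbit segment
    ([second_variation_bound]).

    Test this form with [eta_n = f (theta_n)] and integrate over the phase space
    against the invariant measure [rho rho sin] ([strip_int_step]). All terms of one
    kind contribute the same amount, so after division by the length of the segment
    only two integrals remain. They can be computed ([strip_int_diag_term],
    [strip_int_cross_term]) and give, with [h = f rho] and [A] the enclosed area,
      [((int h)^2 - (int h cos 2theta)^2 - (int h sin 2theta)^2) / 2 <= A int f^2]
    ([hopf_inequality]). Only finite segments occur, hence only continuous integrands.

    The problem is invariant under linear maps. A suitable one makes
    [int rho^2 cos 2theta] and [int rho^2 sin 2theta] vanish ([good_rotation]); then
    [f = rho] yields [int rho^2 <= 2 A]. But [int rho^2 - 2 A] is the mean of
    [(rho (theta + x) - rho theta)^2] against a nonnegative kernel, positive for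
    [0 < x < PI] ([isoperimetric_deficit]), so [rho] is constant: the image of the
    boundary is a circle, and the boundary is an ellipse. *)

(** * Calculus *)

Definition cont {U : UniformSpace} (f : U -> R) : Prop :=
  forall x, continuous f x.

Lemma cont_const {U : UniformSpace} (c : R) : cont (fun _ : U => c).
Proof. intros x; apply continuous_const. Qed.

Lemma cont_id : cont (fun x : R => x).
Proof. intros x; apply continuous_id. Qed.

Lemma cont_fst : cont (fun p : R * R => fst p).
Proof. intros [x y]; apply continuous_fst. Qed.

Lemma cont_snd : cont (fun p : R * R => snd p).
Proof. intros [x y]; apply continuous_snd. Qed.

Lemma cont_plus {U : UniformSpace} (f g : U -> R) :
  cont f -> cont g -> cont (fun x => f x + g x).
Proof. intros Hf Hg x; apply (continuous_plus f g x); auto. Qed.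

Lemma cont_minus {U : UniformSpace} (f g : U -> R) :
  cont f -> cont g -> cont (fun x => f x - g x).
Proof. intros Hf Hg x; apply (continuous_minus f g x); auto. Qed.

Lemma cont_opp {U : UniformSpace} (f : U -> R) : cont f -> cont (fun x => - f x).
Proof. intros Hf x; apply (continuous_opp f x); auto. Qed.

Lemma cont_mult {U : UniformSpace} (f g : U -> R) :
  cont f -> cont g -> cont (fun x => f x * g x).
Proof. intros Hf Hg x; apply (continuous_mult f g x); auto. Qed.

Lemma cont_pow {U : UniformSpace} (f : U -> R) (n : nat) :
  cont f -> cont (fun x => f x ^ n).
Proof.
intros Hf; induction n as [|n IH]; simpl.
- apply cont_const.
- now apply cont_mult.
Qed.

Lemma cont_comp {U V : UniformSpace} (f : U -> V) (g : V -> R) :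
  (forall x, continuous f x) -> cont g -> cont (fun x => g (f x)).
Proof. intros Hf Hg x; apply continuous_comp; auto; apply Hg. Qed.

Lemma cont_comp1 {U : UniformSpace} (f : U -> R) (g : R -> R) :
  cont g -> cont f -> cont (fun x => g (f x)).
Proof. intros Hg Hf; apply (cont_comp f g Hf Hg). Qed.

Lemma continuous_pair {U V W : UniformSpace} (f : U -> V) (g : U -> W) (x : U) :
  continuous f x -> continuous g x -> continuous (fun y => (f y, g y)) x.
Proof.
intros Hf Hg; apply filterlim_locally; intros e.
generalize (filter_and _ _ (proj1 (filterlim_locally f (f x)) Hf e)
                          (proj1 (filterlim_locally g (g x)) Hg e)).
apply filter_imp; intros y [H1 H2]; now split.
Qed.

Lemma cont_comp2 {U : UniformSpace} (f g : U -> R) (F : R * R -> R) :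
  cont F -> cont f -> cont g -> cont (fun x => F (f x, g x)).
Proof.
intros HF Hf Hg x; apply (continuous_comp (fun y => (f y, g y)) F).
- apply continuous_pair; [apply Hf | apply Hg].
- apply HF.
Qed.

Lemma cont_sin : cont sin. Proof. intros x; apply continuous_sin. Qed.
Lemma cont_cos : cont cos. Proof. intros x; apply continuous_cos. Qed.

Lemma cont_div {U : UniformSpace} (f g : U -> R) :
  cont f -> cont g -> (forall x, g x <> 0) -> cont (fun x => f x / g x).
Proof.
intros Hf Hg Hn x; apply (continuous_mult f (fun y => / g y) x).
- apply Hf.
- apply (continuous_comp g Rinv); [apply Hg | apply continuous_Rinv, Hn].
Qed.

Lemma cont_ext {U : UniformSpace} (f g : U -> R) :
  (forall x, f x = g x) -> cont f -> cont g.
Proof. intros E Hf x; apply (continuous_ext f g x E), Hf. Qed.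

Lemma is_derive_cont (f df : R -> R) :
  (forall x, is_derive f x (df x)) -> cont f.
Proof. intros H x; apply (ex_derive_continuous f x); exists (df x); apply H. Qed.

Ltac cts :=
  repeat (try assumption; match goal with
    | |- cont (fun _ => ?c) => apply (cont_const c)
    | |- cont (fun x => x) => apply cont_id
    | |- cont (fun p => fst p) => apply cont_fst
    | |- cont (fun p => snd p) => apply cont_snd
    | |- cont fst => apply cont_fst
    | |- cont snd => apply cont_snd
    | |- cont sin => apply cont_sin
    | |- cont cos => apply cont_cos
    | |- cont (fun x => @?f x + @?g x) => apply (cont_plus f g)
    | |- cont (fun x => @?f x - @?g x) => apply (cont_minus f g)
    | |- cont (fun x => - @?f x) => apply (cont_opp f)
    | |- cont (fun x => @?f x * @?g x) => apply (cont_mult f g)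
    | |- cont (fun x => @?f x ^ ?n) => apply (cont_pow f n)
    | |- cont (fun x => sin (@?f x)) => apply (cont_comp1 f sin cont_sin)
    | |- cont (fun x => cos (@?f x)) => apply (cont_comp1 f cos cont_cos)
    | H : cont ?g |- cont (fun x => ?g (@?f x, @?h x)) => apply (cont_comp2 f h g H)
    | H : cont ?g |- cont (fun x => ?g (@?f x)) => apply (cont_comp1 f g H)
    end).

Lemma cont_ex_RInt (f : R -> R) (a b : R) : cont f -> ex_RInt f a b.
Proof. intros H; apply (ex_RInt_continuous (V := R_CompleteNormedModule)); auto. Qed.

Lemma cont_RInt_derive (f : R -> R) (a x : R) :
  cont f -> is_derive (fun b => RInt f a b) x (f x).
Proof.
intros H; apply (is_derive_RInt f _ a).
- apply filter_forall; intros b; apply (RInt_correct (V := R_CompleteNormedModule)).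
  now apply cont_ex_RInt.
- apply H.
Qed.

Lemma RInt_ext' (f g : R -> R) (a b : R) :
  (forall x, f x = g x) -> RInt f a b = RInt g a b.
Proof. intros E; apply RInt_ext; intros x _; apply E. Qed.

Lemma RInt_plus' (f g : R -> R) (a b : R) : cont f -> cont g ->
  RInt (fun x => f x + g x) a b = RInt f a b + RInt g a b.
Proof. intros Hf Hg; apply (RInt_plus f g); now apply cont_ex_RInt. Qed.

Lemma RInt_minus' (f g : R -> R) (a b : R) : cont f -> cont g ->
  RInt (fun x => f x - g x) a b = RInt f a b - RInt g a b.
Proof. intros Hf Hg; apply (RInt_minus f g); now apply cont_ex_RInt. Qed.

Lemma RInt_scal' (f : R -> R) (a b l : R) : cont f ->
  RInt (fun x => l * f x) a b = l * RInt f a b.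
Proof. intros Hf; apply (RInt_scal f); now apply cont_ex_RInt. Qed.

Lemma RInt_opp' (f : R -> R) (a b : R) : cont f ->
  RInt (fun x => - f x) a b = - RInt f a b.
Proof. intros Hf; apply (RInt_opp f); now apply cont_ex_RInt. Qed.

Lemma RInt_const' (a b c : R) : RInt (fun _ => c) a b = (b - a) * c.
Proof. rewrite RInt_const; reflexivity. Qed.

Lemma RInt_Chasles' (f : R -> R) (a b c : R) : cont f ->
  RInt f a b + RInt f b c = RInt f a c.
Proof. intros Hf; apply (RInt_Chasles f); now apply cont_ex_RInt. Qed.


Lemma RInt_of_derive (f df : R -> R) (a b : R) :
  (forall x, is_derive f x (df x)) -> cont df -> RInt df a b = f b - f a.
Proof.
intros H1 H2; apply is_RInt_unique, (is_RInt_derive f df); intros x _.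
- apply H1.
- apply H2.
Qed.

Lemma RInt_shift (f : R -> R) (a b v : R) : cont f ->
  RInt (fun x => f (x + v)) a b = RInt f (a + v) (b + v).
Proof.
intros Hf.
replace (a + v) with (1 * a + v) by ring; replace (b + v) with (1 * b + v) by ring.
rewrite <- (RInt_comp_lin f 1 v a b) by now apply cont_ex_RInt.
apply RInt_ext'; intros x; unfold scal; simpl; unfold mult; simpl.
rewrite !Rmult_1_l; reflexivity.
Qed.

Lemma RInt_reflect (f : R -> R) (a b v : R) : cont f ->
  RInt (fun x => f (v - x)) a b = RInt f (v - b) (v - a).
Proof.
intros Hf.
rewrite <- (opp_RInt_swap f) by now apply cont_ex_RInt.
replace (v - a) with (-1 * a + v) by ring; replace (v - b) with (-1 * b + v) by ring.
rewrite <- (RInt_comp_lin f (-1) v a b) by now apply cont_ex_RInt.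
rewrite <- (RInt_opp (V := R_CompleteNormedModule)).
- apply RInt_ext'; intros x; unfold scal, opp; simpl; unfold mult; simpl.
  replace (-1 * x + v) with (v - x) by ring; ring.
- apply cont_ex_RInt; unfold scal; simpl; unfold mult; simpl; cts.
Qed.

Lemma cont_RInt_nonneg (f : R -> R) (a b : R) : a <= b -> cont f ->
  (forall x, a <= x <= b -> 0 <= f x) -> 0 <= RInt f a b.
Proof.
intros Hab Hf Hp; apply RInt_ge_0; auto.
- now apply cont_ex_RInt.
- intros x Hx; apply Hp; lra.
Qed.

Lemma cont_locally_pos {U : UniformSpace} (f : U -> R) (x : U) :
  continuous f x -> 0 < f x -> locally x (fun y => 0 < f y).
Proof.
intros Hf Hx; apply (Hf (fun z => 0 < z)).
exists (mkposreal _ Hx); intros z Hz; apply Rabs_lt_between' in Hz; simpl in Hz; lra.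
Qed.

Lemma RInt_zero_nonneg (f : R -> R) (a b : R) : cont f ->
  (forall x, a <= x <= b -> 0 <= f x) -> RInt f a b = 0 ->
  forall x, a < x < b -> f x = 0.
Proof.
intros Hf Hp H0 c Hc.
destruct (Req_dec (f c) 0) as [E|E]; [exact E|exfalso].
assert (Hc0 : 0 < f c) by (assert (H := Hp c ltac:(lra)); lra).
destruct (cont_locally_pos f c (Hf c) Hc0) as [e He].
set (d := Rmin (e / 2) (Rmin (c - a) (b - c))).
assert (d <= e / 2) by apply Rmin_l.
assert (d <= c - a) by (eapply Rle_trans; [apply Rmin_r | apply Rmin_l]).
assert (d <= b - c) by (eapply Rle_trans; [apply Rmin_r | apply Rmin_r]).
assert (He0 := cond_pos e).
assert (0 < d) by (unfold d; repeat apply Rmin_glb_lt; lra).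
rewrite <- (RInt_Chasles' f a (c - d) b Hf), <- (RInt_Chasles' f (c - d) (c + d) b Hf) in H0.
assert (0 <= RInt f a (c - d)) by (apply cont_RInt_nonneg; [lra | auto | intros; apply Hp; lra]).
assert (0 <= RInt f (c + d) b) by (apply cont_RInt_nonneg; [lra | auto | intros; apply Hp; lra]).
assert (0 < RInt f (c - d) (c + d)).
{ apply RInt_gt_0; [lra | | intros; apply Hf].
  intros x Hx; apply He; apply Rabs_lt_between'; lra. }
lra.
Qed.

Lemma cont_2d (F : R * R -> R) (x y : R) : cont F ->
  continuity_2d_pt (fun u v => F (u, v)) x y.
Proof.
intros H; apply continuity_2d_pt_filterlim.
apply (filterlim_ext F); [now intros [u v] | apply (H (x, y))].
Qed.

(** Uniform continuity on a compact strip. *)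
Lemma cont_RInt_param (F : R * R -> R) (c d : R) : cont F ->
  cont (fun x => RInt (fun y => F (x, y)) c d).
Proof.
intros HF.
assert (W : forall a b, a <= b -> cont (fun x => RInt (fun y => F (x, y)) a b)).
{ intros a b Hab x; apply filterlim_locally; intros e.
  assert (He : 0 < e / (b - a + 1)) by (apply Rdiv_lt_0_compat; [apply cond_pos | lra]).
  destruct (uniform_continuity_2d_1d' (fun u v => F (u, v)) a b x
    (fun y _ => cont_2d F x y HF) (mkposreal _ He)) as [del Hd]; simpl in Hd.
  assert (Hdp := cond_pos del).
  exists del; intros u Hu; apply Rabs_lt_between' in Hu.
  change (Rabs (RInt (fun y => F (u, y)) a b - RInt (fun y => F (x, y)) a b) < e).
  rewrite <- RInt_minus' by cts.
  eapply Rle_lt_trans.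
  { apply (abs_RInt_le_const _ _ _ (e / (b - a + 1))); auto.
    - apply cont_ex_RInt; cts.
    - intros y Hy; apply Rlt_le, (Hd y x y u); try lra.
      rewrite Rminus_diag, Rabs_R0; lra. }
  assert (Hep := cond_pos e).
  apply (Rmult_lt_reg_r (b - a + 1)); [lra|].
  replace ((b - a) * (e / (b - a + 1)) * (b - a + 1)) with ((b - a) * e) by (field; lra).
  nra. }
destruct (Rle_dec c d) as [H|H]; [now apply W|].
apply (cont_ext (fun x => - RInt (fun y => F (x, y)) d c)).
- intros x; apply (opp_RInt_swap (fun y => F (x, y)) d c).
  apply cont_ex_RInt; cts.
- apply cont_opp, W; lra.
Qed.

Lemma cont_RInt_param' (F : R * R -> R) (a b : R) : cont F ->
  cont (fun y => RInt (fun x => F (x, y)) a b).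
Proof.
intros HF; apply (cont_RInt_param (fun p => F (snd p, fst p))); cts.
Qed.

(** Both sides have the same derivative in [b]: on the right one may differentiate
    under the integral sign. *)
Lemma fubini (F : R * R -> R) (a b c d : R) : cont F ->
  RInt (fun x => RInt (fun y => F (x, y)) c d) a b =
  RInt (fun y => RInt (fun x => F (x, y)) a b) c d.
Proof.
intros HF.
set (H := fun t => RInt (fun y => RInt (fun x => F (x, y)) a t) c d).
assert (HD : forall t y, Derive (fun z => RInt (fun x => F (x, y)) a z) t = F (t, y)).
{ intros t y; apply is_derive_unique, (cont_RInt_derive (fun x => F (x, y))); cts. }
assert (E : RInt (fun x => RInt (fun y => F (x, y)) c d) a b = H b - H a).
{ apply (RInt_of_derive H).
  - intros t; unfold H.
    rewrite (RInt_ext' _ (fun y => Derive (fun z => RInt (fun x => F (x, y)) a z) t))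
      by (intros y; now rewrite HD).
    apply (is_derive_RInt_param (fun t y => RInt (fun x => F (x, y)) a t)).
    + apply filter_forall; intros s y _; exists (F (s, y)).
      apply (cont_RInt_derive (fun x => F (x, y))); cts.
    + intros y _; apply (continuity_2d_pt_ext (fun u v => F (u, v))).
      * intros; now rewrite HD.
      * now apply cont_2d.
    + apply filter_forall; intros s; apply cont_ex_RInt.
      apply cont_RInt_param'; auto.
  - apply cont_RInt_param; auto. }
rewrite E; unfold H.
rewrite (RInt_ext' (fun y => RInt (fun x => F (x, y)) a a) (fun _ => 0))
  by (intros y; apply (RInt_point (V := R_CompleteNormedModule))).
rewrite RInt_const', Rmult_0_r; apply Rminus_0_r.
Qed.

Lemma is_derive_eq (f : R -> R) (x a b : R) : is_derive f x a -> a = b -> is_derive f x b.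
Proof. now intros H <-. Qed.

Lemma is_derive_chain (f g : R -> R) (x a b c : R) :
  is_derive f (g x) a -> is_derive g x b -> a * b = c ->
  is_derive (fun y => f (g y)) x c.
Proof.
intros Hf Hg <-; apply (is_derive_eq _ _ (scal b a)).
- apply (is_derive_comp f g x a b Hf Hg).
- apply Rmult_comm.
Qed.

Lemma increasing_of_derive (f df : R -> R) (a b : R) :
  (forall x, is_derive f x (df x)) -> (forall x, a < x < b -> 0 < df x) ->
  forall x y, a <= x -> x < y -> y <= b -> f x < f y.
Proof.
intros Hf Hp x y Hx Hxy Hy.
destruct (MVT_cor2 f df x y Hxy) as [c [E Hc]].
- intros c _; apply is_derive_Reals, Hf.
- assert (W := Hp c ltac:(lra)).
  assert (0 < df c * (y - x)) by (apply Rmult_lt_0_compat; lra); lra.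
Qed.

(** Applied below with [q = 1 - cos] and [q = sin], for which [q y] is what [f y]
    would be on a unit circle; [r c] is then a radius of curvature along the arc. *)
Lemma cauchy_mean (f q r dq : R -> R) (y : R) : 0 < y ->
  (forall u, is_derive f u (r u * dq u)) -> (forall u, is_derive q u (dq u)) ->
  (forall u, 0 < u < y -> 0 < dq u) -> f 0 = 0 -> q 0 = 0 ->
  exists c, 0 < c < y /\ f y = r c * q y.
Proof.
intros Hy Hf Hq Hp f0 q0.
destruct (MVT_cor2 (fun u => f u * q y - f y * q u)
  (fun u => r u * dq u * q y - f y * dq u) 0 y Hy) as [c [E Hc]].
- intros c _; apply is_derive_Reals.
  apply (is_derive_minus (fun u => f u * q y) (fun u => f y * q u)).
  + evar_last; [apply (is_derive_scal_l f c _ (q y) (Hf c)) | reflexivity].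
  + apply (is_derive_scal q c (f y) _ (Hq c)).
- exists c; split; auto.
  rewrite f0, q0 in E.
  assert (W := Hp c Hc).
  assert (E2 : dq c * (r c * q y - f y) * y = 0) by lra.
  apply Rmult_integral in E2; destruct E2 as [E2|E2]; [|lra].
  apply Rmult_integral in E2; destruct E2 as [E2|E2]; lra.
Qed.

Lemma int_product_derive (f g df dg : R -> R) (T : R) :
  (forall t, is_derive f t (df t)) -> (forall t, is_derive g t (dg t)) ->
  cont df -> cont dg -> f T = f 0 -> g T = g 0 ->
  RInt (fun t => f t * dg t) 0 T = - RInt (fun t => g t * df t) 0 T.
Proof.
intros Hf Hg Cf Cg Ef Eg.
assert (Cf' := is_derive_cont _ _ Hf); assert (Cg' := is_derive_cont _ _ Hg).
assert (E : RInt (fun t => f t * dg t + g t * df t) 0 T = f T * g T - f 0 * g 0).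
{ apply (RInt_of_derive (fun t => f t * g t)); [|cts].
  intros t; apply (is_derive_eq _ _ (df t * g t + f t * dg t)); [|ring].
  apply (is_derive_mult f g t _ _ (Hf t) (Hg t)); intros; apply Rmult_comm. }
rewrite RInt_plus', Ef, Eg in E by cts; lra.
Qed.

Lemma const_of_derive (f : R -> R) : (forall t, is_derive f t 0) -> forall s t, f s = f t.
Proof.
intros H s t.
assert (E := RInt_of_derive f (fun _ => 0) t s H (cont_const 0)).
rewrite RInt_const' in E; lra.
Qed.

(** [f] times [exp] of minus a primitive of [m] has derivative zero. *)
Lemma linear_ode (m f : R -> R) : cont m ->
  (forall t, is_derive f t (m t * f t)) ->
  forall t, f t = f 0 * exp (RInt m 0 t).
Proof.
intros Cm Hf t.
set (M := fun t => RInt m 0 t).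
assert (HM : forall t, is_derive M t (m t)) by (intros u; now apply cont_RInt_derive).
assert (E : f t * exp (- M t) = f 0 * exp (- M 0)).
{ apply (const_of_derive (fun t => f t * exp (- M t))); intros u.
  apply (is_derive_eq _ _ ((m u * f u) * exp (- M u) + f u * (exp (- M u) * - m u))); [|ring].
  apply (is_derive_mult f (fun t => exp (- M t))); [apply Hf | | intros; apply Rmult_comm].
  apply (is_derive_chain exp (fun t => - M t) u (exp (- M u)) (- m u)); auto.
  - apply is_derive_exp.
  - apply (is_derive_opp M), HM. }
assert (M0 : M 0 = 0) by apply (RInt_point (V := R_CompleteNormedModule)).
rewrite M0, Ropp_0, exp_0, Rmult_1_r in E.
rewrite <- E; fold (M t); rewrite Rmult_assoc, <- exp_plus.
replace (- M t + M t) with 0 by ring; rewrite exp_0; ring.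
Qed.

(** The polar angle is [acos] of the first coordinate, up to sign. *)
Lemma polar_form (a b : R) : exists r phi, 0 <= r /\ a = r * cos phi /\ b = r * sin phi.
Proof.
set (r := sqrt (a ^ 2 + b ^ 2)).
assert (N : 0 <= a ^ 2 + b ^ 2) by nra.
assert (r0 : 0 <= r) by apply sqrt_pos.
assert (r2 : r * r = a ^ 2 + b ^ 2) by (apply sqrt_sqrt; auto).
destruct (Req_dec r 0) as [Z|Z].
{ exists 0, 0; rewrite Z in r2; split; [lra|]; split; nra. }
assert (rp : 0 < r) by lra.
assert (B : -1 <= a / r <= 1).
{ split; apply (Rmult_le_reg_r r); auto; replace (a / r * r) with a by (field; lra); nra. }
assert (C := cos_acos _ B); assert (S := sin_acos _ B).
assert (E : sqrt (1 - (a / r)²) = Rabs b / r).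
{ rewrite <- (sqrt_Rsqr (Rabs b / r)) by (apply Rle_div_r; auto; rewrite Rmult_0_l; apply Rabs_pos).
  f_equal; unfold Rsqr.
  replace (Rabs b / r * (Rabs b / r)) with (Rabs b * Rabs b / (r * r)) by (field; auto).
  rewrite <- Rabs_mult, (Rabs_pos_eq (b * b)) by nra.
  replace (b * b) with (r * r - a * a) by nra; field; auto. }
rewrite E in S.
destruct (Rle_dec 0 b) as [Hb|Hb].
- exists r, (acos (a / r)); split; auto; rewrite C, S, Rabs_pos_eq by auto; split; field; auto.
- exists r, (- acos (a / r)); split; auto; rewrite cos_neg, sin_neg, C, S, Rabs_left by lra.
  split; field; auto.
Qed.

Lemma sign_near_zero (f : R -> R) (t l : R) : is_derive f t l -> f t = 0 -> 0 < l ->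
  exists d, 0 < d /\ (forall s, t < s < t + d -> 0 < f s) /\ (forall s, t - d < s < t -> f s < 0).
Proof.
intros Hf Hz Hl.
apply is_derive_Reals in Hf.
destruct (Hf (l / 2) ltac:(lra)) as [d Hd].
exists d; split; [apply cond_pos|].
assert (K : forall s, s <> t -> Rabs (s - t) < d -> l / 2 < f s / (s - t)).
{ intros s Hs Hsd; assert (A := Hd (s - t) ltac:(lra) Hsd).
  replace (t + (s - t)) with s in A by ring; rewrite Hz, Rminus_0_r in A.
  apply Rabs_lt_between' in A; lra. }
split; intros s Hs.
- assert (A := K s ltac:(lra) ltac:(apply Rabs_lt_between'; lra)).
  replace (f s) with (f s / (s - t) * (s - t)) by (field; lra).
  apply Rmult_lt_0_compat; lra.
- assert (A := K s ltac:(lra) ltac:(apply Rabs_lt_between'; lra)).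
  replace (f s) with (- (f s / (s - t) * (t - s))) by (field; lra).
  assert (0 < f s / (s - t) * (t - s)) by (apply Rmult_lt_0_compat; lra); lra.
Qed.

Lemma Derive_n2_comb (f g : R -> R) (u v t : R) :
  (forall t, ex_derive f t) -> (forall t, ex_derive g t) ->
  ex_derive (Derive f) t -> ex_derive (Derive g) t ->
  Derive_n (fun s => u * f s - v * g s) 2 t = u * Derive_n f 2 t - v * Derive_n g 2 t.
Proof.
intros Hf Hg Hf2 Hg2; simpl.
rewrite (Derive_ext _ (fun s => u * Derive f s - v * Derive g s)).
- rewrite Derive_minus, !Derive_scal; auto; now apply ex_derive_scal.
- intros s; rewrite Derive_minus, !Derive_scal; auto; now apply ex_derive_scal.
Qed.

Lemma Derive_comb (f g : R -> R) (u v t : R) : ex_derive f t -> ex_derive g t ->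
  Derive (fun s => u * f s - v * g s) t = u * Derive f t - v * Derive g t.
Proof.
intros Hf Hg; rewrite Derive_minus, !Derive_scal; auto; now apply ex_derive_scal.
Qed.

(** The conditions [F (t, y - e) < z < F (t, y + e)] are open in [(t, z)], so the inverse
    is continuous in both variables. *)
Lemma cont_inverse (F : R * R -> R) : cont F ->
  (forall t y z, y < z -> F (t, y) < F (t, z)) ->
  (forall t z, exists y, F (t, y) = z) ->
  exists inv : R * R -> R, cont inv /\ (forall t z, F (t, inv (t, z)) = z) /\
    (forall t y, inv (t, F (t, y)) = y).
Proof.
intros HF Hinc Honto.
assert (C : forall p : R * R, {y | F (fst p, y) = snd p}).
{ intros p; apply constructive_indefinite_description, Honto. }
set (inv := fun p => proj1_sig (C p)).
assert (HI : forall t z, F (t, inv (t, z)) = z) by (intros t z; apply (proj2_sig (C (t, z)))).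
assert (Hlt : forall t y z, F (t, y) < F (t, z) -> y < z).
{ intros t y z H; destruct (Rtotal_order y z) as [L|[L|L]]; auto.
  - subst; lra.
  - apply (Hinc t) in L; lra. }
exists inv; split; [|split]; auto.
- assert (W : forall (t z : R) (e : posreal),
    locally (t, z) (fun p => Rabs (inv p - inv (t, z)) < e));
    [|intros [t z]; apply filterlim_locally; intros e; apply (W t z e)].
  intros t z e.
  assert (He := cond_pos e).
  assert (Hy := HI t z); set (y := inv (t, z)) in *; clearbody y.
  assert (L1 : locally (t, z) (fun p => 0 < snd p - F (fst p, y - e))).
  { apply (cont_locally_pos (fun p => snd p - F (fst p, y - e))).
    - assert (W : cont (fun p : R * R => snd p - F (fst p, y - e))) by cts; apply W.
    - simpl; assert (W : F (t, y - e) < F (t, y)) by (apply Hinc; lra); lra. }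
  assert (L2 : locally (t, z) (fun p => 0 < F (fst p, y + e) - snd p)).
  { apply (cont_locally_pos (fun p => F (fst p, y + e) - snd p)).
    - assert (W : cont (fun p : R * R => F (fst p, y + e) - snd p)) by cts; apply W.
    - simpl; assert (W : F (t, y) < F (t, y + e)) by (apply Hinc; lra); lra. }
  generalize (filter_and _ _ L1 L2); apply filter_imp; intros [t' z'] [H1 H2]; simpl in *.
  assert (HI' := HI t' z').
  assert (A1 := Hlt t' (y - e) (inv (t', z')) ltac:(lra)).
  assert (A2 := Hlt t' (inv (t', z')) (y + e) ltac:(lra)).
  apply Rabs_lt_between'; lra.
- intros t y.
  assert (H := HI t (F (t, y))).
  destruct (Rtotal_order (inv (t, F (t, y))) y) as [L|[L|L]]; auto;
    apply (Hinc t) in L; lra.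
Qed.


(** Gives back the type [R] to an equation stated through a canonical structure. *)
Ltac real_eq := match goal with |- @eq _ ?a ?b => change (@eq R a b) end.

(** * Periodic functions *)

Definition periodic (T : R) (f : R -> R) : Prop := forall x, f (x + T) = f x.

Lemma periodic_Z (T : R) (f : R -> R) : periodic T f ->
  forall (k : Z) x, f (x + IZR k * T) = f x.
Proof.
intros Hf.
assert (W : forall (n : nat) x, f (x + INR n * T) = f x).
{ induction n as [|n IH]; intros x.
  - f_equal; simpl; ring.
  - rewrite S_INR; replace (x + (INR n + 1) * T) with (x + INR n * T + T) by ring.
    now rewrite Hf. }
intros k x; destruct (Z_le_dec 0 k) as [H|H].
- rewrite <- (Z2Nat.id k H), <- INR_IZR_INZ; apply W.
- rewrite <- (W (Z.to_nat (- k))); f_equal.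
  rewrite INR_IZR_INZ, Z2Nat.id, opp_IZR by lia; ring.
Qed.

Lemma period_shift (T : R) : 0 < T -> forall a t : R, exists k : Z, a <= t + IZR k * T < a + T.
Proof.
intros HT a t; exists (1 - up ((t - a) / T))%Z.
destruct (archimed ((t - a) / T)) as [A B].
assert (E : t - a = (t - a) / T * T) by (field; lra).
rewrite minus_IZR.
set (q := (t - a) / T) in *; clearbody q; set (u := IZR (up q)) in *; clearbody u.
apply (Rmult_lt_compat_r T) in A; [|lra].
apply (Rmult_le_compat_r T) in B; [|lra].
lra.
Qed.

Lemma cos_per : periodic (2 * PI) cos.
Proof. intros x; rewrite <- (cos_period x 1); f_equal; simpl; ring. Qed.
Lemma sin_per : periodic (2 * PI) sin.
Proof. intros x; rewrite <- (sin_period x 1); f_equal; simpl; ring. Qed.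

Lemma derive_periodic (f df : R -> R) (T : R) :
  (forall t, is_derive f t (df t)) -> periodic T f -> periodic T df.
Proof.
intros Hf HT t.
assert (E : is_derive f t (df (t + T))).
{ apply (is_derive_ext (fun u => f (u + T))); [apply HT|].
  apply (is_derive_chain f (fun u => u + T) t (df (t + T)) 1); [apply Hf | auto_derive; auto | ring]. }
rewrite <- (is_derive_unique _ _ _ E); apply is_derive_unique, Hf.
Qed.

(** The piece over [(T, a + T)] replaces the one over [(0, a)]. *)
Lemma RInt_periodic (T : R) (f : R -> R) (a : R) :
  cont f -> periodic T f -> RInt f a (a + T) = RInt f 0 T.
Proof.
intros Hf HT.
rewrite <- (RInt_Chasles' f a 0 (a + T) Hf), <- (RInt_Chasles' f 0 T (a + T) Hf).
assert (E : RInt f T (a + T) = RInt f 0 a).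
{ transitivity (RInt f (0 + T) (a + T)); [now rewrite Rplus_0_l|].
  rewrite <- (RInt_shift f 0 a T Hf); apply RInt_ext'; apply HT. }
rewrite E.
assert (E2 : RInt f a 0 + RInt f 0 a = 0).
{ rewrite RInt_Chasles' by auto; apply (RInt_point (V := R_CompleteNormedModule)). }
lra.
Qed.

(** This exchanges the two ends of a chord: a pair (first angle, difference) becomes
    (second angle, difference). For fixed [x] it is a translation of a periodic
    function. *)
Lemma strip_shear (T : R) (F : R * R -> R) (c d : R) : cont F ->
  (forall t x, F (t + T, x) = F (t, x)) ->
  RInt (fun t => RInt (fun x => F (t + x, x)) c d) 0 T =
  RInt (fun t => RInt (fun x => F (t, x)) c d) 0 T.
Proof.
intros HF HT.
rewrite (fubini (fun p => F (fst p + snd p, snd p))) by cts; simpl.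
rewrite (fubini F) by auto.
apply RInt_ext'; intros x.
rewrite (RInt_shift (fun t => F (t, x)) 0 T x) by cts.
replace (0 + x) with x by ring; replace (T + x) with (x + T) by ring.
apply (RInt_periodic T (fun t => F (t, x))); [cts | intros t; apply HT].
Qed.

(** * Two-sided sequences *)

(** Used for the orbits of the billiard and for its Jacobi fields. *)
Lemma Z_sequence {X : Type} (P : X -> Prop) (f g : Z -> X -> X) (x0 : X) :
  P x0 -> (forall n x, P x -> P (f n x)) ->
  (forall n x, P x -> P (g n x) /\ f n (g n x) = x) ->
  exists s : Z -> X, s 0%Z = x0 /\ forall n, P (s n) /\ s (n + 1)%Z = f n (s n).
Proof.
intros H0 Hf Hg.
set (F := fix F n := match n with O => x0 | S k => f (Z.of_nat k) (F k) end).
set (B := fix B n := match n with O => x0 | S k => g (- Z.of_nat (S k))%Z (B k) end).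
assert (PF : forall n, P (F n)) by (induction n; simpl; auto).
assert (PB : forall n, P (B n)) by (induction n; simpl; [auto | now apply Hg]).
exists (fun n => if (0 <=? n)%Z then F (Z.to_nat n) else B (Z.to_nat (- n))); split.
- reflexivity.
- intros n; split; [destruct (0 <=? n)%Z; auto|].
  destruct (Z.leb_spec 0 n) as [L|L].
  + replace (0 <=? n + 1)%Z with true by (symmetry; apply Z.leb_le; lia).
    replace (Z.to_nat (n + 1)) with (S (Z.to_nat n)) by lia; simpl.
    now rewrite Z2Nat.id by lia.
  + set (k := Z.to_nat (- (n + 1))).
    replace (Z.to_nat (- n)) with (S k) by (unfold k; lia).
    change (B (S k)) with (g (- Z.of_nat (S k))%Z (B k)).
    replace (- Z.of_nat (S k))%Z with n by (unfold k; lia).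
    rewrite (proj2 (Hg n (B k) (PB k))).
    destruct (Z.leb_spec 0 (n + 1)) as [L'|L']; [|reflexivity].
    unfold k; replace (n + 1)%Z with 0%Z by lia; reflexivity.
Qed.

(** * Ovals parametrised by the tangent angle *)

Lemma cont_Rabs : cont Rabs.
Proof. intros x; apply continuous_Rabs. Qed.

Lemma Rmin_abs (a b : R) : Rmin a b = (a + b - Rabs (a - b)) / 2.
Proof. unfold Rmin, Rabs; destruct (Rle_dec a b), (Rcase_abs (a - b)); lra. Qed.

Lemma Rmax_abs (a b : R) : Rmax a b = (a + b + Rabs (a - b)) / 2.
Proof. unfold Rmax, Rabs; destruct (Rle_dec a b), (Rcase_abs (a - b)); lra. Qed.

(** Truncation to the range of the angle difference of two consecutive points. *)
Definition clamp (y : R) : R := Rmax 0 (Rmin y PI).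

Lemma clamp_cont : cont clamp.
Proof.
assert (W := cont_Rabs).
apply (cont_ext (fun y => (0 + (y + PI - Rabs (y - PI)) / 2 +
   Rabs (0 - (y + PI - Rabs (y - PI)) / 2)) / 2)).
- intros y; unfold clamp; now rewrite Rmax_abs, Rmin_abs.
- apply cont_mult; [|cts].
  assert (cont (fun y => (y + PI - Rabs (y - PI)) / 2)) by (apply cont_mult; cts).
  cts.
Qed.

Ltac clamp_cases := unfold clamp, Rmax, Rmin; repeat destruct Rle_dec.

Lemma clamp_in (y : R) : 0 <= y <= PI -> clamp y = y.
Proof. clamp_cases; lra. Qed.

Lemma clamp_range (y : R) : 0 <= clamp y <= PI.
Proof. assert (H := PI_RGT_0); clamp_cases; lra. Qed.

Lemma clamp_low (y : R) : y <= 0 -> clamp y = 0.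
Proof. assert (H := PI_RGT_0); clamp_cases; lra. Qed.

Lemma clamp_high (y : R) : PI <= y -> clamp y = PI.
Proof. assert (H := PI_RGT_0); clamp_cases; lra. Qed.

Lemma clamp_mono (y z : R) : y < z ->
  clamp y <= clamp z /\ y - clamp y <= z - clamp z.
Proof. assert (H := PI_RGT_0); clamp_cases; lra. Qed.

Section Oval.

Variable rho : R -> R.
Hypothesis rho_cont : cont rho.
Hypothesis rho_pos : forall t, 0 < rho t.
Hypothesis rho_per : periodic (2 * PI) rho.
Hypothesis closed_x : RInt (fun u => rho u * cos u) 0 (2 * PI) = 0.
Hypothesis closed_y : RInt (fun u => rho u * sin u) 0 (2 * PI) = 0.

(** [(gx, gy)] is the closed curve, starting at the origin, with tangent angle [t] and
    radius of curvature [rho t]. *)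
Definition gx (t : R) : R := RInt (fun u => rho u * cos u) 0 t.
Definition gy (t : R) : R := RInt (fun u => rho u * sin u) 0 t.

Lemma gx_derive (t : R) : is_derive gx t (rho t * cos t).
Proof. apply (cont_RInt_derive (fun u => rho u * cos u)); cts. Qed.
Lemma gy_derive (t : R) : is_derive gy t (rho t * sin t).
Proof. apply (cont_RInt_derive (fun u => rho u * sin u)); cts. Qed.

Lemma gx_cont : cont gx.
Proof. apply (is_derive_cont _ _ gx_derive). Qed.
Lemma gy_cont : cont gy.
Proof. apply (is_derive_cont _ _ gy_derive). Qed.

Lemma gx_per : periodic (2 * PI) gx.
Proof.
intros t; unfold gx.
rewrite <- (RInt_Chasles' _ 0 t) by cts.
rewrite (RInt_periodic (2 * PI)), closed_x by (cts || intros x; now rewrite rho_per, cos_per).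
ring.
Qed.
Lemma gy_per : periodic (2 * PI) gy.
Proof.
intros t; unfold gy.
rewrite <- (RInt_Chasles' _ 0 t) by cts.
rewrite (RInt_periodic (2 * PI)), closed_y by (cts || intros x; now rewrite rho_per, sin_per).
ring.
Qed.

(** Components of the chord from [t] to [s] along the tangent at [t] and along the
    inner normal at [t]. *)
Definition along (t s : R) : R := cos t * (gx s - gx t) + sin t * (gy s - gy t).
Definition above (t s : R) : R := cos t * (gy s - gy t) - sin t * (gx s - gx t).

Lemma along_derive (t s : R) : is_derive (along t) s (rho s * cos (s - t)).
Proof.
unfold along; auto_derive.
- split; [exists (rho s * cos s); apply gx_derive|].
  split; [exists (rho s * sin s); apply gy_derive | auto].
- rewrite (is_derive_unique (fun x : R => gx x) s _ (gx_derive s) : Derive (fun x : R => gx x) s = _).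
  rewrite (is_derive_unique (fun x : R => gy x) s _ (gy_derive s) : Derive (fun x : R => gy x) s = _).
  rewrite cos_minus; ring.
Qed.

Lemma above_derive (t s : R) : is_derive (above t) s (rho s * sin (s - t)).
Proof.
unfold above; auto_derive.
- split; [exists (rho s * sin s); apply gy_derive|].
  split; [exists (rho s * cos s); apply gx_derive | auto].
- rewrite (is_derive_unique (fun x : R => gx x) s _ (gx_derive s) : Derive (fun x : R => gx x) s = _).
  rewrite (is_derive_unique (fun x : R => gy x) s _ (gy_derive s) : Derive (fun x : R => gy x) s = _).
  rewrite sin_minus; ring.
Qed.

Lemma above_cont {U : UniformSpace} (f g : U -> R) :
  cont f -> cont g -> cont (fun p => above (f p) (g p)).
Proof. intros Hf Hg; assert (H1 := gx_cont); assert (H2 := gy_cont); unfold above; cts. Qed.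

Lemma along_cont {U : UniformSpace} (f g : U -> R) :
  cont f -> cont g -> cont (fun p => along (f p) (g p)).
Proof. intros Hf Hg; assert (H1 := gx_cont); assert (H2 := gy_cont); unfold along; cts. Qed.

Lemma above_self t : above t t = 0.
Proof. unfold above; ring. Qed.
Lemma along_self t : along t t = 0.
Proof. unfold along; ring. Qed.

Lemma above_per_r t s : above t (s + 2 * PI) = above t s.
Proof. unfold above; now rewrite gx_per, gy_per. Qed.
Lemma above_per t s : above (t + 2 * PI) (s + 2 * PI) = above t s.
Proof. unfold above; now rewrite !gx_per, !gy_per, cos_per, sin_per. Qed.
Lemma along_per_r t s : along t (s + 2 * PI) = along t s.
Proof. unfold along; now rewrite gx_per, gy_per. Qed.
Lemma along_per t s : along (t + 2 * PI) (s + 2 * PI) = along t s.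
Proof. unfold along; now rewrite !gx_per, !gy_per, cos_per, sin_per. Qed.

Lemma above_fwd_derive (t y : R) : is_derive (fun y => above t (t + y)) y (rho (t + y) * sin y).
Proof.
apply (is_derive_chain (above t) (fun y => t + y) _ (rho (t + y) * sin (t + y - t)) 1).
- apply above_derive.
- auto_derive; auto.
- replace (t + y - t) with y by ring; ring.
Qed.

Lemma above_bwd_derive (t y : R) : is_derive (fun y => above t (t - y)) y (rho (t - y) * sin y).
Proof.
apply (is_derive_chain (above t) (fun y => t - y) _ (rho (t - y) * sin (t - y - t)) (-1)).
- apply above_derive.
- auto_derive; auto; ring.
- replace (t - y - t) with (- y) by ring; rewrite sin_neg; ring.
Qed.

Lemma along_fwd_derive (t y : R) : is_derive (fun y => along t (t + y)) y (rho (t + y) * cos y).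
Proof.
apply (is_derive_chain (along t) (fun y => t + y) _ (rho (t + y) * cos (t + y - t)) 1).
- apply along_derive.
- auto_derive; auto.
- replace (t + y - t) with y by ring; ring.
Qed.

Lemma along_bwd_derive (t y : R) : is_derive (fun y => - along t (t - y)) y (rho (t - y) * cos y).
Proof.
apply (is_derive_eq _ _ (- - (rho (t - y) * cos y))); [|ring].
apply (is_derive_opp (fun y => along t (t - y))).
apply (is_derive_chain (along t) (fun y => t - y) _ (rho (t - y) * cos (t - y - t)) (-1)).
- apply along_derive.
- auto_derive; auto; ring.
- replace (t - y - t) with (- y) by ring; rewrite cos_neg; ring.
Qed.

Lemma above_fwd_incr t x y : 0 <= x -> x < y -> y <= PI ->
  above t (t + x) < above t (t + y).
Proof.
apply (increasing_of_derive (fun y => above t (t + y)) _ 0 PI (above_fwd_derive t)).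
intros u Hu; apply Rmult_lt_0_compat; [apply rho_pos | apply sin_gt_0; lra].
Qed.

Lemma above_bwd_incr t x y : 0 <= x -> x < y -> y <= PI ->
  above t (t - x) < above t (t - y).
Proof.
apply (increasing_of_derive (fun y => above t (t - y)) _ 0 PI (above_bwd_derive t)).
intros u Hu; apply Rmult_lt_0_compat; [apply rho_pos | apply sin_gt_0; lra].
Qed.

(** [t - PI] and [t + PI] are the same boundary point, at the largest distance from
    the tangent at [t]. *)
Lemma above_antipode t : above t (t - PI) = above t (t + PI).
Proof. rewrite <- above_per_r; f_equal; ring. Qed.

(** ** The billiard map in tangent-angle coordinates *)

(** Heights over the tangent at angle [fst p] of the points reached by turning through
    [snd p] counter-clockwise and clockwise. Outside [0 <= snd p <= PI] they are
    continued with slope one, which makes them increasing bijections of the line. *)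
Definition fwd (p : R * R) : R :=
  above (fst p) (fst p + clamp (snd p)) + (snd p - clamp (snd p)).
Definition bwd (p : R * R) : R :=
  above (fst p) (fst p - clamp (snd p)) + (snd p - clamp (snd p)).

Lemma fwd_cont : cont fwd.
Proof.
assert (C := clamp_cont).
unfold fwd; apply cont_plus; [apply above_cont|]; cts.
Qed.
Lemma bwd_cont : cont bwd.
Proof.
assert (C := clamp_cont).
unfold bwd; apply cont_plus; [apply above_cont|]; cts.
Qed.

Lemma extend_incr (f : R -> R) :
  (forall x y, 0 <= x -> x < y -> y <= PI -> f x < f y) ->
  forall y z, y < z -> f (clamp y) + (y - clamp y) < f (clamp z) + (z - clamp z).
Proof.
intros Hf y z H.
destruct (clamp_mono y z H) as [H1 H2].
assert (A := clamp_range y); assert (B := clamp_range z).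
destruct (Req_dec (clamp y) (clamp z)) as [E|E].
- rewrite E; lra.
- assert (f (clamp y) < f (clamp z)) by (apply Hf; lra); lra.
Qed.

Lemma extend_onto (f : R -> R) : cont f -> f 0 = 0 -> 0 <= f PI ->
  forall z, exists y, f (clamp y) + (y - clamp y) = z.
Proof.
intros Hf H0 HP z.
assert (HC := clamp_cont).
destruct (IVT_gen (fun y => f (clamp y) + (y - clamp y)) (Rmin z 0) (PI + Rabs z) z)
  as [y [_ Hy]].
- intros x; apply continuity_pt_filterlim.
  assert (W : cont (fun y => f (clamp y) + (y - clamp y))) by cts; apply W.
- assert (A := Rmin_l z 0); assert (B := Rmin_r z 0).
  assert (C := Rle_abs z); assert (D := Rabs_pos z).
  rewrite clamp_low, H0, clamp_high by lra.
  split.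
  + eapply Rle_trans; [apply Rmin_l | lra].
  + eapply Rle_trans; [| apply Rmax_r]; lra.
- now exists y.
Qed.

Lemma fwd_incr t y z : y < z -> fwd (t, y) < fwd (t, z).
Proof. apply (extend_incr (fun y => above t (t + y))), above_fwd_incr. Qed.

Lemma bwd_incr t y z : y < z -> bwd (t, y) < bwd (t, z).
Proof. apply (extend_incr (fun y => above t (t - y))), above_bwd_incr. Qed.

Lemma above_PI_pos t : 0 < above t (t + PI).
Proof.
assert (H := above_fwd_incr t 0 PI (Rle_refl 0) PI_RGT_0 (Rle_refl _)).
now rewrite Rplus_0_r, above_self in H.
Qed.

Lemma fwd_onto t z : exists y, fwd (t, y) = z.
Proof.
apply (extend_onto (fun y => above t (t + y))).
- apply (is_derive_cont _ _ (above_fwd_derive t)).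
- now rewrite Rplus_0_r, above_self.
- apply Rlt_le, above_PI_pos.
Qed.

Lemma bwd_onto t z : exists y, bwd (t, y) = z.
Proof.
apply (extend_onto (fun y => above t (t - y))).
- apply (is_derive_cont _ _ (above_bwd_derive t)).
- now rewrite Rminus_0_r, above_self.
- rewrite above_antipode; apply Rlt_le, above_PI_pos.
Qed.

Lemma fwd_in t y : 0 <= y <= PI -> fwd (t, y) = above t (t + y).
Proof. intros H; unfold fwd; simpl; rewrite clamp_in by lra; ring. Qed.
Lemma bwd_in t y : 0 <= y <= PI -> bwd (t, y) = above t (t - y).
Proof. intros H; unfold bwd; simpl; rewrite clamp_in by lra; ring. Qed.

Lemma fwd_per t y : fwd (t + 2 * PI, y) = fwd (t, y).
Proof.
unfold fwd; simpl; rewrite <- (above_per t); do 2 f_equal; ring.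
Qed.
Lemma bwd_per t y : bwd (t + 2 * PI, y) = bwd (t, y).
Proof.
unfold bwd; simpl; rewrite <- (above_per t); do 2 f_equal; ring.
Qed.

Section Map.

Variable invf : R * R -> R.
Hypothesis invf_cont : cont invf.
Hypothesis fwd_invf : forall t z, fwd (t, invf (t, z)) = z.
Hypothesis invf_fwd : forall t y, invf (t, fwd (t, y)) = y.

Lemma invf_per t z : invf (t + 2 * PI, z) = invf (t, z).
Proof. rewrite <- (fwd_invf t z) at 1; now rewrite <- fwd_per, invf_fwd. Qed.

(** A pair of points is encoded as (first angle, angle difference). Three consecutive
    points [t, t + x, t + x + s] satisfy the reflection law when the first and the
    third have the same height over the tangent at the middle one. *)
Definition step (p : R * R) : R * R :=
  (fst p + snd p, invf (fst p + snd p, bwd (fst p + snd p, snd p))).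

#[local] Arguments step : simpl never.

Lemma step_eq t x : fwd (t + x, snd (step (t, x))) = bwd (t + x, x).
Proof. apply fwd_invf. Qed.

Lemma step_per t x : step (t + 2 * PI, x) = (fst (step (t, x)) + 2 * PI, snd (step (t, x))).
Proof.
unfold step; simpl; replace (t + 2 * PI + x) with (t + x + 2 * PI) by ring.
now rewrite invf_per, bwd_per.
Qed.

Lemma fst_step_cont : cont (fun p => fst (step p)).
Proof. unfold step; simpl; cts. Qed.
Lemma snd_step_cont : cont (fun p => snd (step p)).
Proof. assert (W := bwd_cont); unfold step; simpl; cts. Qed.

Lemma step_continuous p : continuous step p.
Proof.
apply (continuous_pair (fun p => fst p + snd p)
   (fun p => invf (fst p + snd p, bwd (fst p + snd p, snd p))) p).
- apply (fst_step_cont p).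
- apply (snd_step_cont p).
Qed.

Lemma bwd_0 t : bwd (t, 0) = 0.
Proof. rewrite bwd_in, Rminus_0_r, above_self; auto; generalize PI_RGT_0; lra. Qed.
Lemma fwd_0 t : fwd (t, 0) = 0.
Proof. rewrite fwd_in, Rplus_0_r, above_self; auto; generalize PI_RGT_0; lra. Qed.
Lemma bwd_PI t : bwd (t, PI) = fwd (t, PI).
Proof. rewrite bwd_in, fwd_in, above_antipode; auto; generalize PI_RGT_0; lra. Qed.

(** The map extends continuously to the boundary [x = 0] of the phase space, which
    consists of fixed points. *)
Lemma step_0 t : step (t, 0) = (t, 0).
Proof.
unfold step; simpl; rewrite Rplus_0_r, bwd_0; f_equal.
transitivity (invf (t, fwd (t, 0))); [now rewrite fwd_0 | apply invf_fwd].
Qed.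

Lemma fwd_lt_inv t y z : fwd (t, y) < fwd (t, z) -> y < z.
Proof.
intros H; destruct (Rtotal_order y z) as [L|[L|L]]; auto.
- subst; lra.
- apply (fwd_incr t) in L; lra.
Qed.
Lemma bwd_lt_inv t y z : bwd (t, y) < bwd (t, z) -> y < z.
Proof.
intros H; destruct (Rtotal_order y z) as [L|[L|L]]; auto.
- subst; lra.
- apply (bwd_incr t) in L; lra.
Qed.

Lemma step_range p : 0 < snd p < PI -> 0 < snd (step p) < PI.
Proof.
destruct p as [t x]; simpl; intros H.
split; apply (fwd_lt_inv (t + x)); unfold step; simpl; rewrite fwd_invf.
- rewrite fwd_0, <- (bwd_0 (t + x)); now apply bwd_incr.
- rewrite <- bwd_PI; now apply bwd_incr.
Qed.

Lemma step_above t x : 0 < x < PI ->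
  above (t + x) (t + x + snd (step (t, x))) = above (t + x) t.
Proof.
intros H; assert (H' := step_range (t, x) H).
rewrite <- fwd_in by lra; rewrite step_eq, bwd_in by lra; f_equal; ring.
Qed.

Lemma step_onto q : 0 < snd q < PI -> exists p, 0 < snd p < PI /\ step p = q.
Proof.
destruct q as [s y]; simpl; intros H.
destruct (bwd_onto s (fwd (s, y))) as [x Hx].
exists (s - x, x); simpl; split.
- split; apply (bwd_lt_inv s); rewrite Hx.
  + rewrite bwd_0, <- (fwd_0 s); now apply fwd_incr.
  + rewrite bwd_PI; now apply fwd_incr.
- unfold step; simpl; replace (s - x + x) with s by ring; now rewrite Hx, invf_fwd.
Qed.

(** ** The invariant measure *)

(** The density [omega (gamma' s) (gamma' t)] of the invariant measure, in angles. *)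
Definition weight (p : R * R) : R := rho (fst p) * rho (fst p + snd p) * sin (snd p).

Definition strip_int (F : R * R -> R) : R :=
  RInt (fun t => RInt (fun x => F (t, x) * weight (t, x)) 0 PI) 0 (2 * PI).

Definition diag_per (F : R * R -> R) : Prop := forall t x, F (t + 2 * PI, x) = F (t, x).

Lemma weight_cont : cont weight.
Proof. unfold weight; cts. Qed.

(** Both sides are the integral of [f] against the height over the tangent at [t], once
    with the height as a function of the incoming point and once of the outgoing one. *)
Lemma invariant_fibre (f : R -> R) (t : R) : cont f ->
  RInt (fun x => f (invf (t, bwd (t, x))) * (rho (t - x) * sin x)) 0 PI =
  RInt (fun y => f y * (rho (t + y) * sin y)) 0 PI.
Proof.
intros Hf; assert (HP := PI_RGT_0).
assert (HG : cont (fun z => f (invf (t, z)))) by cts.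
transitivity (RInt (fun z => f (invf (t, z))) 0 (above t (t + PI))).
- transitivity (RInt (fun z => f (invf (t, z))) (above t (t - 0)) (above t (t - PI))).
  + rewrite <- (RInt_comp (fun z => f (invf (t, z))) (fun x => above t (t - x))
       (fun x => rho (t - x) * sin x)).
    * apply RInt_ext; rewrite Rmin_left, Rmax_right by lra; intros x Hx.
      unfold scal; simpl; unfold mult; simpl; rewrite bwd_in by lra; ring.
    * intros x _; apply HG.
    * intros x _; split; [apply above_bwd_derive|].
      assert (W : cont (fun x => rho (t - x) * sin x)) by cts; apply W.
  + now rewrite Rminus_0_r, above_self, above_antipode.
- transitivity (RInt (fun z => f (invf (t, z))) (above t (t + 0)) (above t (t + PI))).
  + now rewrite Rplus_0_r, above_self.
  + rewrite <- (RInt_comp (fun z => f (invf (t, z))) (fun x => above t (t + x))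
       (fun x => rho (t + x) * sin x)).
    * apply RInt_ext; rewrite Rmin_left, Rmax_right by lra; intros x Hx.
      unfold scal; simpl; unfold mult; simpl; rewrite <- fwd_in, invf_fwd by lra; ring.
    * intros x _; apply HG.
    * intros x _; split; [apply above_fwd_derive|].
      assert (W : cont (fun x => rho (t + x) * sin x)) by cts; apply W.
Qed.

Lemma strip_int_shear (F : R * R -> R) : cont F -> diag_per F ->
  strip_int (fun p => F (fst p + snd p, snd p)) =
  RInt (fun t => RInt (fun x => F (t, x) * (rho t * (rho (t - x) * sin x))) 0 PI) 0 (2 * PI).
Proof.
intros HF HP; unfold strip_int, weight; simpl.
rewrite <- (strip_shear (2 * PI)
  (fun p => F p * (rho (fst p) * (rho (fst p - snd p) * sin (snd p))))).
- apply RInt_ext'; intros t; apply RInt_ext'; intros x; simpl.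
  replace (t + x - x) with t by ring; ring.
- cts; apply HF.
- intros t x; simpl; rewrite HP, rho_per.
  replace (t + 2 * PI - x) with (t - x + 2 * PI) by ring; now rewrite rho_per.
Qed.

Lemma strip_int_step (F : R * R -> R) : cont F -> diag_per F ->
  strip_int (fun p => F (step p)) = strip_int F.
Proof.
intros HF HP; assert (HB := bwd_cont).
set (G := fun q => F (fst q, invf (fst q, bwd (fst q, snd q)))).
transitivity (strip_int (fun p => G (fst p + snd p, snd p))); [reflexivity|].
rewrite (strip_int_shear G); unfold G.
- apply RInt_ext'; intros t; simpl.
  transitivity (rho t * RInt (fun x => F (t, invf (t, bwd (t, x))) * (rho (t - x) * sin x)) 0 PI).
  + rewrite <- RInt_scal' by cts; apply RInt_ext'; intros x; ring.
  + rewrite (invariant_fibre (fun y => F (t, y))) by cts.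
    rewrite <- RInt_scal' by cts; apply RInt_ext'; intros x; unfold weight; simpl; ring.
- cts.
- intros t x; simpl; now rewrite bwd_per, invf_per, HP.
Qed.


(** ** Jacobi fields *)

(** The coefficient [r] of Jacobi's equation at the second point of the pair [p]. *)
Definition jacobi_coeff (p : R * R) : R :=
  (along (fst p + snd p) (fst p + snd p + snd (step p)) - along (fst p + snd p) (fst p))
  / rho (fst p + snd p).

(** Absence of conjugate points in angular coordinates, for fields measured in arc
    length. *)
Definition no_conjugate_angles : Prop :=
  forall th eta : Z -> R,
  (forall n, 0 < th (n + 1)%Z - th n < PI) ->
  (forall n, above (th n) (th (n + 1)%Z) = above (th n) (th (n - 1)%Z)) ->
  (forall n, sin (th n - th (n - 1)%Z) * eta (n - 1)%Z +
             sin (th (n + 1)%Z - th n) * eta (n + 1)%Z =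
     (along (th n) (th (n + 1)%Z) - along (th n) (th (n - 1)%Z)) / rho (th n) * eta n) ->
  forall M N, (M < N)%Z -> eta M = 0 -> eta N = 0 -> forall n, eta n = 0.

Definition orbit (n : nat) (p : R * R) : R * R := Nat.iter n step p.

(** The consecutive values [(eta_n, eta_(n+1))] of the Jacobi field with [eta_0 = 0] and
    [eta_1 = 1]. *)
Fixpoint jfield (p : R * R) (n : nat) : R * R :=
  match n with
  | O => (0, 1)
  | S k => (snd (jfield p k),
      (jacobi_coeff (orbit k p) * snd (jfield p k) - sin (snd (orbit k p)) * fst (jfield p k))
      / sin (snd (orbit (S k) p)))
  end.

Lemma orbit_range n p : 0 < snd p < PI -> 0 < snd (orbit n p) < PI.
Proof. intros H; induction n; auto; now apply step_range. Qed.

Lemma orbit_sin n p : 0 < snd p < PI -> 0 < sin (snd (orbit n p)).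
Proof. intros H; apply (orbit_range n) in H; now apply sin_gt_0. Qed.

Lemma fst_orbit_S n p : fst (orbit (S n) p) = fst (orbit n p) + snd (orbit n p).
Proof. reflexivity. Qed.

(** The orbit and the field are continued to negative times, which is possible because
    the billiard map is onto and the off-diagonal coefficients are positive; a second
    zero would then make [0] and [S n] conjugate. *)
Lemma jfield_nonzero : no_conjugate_angles ->
  forall p n, 0 < snd p < PI -> fst (jfield p (S n)) <> 0.
Proof.
intros NC p n Hp H0.
set (P := fun q : R * R => 0 < snd q < PI).
assert (C : forall q, {r | P q -> P r /\ step r = q}).
{ intros q; apply constructive_indefinite_description.
  destruct (classic (P q)) as [Hq|Hq].
  - destruct (step_onto q Hq) as [r Hr]; now exists r.
  - exists q; tauto. }
destruct (Z_sequence P (fun _ => step) (fun _ q => proj1_sig (C q)) p) as [s [s0 Hs]].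
- exact Hp.
- intros _ q; apply step_range.
- intros _ q; apply (proj2_sig (C q)).
- assert (sP : forall k, P (s k)) by (intros k; apply Hs).
  assert (sS : forall k, s (k + 1)%Z = step (s k)) by (intros k; apply Hs).
  assert (sin_s : forall k, 0 < sin (snd (s k))) by (intros k; apply sin_gt_0; apply sP).
  set (f := fun k (v : R * R) => (snd v,
     (jacobi_coeff (s k) * snd v - sin (snd (s k)) * fst v) / sin (snd (s (k + 1)%Z)))).
  set (g := fun k (v : R * R) =>
     ((jacobi_coeff (s k) * fst v - sin (snd (s (k + 1)%Z)) * snd v) / sin (snd (s k)), fst v)).
  destruct (Z_sequence (fun _ => True) f g (0, 1)) as [e [e0 He]]; auto.
  { intros k [b c] _; split; auto; unfold f, g; simpl; f_equal.
    field; split; apply Rgt_not_eq; apply sin_s. }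
  assert (eS : forall k, e (k + 1)%Z = f k (e k)) by (intros k; apply He).
  assert (sN : forall k, s (Z.of_nat k) = orbit k p).
  { induction k as [|k IH]; [exact s0|].
    rewrite Nat2Z.inj_succ, <- Z.add_1_r, sS, IH; reflexivity. }
  assert (eN : forall k, e (Z.of_nat k) = jfield p k).
  { induction k as [|k IH]; [exact e0|].
    rewrite Nat2Z.inj_succ, <- Z.add_1_r, eS, IH; unfold f.
    rewrite Z.add_1_r, <- Nat2Z.inj_succ, !sN; reflexivity. }
  assert (E : forall k, fst (e k) = 0).
  { apply (NC (fun k => fst (s k)) (fun k => fst (e k))) with (M := 0%Z) (N := Z.of_nat (S n)).
    - intros k; rewrite sS; simpl.
      replace (fst (s k) + snd (s k) - fst (s k)) with (snd (s k)) by ring; apply sP.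
    - intros k; replace k with (k - 1 + 1)%Z by ring.
      replace (k - 1 + 1 - 1)%Z with (k - 1)%Z by ring.
      rewrite !sS; assert (Hk := sP (k - 1)%Z).
      destruct (s (k - 1)%Z) as [t x]; apply (step_above t x Hk).
    - intros k; replace k with (k - 1 + 1)%Z by ring.
      replace (k - 1 + 1 - 1)%Z with (k - 1)%Z by ring.
      rewrite (eS (k - 1 + 1)%Z), (eS (k - 1)%Z).
      assert (H1 := sin_s (k - 1)%Z); assert (H2 := sin_s (k - 1 + 1)%Z).
      revert H1 H2; unfold f; simpl.
      rewrite !sS; destruct (e (k - 1)%Z) as [a b]; destruct (s (k - 1)%Z) as [t x].
      unfold jacobi_coeff; simpl fst; simpl snd.
      replace (t + x - t) with x by ring.
      set (y := invf _).
      replace (t + x + y - (t + x)) with y by ring.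
      intros H1 H2; field; split; [|apply Rgt_not_eq, H2].
      apply Rgt_not_eq, rho_pos.
    - lia.
    - now rewrite e0.
    - now rewrite eN. }
  assert (W := E 1%Z); change 1%Z with (Z.of_nat 1) in W; rewrite eN in W; simpl in W; lra.
Qed.

(** ** Short chords *)

Lemma lim_comp {T} {F : (T -> Prop) -> Prop} (f : T -> R) (g : R -> R) (a : R) :
  filterlim f F (locally a) -> continuous g a ->
  filterlim (fun x => g (f x)) F (locally (g a)).
Proof. intros Hf Hg; exact (filterlim_comp _ _ _ f g F _ _ Hf Hg). Qed.

Lemma lim_plus {T} {F : (T -> Prop) -> Prop} {FF : Filter F} (f g : T -> R) (a b : R) :
  filterlim f F (locally a) -> filterlim g F (locally b) ->
  filterlim (fun x => f x + g x) F (locally (a + b)).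
Proof.
intros Hf Hg; exact (filterlim_comp_2 f g Rplus Hf Hg (filterlim_plus (V := R_NormedModule) a b)).
Qed.

Lemma lim_mult {T} {F : (T -> Prop) -> Prop} {FF : Filter F} (f g : T -> R) (a b : R) :
  filterlim f F (locally a) -> filterlim g F (locally b) ->
  filterlim (fun x => f x * g x) F (locally (a * b)).
Proof.
intros Hf Hg; exact (filterlim_comp_2 f g Rmult Hf Hg (filterlim_mult (K := R_AbsRing) a b)).
Qed.

Lemma lim_div {T} {F : (T -> Prop) -> Prop} {FF : Filter F} (f g : T -> R) (a b : R) :
  b <> 0 -> filterlim f F (locally a) -> filterlim g F (locally b) ->
  filterlim (fun x => f x / g x) F (locally (a / b)).
Proof.
intros Hb Hf Hg; apply lim_mult; auto; apply (lim_comp g Rinv b Hg).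
now apply continuous_Rinv.
Qed.


(** Pairs of distinct points tending to the pair [(t, t)]. *)
Definition near0 (t : R) : (R * R -> Prop) -> Prop :=
  within (fun p => 0 < snd p < PI) (locally (t, 0)).

Instance near0_filter t : Filter (near0 t).
Proof. apply within_filter, locally_filter. Qed.

Lemma near0_strip t : near0 t (fun p => 0 < snd p < PI).
Proof. apply (filter_forall (F := locally (t, 0))); auto. Qed.

Lemma near0_lim (F : R * R -> R) t : cont F -> filterlim F (near0 t) (locally (F (t, 0))).
Proof.
intros HF; apply (filterlim_filter_le_1 (G := near0 t) (F := locally (t, 0))).
- intros P HP; unfold near0, within; apply filter_imp with (2 := HP); auto.
- apply HF.
Qed.

Lemma step_near0 t : filterlim step (near0 t) (near0 t).
Proof.
intros P HP; unfold near0, within, filtermap in *.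
assert (HS := step_continuous (t, 0)); unfold continuous in HS; rewrite step_0 in HS.
apply HS in HP; unfold filtermap in HP.
apply filter_imp with (2 := HP); intros p Hp Hr; apply Hp, step_range, Hr.
Qed.

Lemma orbit_near0 t n : filterlim (orbit n) (near0 t) (near0 t).
Proof.
induction n as [|n IH]; [apply filterlim_id|].
apply (filterlim_comp _ _ _ (orbit n) step _ (near0 t)); auto; apply step_near0.
Qed.

(** All points between the first and the third point of the orbit tend to [t]. *)
Lemma mean_rho_lim t (m : R * R -> R) :
  near0 t (fun p => exists c, fst p <= c <= fst p + snd p + snd (step p) /\ m p = rho c) ->
  filterlim m (near0 t) (locally (rho t)).
Proof.
intros Hm; apply filterlim_locally; intros e.
destruct (proj1 (filterlim_locally rho (rho t)) (rho_cont t) e) as [d Hd].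
assert (L1 := near0_lim fst t cont_fst).
assert (H2 : cont (fun p => fst p + snd p + snd (step p))) by (assert (W := snd_step_cont); cts).
assert (L2 := near0_lim _ t H2).
cbv beta in L1, L2; rewrite step_0 in L2; simpl in L1, L2; rewrite !Rplus_0_r in L2.
generalize (filter_and _ _ Hm (filter_and _ _
  (proj1 (filterlim_locally _ t) L1 d) (proj1 (filterlim_locally _ t) L2 d))).
apply filter_imp; intros p [[c [Hc E]] [B1 B2]]; rewrite E; clear E; apply Hd; clear Hd L1 L2 Hm.
change (Rabs (fst p - t) < d) in B1.
change (Rabs (fst p + snd p + snd (step p) - t) < d) in B2.
apply Rabs_lt_between' in B1; apply Rabs_lt_between' in B2.
apply Rabs_lt_between'; lra.
Qed.

Lemma one_minus_cos_derive (u : R) : is_derive (fun u => 1 - cos u) u (sin u).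
Proof. auto_derive; auto; ring. Qed.

Lemma above_fwd_mean t y : 0 < y < PI ->
  exists c, 0 < c < y /\ above t (t + y) = rho (t + c) * (1 - cos y).
Proof.
intros H; apply (cauchy_mean (fun y => above t (t + y)) (fun u => 1 - cos u)
  (fun u => rho (t + u)) sin); try lra.
- apply above_fwd_derive.
- apply one_minus_cos_derive.
- intros u Hu; apply sin_gt_0; lra.
- now rewrite Rplus_0_r, above_self.
- rewrite cos_0; ring.
Qed.

Lemma above_bwd_mean t y : 0 < y < PI ->
  exists c, 0 < c < y /\ above t (t - y) = rho (t - c) * (1 - cos y).
Proof.
intros H; apply (cauchy_mean (fun y => above t (t - y)) (fun u => 1 - cos u)
  (fun u => rho (t - u)) sin); try lra.
- apply above_bwd_derive.
- apply one_minus_cos_derive.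
- intros u Hu; apply sin_gt_0; lra.
- now rewrite Rminus_0_r, above_self.
- rewrite cos_0; ring.
Qed.

Lemma along_fwd_mean t y : 0 < y < PI / 2 ->
  exists c, 0 < c < y /\ along t (t + y) = rho (t + c) * sin y.
Proof.
intros H; apply (cauchy_mean (fun y => along t (t + y)) sin
  (fun u => rho (t + u)) cos); try lra.
- apply along_fwd_derive.
- apply is_derive_sin.
- intros u Hu; apply cos_gt_0; lra.
- now rewrite Rplus_0_r, along_self.
- apply sin_0.
Qed.

Lemma along_bwd_mean t y : 0 < y < PI / 2 ->
  exists c, 0 < c < y /\ - along t (t - y) = rho (t - c) * sin y.
Proof.
intros H; apply (cauchy_mean (fun y => - along t (t - y)) sin
  (fun u => rho (t - u)) cos); try lra.
- apply along_bwd_derive.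
- apply is_derive_sin.
- intros u Hu; apply cos_gt_0; lra.
- rewrite Rminus_0_r, along_self; ring.
- apply sin_0.
Qed.

Lemma one_minus_cos_pos x : 0 < x < PI -> 0 < 1 - cos x.
Proof.
intros H; assert (W := cos_decreasing_1 0 x); rewrite cos_0 in W; lra.
Qed.

Lemma near0_small t : near0 t (fun p => snd p < PI / 2 /\ snd (step p) < PI / 2).
Proof.
assert (HP := PI_RGT_0).
apply filter_and.
- assert (L := near0_lim (fun p => PI / 2 - snd p) t ltac:(cts)); simpl in L.
  assert (E := L (fun z => 0 < z) ltac:(apply open_gt; simpl; lra)); unfold filtermap in E.
  apply filter_imp with (2 := E); intros p Hp; exact (proj2 (Rminus_lt_0 _ _) Hp).
- assert (W := snd_step_cont).
  assert (L := near0_lim (fun p => PI / 2 - snd (step p)) t ltac:(cts)); cbv beta in L; rewrite step_0 in L; simpl in L.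
  assert (E := L (fun z => 0 < z) ltac:(apply open_gt; simpl; lra)); unfold filtermap in E.
  apply filter_imp with (2 := E); intros p Hp; exact (proj2 (Rminus_lt_0 _ _) Hp).
Qed.

(** Consecutive angle differences become equal: the common height is
    [rho (1 - cos x)] seen from one side and [rho (1 - cos y)] from the other, with
    radii at intermediate points, and [sin ^ 2 = (1 - cos) (1 + cos)]. *)
Lemma sin_ratio_lim t :
  filterlim (fun p => sin (snd p) / sin (snd (step p))) (near0 t) (locally 1).
Proof.
assert (Hr := rho_pos t).
assert (W := snd_step_cont).
assert (L1 : filterlim (fun p => above (fst p + snd p) (fst p + snd p - snd p) / (1 - cos (snd p)))
   (near0 t) (locally (rho t))).
{ apply mean_rho_lim; apply filter_imp with (2 := near0_strip t).
  intros [s x] Hx; assert (Hy := step_range _ Hx); simpl fst in *; simpl snd in Hx, Hy |- *.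
  destruct (above_bwd_mean (s + x) x Hx) as [c [Hc E]].
  exists (s + x - c); split; [unfold step in *; simpl in *; lra|].
  rewrite E; field; apply Rgt_not_eq, (one_minus_cos_pos x Hx). }
assert (L2 : filterlim (fun p => above (fst p + snd p) (fst p + snd p + snd (step p))
    / (1 - cos (snd (step p)))) (near0 t) (locally (rho t))).
{ apply mean_rho_lim; apply filter_imp with (2 := near0_strip t).
  intros [s x] Hx; assert (Hy := step_range _ Hx).
  destruct (above_fwd_mean (s + x) _ Hy) as [c [Hc E]].
  simpl in Hx.
  exists (s + x + c); split; [unfold step in *; simpl in *; lra|].
  simpl fst; simpl snd at 1 2; rewrite E; field; apply Rgt_not_eq, (one_minus_cos_pos _ Hy). }
assert (L3 : filterlim (fun p => (1 + cos (snd p)) / (1 + cos (snd (step p))))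
   (near0 t) (locally ((1 + 1) / (1 + 1)))).
{ apply lim_div; [lra| |].
  - assert (L := near0_lim (fun p => 1 + cos (snd p)) t ltac:(cts)).
    simpl in L; now rewrite cos_0 in L.
  - assert (L := near0_lim (fun p => 1 + cos (snd (step p))) t ltac:(cts)).
    cbv beta in L; rewrite step_0 in L; simpl in L; now rewrite cos_0 in L. }
assert (L := lim_comp _ sqrt _ (lim_mult _ _ _ _ (lim_div _ _ _ _ (Rgt_not_eq _ _ Hr) L2 L1) L3)
   (continuous_sqrt _)).
replace (sqrt (rho t / rho t * ((1 + 1) / (1 + 1)))) with 1 in L
  by (rewrite <- sqrt_1 at 1; f_equal; field; lra).
apply (filterlim_ext_loc) with (2 := L).
apply filter_imp with (2 := near0_strip t).
intros [s x] Hx; assert (Hy := step_range _ Hx).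
assert (Sx := sin_gt_0 x ltac:(apply Hx) ltac:(apply Hx)).
assert (Sy := sin_gt_0 _ (proj1 Hy) (proj2 Hy)).
rewrite <- (sqrt_Rsqr (sin (snd (s, x)) / sin (snd (step (s, x)))))
  by (apply Rlt_le, Rdiv_lt_0_compat; auto).
f_equal; simpl fst; simpl snd at 1 2 5 8.
rewrite step_above by apply Hx.
replace (s + x - x) with s by ring.
set (y := snd (step (s, x))) in *; simpl snd.
assert (Cx := one_minus_cos_pos x Hx).
assert (Cy := one_minus_cos_pos y Hy).
assert (A : 0 < above (s + x) s).
{ destruct (above_bwd_mean (s + x) x Hx) as [c [Hc E]].
  replace s with (s + x - x) at 2 by ring; rewrite E.
  apply Rmult_lt_0_compat; auto. }
assert (Qx := sin2_cos2 x); assert (Qy := sin2_cos2 y); unfold Rsqr in *.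
assert (Cy' : 1 + cos y <> 0) by (intros Z; nra).
apply (Rmult_eq_reg_r (sin y * sin y)); [|nra].
replace (sin x / sin y * (sin x / sin y) * (sin y * sin y)) with (sin x * sin x)
  by (field; lra).
replace (sin x * sin x) with ((1 - cos x) * (1 + cos x)) by lra.
replace (sin y * sin y) with ((1 - cos y) * (1 + cos y)) by lra.
replace (s + x - x) with s by ring.
field; repeat split; auto; lra.
Qed.

(** The chord from the first to the third point is [rho (sin x + sin y)], with radii at intermediate points. *)
Lemma jacobi_coeff_ratio_lim t :
  filterlim (fun p => jacobi_coeff p / sin (snd (step p))) (near0 t) (locally 2).
Proof.
assert (Hr := rho_pos t).
assert (W := snd_step_cont).
assert (L1 : filterlim (fun p => - along (fst p + snd p) (fst p + snd p - snd p) / sin (snd p))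
   (near0 t) (locally (rho t))).
{ apply mean_rho_lim; apply filter_imp with (2 := filter_and _ _ (near0_strip t) (near0_small t)).
  intros [s x] [Hx [Hx2 Hy2]]; assert (Hy := step_range _ Hx).
  destruct (along_bwd_mean (s + x) x (conj (proj1 Hx) Hx2)) as [c [Hc E]].
  simpl in Hx.
  exists (s + x - c); split; [unfold step in *; simpl in *; lra|].
  simpl fst; simpl snd; rewrite E; field; apply Rgt_not_eq, sin_gt_0; apply Hx. }
assert (L2 : filterlim (fun p => along (fst p + snd p) (fst p + snd p + snd (step p))
    / sin (snd (step p))) (near0 t) (locally (rho t))).
{ apply mean_rho_lim; apply filter_imp with (2 := filter_and _ _ (near0_strip t) (near0_small t)).
  intros [s x] [Hx [Hx2 Hy2]]; assert (Hy := step_range _ Hx).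
  destruct (along_fwd_mean (s + x) _ (conj (proj1 Hy) Hy2)) as [c [Hc E]].
  simpl in Hx.
  exists (s + x + c); split; [unfold step in *; simpl in *; lra|].
  simpl fst; simpl snd at 1 2; rewrite E; field; apply Rgt_not_eq, sin_gt_0; apply Hy. }
assert (L3 := near0_lim (fun p => rho (fst p + snd p)) t ltac:(cts)).
simpl in L3; rewrite Rplus_0_r in L3.
assert (L := lim_div _ _ _ _ (Rgt_not_eq _ _ Hr)
  (lim_plus _ _ _ _ L2 (lim_mult _ _ _ _ L1 (sin_ratio_lim t))) L3).
replace ((rho t + rho t * 1) / rho t) with 2 in L by (field; lra).
apply (filterlim_ext_loc) with (2 := L).
apply filter_imp with (2 := near0_strip t).
intros [s x] Hx; assert (Hy := step_range _ Hx).
assert (Sx := sin_gt_0 x ltac:(apply Hx) ltac:(apply Hx)).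
assert (Sy := sin_gt_0 _ (proj1 Hy) (proj2 Hy)).
assert (R1 := rho_pos (s + x)).
unfold jacobi_coeff; set (y := snd (step (s, x))) in *; simpl.
replace (s + x - x) with s by ring.
field; lra.
Qed.

(** In the limit Jacobi's equation reads [eta_n + eta_(n+2) = 2 eta_(n+1)]. *)
Lemma jfield_lim t n :
  filterlim (fun p => fst (jfield p n)) (near0 t) (locally (INR n)) /\
  filterlim (fun p => snd (jfield p n)) (near0 t) (locally (INR (S n))).
Proof.
induction n as [|n [IH1 IH2]].
- split; simpl; apply filterlim_const.
- split; [exact IH2|].
  assert (O := orbit_near0 t n).
  assert (L1 := filterlim_comp _ _ _ _ _ _ _ _ O (jacobi_coeff_ratio_lim t)).
  assert (L2 := filterlim_comp _ _ _ _ _ _ _ _ O (sin_ratio_lim t)).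
  assert (L := lim_plus _ _ _ _ (lim_mult _ _ _ _ L1 IH2)
     (lim_mult _ _ _ _ (lim_mult _ _ _ _ (filterlim_const (-1)) L2) IH1)).
  replace (2 * INR (S n) + -1 * 1 * INR n) with (INR (S (S n))) in L
    by (rewrite !S_INR; ring).
  apply (filterlim_ext_loc) with (2 := L).
  apply filter_imp with (2 := near0_strip t); intros p Hp.
  assert (S1 := orbit_sin (S n) p Hp); simpl in *; field; lra.
Qed.

(** ** Positivity of Jacobi fields *)

Lemma orbit_continuous n p : continuous (orbit n) p.
Proof.
induction n as [|n IH]; [apply continuous_id|].
apply (continuous_comp (orbit n) step); auto; apply step_continuous.
Qed.

Lemma jacobi_coeff_cont : cont jacobi_coeff.
Proof.
assert (W := snd_step_cont).
unfold jacobi_coeff; apply cont_div; [|cts|intros; apply Rgt_not_eq, rho_pos].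
apply cont_minus; apply along_cont; cts.
Qed.

Lemma jfield_continuous n p : 0 < snd p < PI ->
  continuous (fun q => fst (jfield q n)) p /\ continuous (fun q => snd (jfield q n)) p.
Proof.
intros Hp; induction n as [|n [IH1 IH2]]; simpl.
- split; apply continuous_const.
- split; [exact IH2|].
  assert (C1 : continuous (fun q => jacobi_coeff (orbit n q)) p)
    by (apply (continuous_comp (orbit n) jacobi_coeff); [apply orbit_continuous | apply jacobi_coeff_cont]).
  assert (C2 : forall m, continuous (fun q => sin (snd (orbit m q))) p).
  { intros m; apply (continuous_comp (orbit m) (fun q => sin (snd q)));
      [apply orbit_continuous|]. assert (W : cont (fun q : R * R => sin (snd q))) by cts; apply W. }
  apply (continuous_mult (K := R_AbsRing)).
  + apply (continuous_minus (V := R_NormedModule)); apply (continuous_mult (K := R_AbsRing)); auto.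
  + apply (continuous_comp (fun q => sin (snd (orbit (S n) q))) Rinv); [apply (C2 (S n))|].
    apply continuous_Rinv, Rgt_not_eq, (orbit_sin (S n) p Hp).
Qed.

(** Keep the first point and let the second tend to it: the value never vanishes and is
    positive at the end, so it is positive throughout. *)
Lemma jfield_pos : no_conjugate_angles ->
  forall n p, 0 < snd p < PI -> 0 < fst (jfield p (S n)).
Proof.
intros NC n [t x] Hx; simpl snd in Hx.
destruct (Rlt_dec 0 (fst (jfield (t, x) (S n)))) as [L|L]; [exact L|exfalso].
assert (N0 := jfield_nonzero NC (t, x) n Hx).
assert (Ev : near0 t (fun p => 0 < fst (jfield p (S n)))).
{ apply (proj1 (jfield_lim t (S n))); apply open_gt; apply lt_0_INR; lia. }
destruct Ev as [e He].
set (x1 := Rmin (e / 2) (x / 2)).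
assert (e0 := cond_pos e).
assert (x1 <= e / 2) by apply Rmin_l.
assert (x1 <= x / 2) by apply Rmin_r.
assert (0 < x1) by (apply Rmin_glb_lt; lra).
assert (P1 : 0 < fst (jfield (t, x1) (S n))).
{ apply He.
  - split; [apply ball_center | apply Rabs_lt_between'; simpl; lra].
  - simpl; lra. }
destruct (Ranalysis5.IVT_interv (fun u => - fst (jfield (t, u) (S n))) x1 x) as [z [Hz Ez]].
- intros u Hu; apply continuity_pt_filterlim.
  apply (continuous_opp (fun u => fst (jfield (t, u) (S n)))).
  apply (continuous_comp (fun u => (t, u)) (fun p => fst (jfield p (S n)))).
  + apply continuous_pair; [apply continuous_const | apply continuous_id].
  + apply (jfield_continuous (S n) (t, u)); simpl; lra.
- lra.
- lra.
- lra.
- apply (jfield_nonzero NC (t, z) n); simpl snd; lra.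
Qed.

(** ** Hopf's inequality *)

Fixpoint birkhoff (F : R * R -> R) (N : nat) (p : R * R) : R :=
  match N with
  | O => 0
  | S n => birkhoff F n p + F (orbit n p)
  end.

Variable f : R -> R.
Hypothesis f_cont : cont f.
Hypothesis f_per : periodic (2 * PI) f.

(** The two kinds of terms of the second variation for the field [eta_n = f (theta_n)];
    [diag_term] belongs to the second point of the pair. *)
Definition diag_term (p : R * R) : R := jacobi_coeff p * f (fst p + snd p) ^ 2.
Definition cross_term (p : R * R) : R := sin (snd p) * f (fst p) * f (fst p + snd p).

Definition excess (p : R * R) : R := diag_term p - 2 * cross_term p.

(** Jacobi's identity: with [eta] the positive field and [b_n = sin (theta_(n+1) -
    theta_n)], the form is the sum of the squares
    [b_n / (eta_n eta_(n+1)) (eta_(n+1) f_n - eta_n f_(n+1)) ^ 2] and a last term, which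
    is the left-hand side. *)
Lemma second_variation_bound : no_conjugate_angles ->
  forall N p, 0 < snd p < PI ->
  let q := orbit (S N) p in
  sin (snd q) * (fst (jfield p (S (S N))) / fst (jfield p (S N))) * f (fst q) ^ 2 <=
  birkhoff excess (S N) p + 2 * cross_term p.
Proof.
intros NC N p Hp.
induction N as [|N IH]; cbv zeta.
- assert (S1 := orbit_sin 1 p Hp); right; simpl in *; unfold excess, diag_term.
  field; lra.
- cbv zeta in IH.
  assert (S1 := orbit_sin (S N) p Hp); assert (S2 := orbit_sin (S (S N)) p Hp).
  assert (J1 := jfield_pos NC N p Hp); assert (J2 := jfield_pos NC (S N) p Hp).
  assert (Erec : fst (jfield p (S (S (S N)))) =
    (jacobi_coeff (orbit (S N) p) * fst (jfield p (S (S N))) - sin (snd (orbit (S N) p)) * fst (jfield p (S N)))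
      / sin (snd (orbit (S (S N)) p))) by reflexivity.
  assert (Efst := fst_orbit_S (S N) p).
  change (birkhoff excess (S (S N)) p) with
    (birkhoff excess (S N) p
      + (diag_term (orbit (S N) p) - 2 * cross_term (orbit (S N) p))).
  set (S := birkhoff _ _ _) in *.
  unfold diag_term at 1, cross_term at 1; rewrite <- Efst.
  rewrite Erec.
  set (a := fst (jfield p (Datatypes.S N))) in *.
  set (b := fst (jfield p (Datatypes.S (Datatypes.S N)))) in *.
  set (u := sin (snd (orbit (Datatypes.S N) p))) in *.
  set (v := sin (snd (orbit (Datatypes.S (Datatypes.S N)) p))) in *.
  set (r := jacobi_coeff _) in *.
  set (f1 := f (fst (orbit (Datatypes.S N) p))) in *.
  set (f2 := f (fst (orbit (Datatypes.S (Datatypes.S N)) p))) in *.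
  assert (K : 0 <= u / (a * b) * (b * f1 - a * f2) ^ 2).
  { apply Rmult_le_pos; [|apply pow2_ge_0].
    apply Rlt_le, Rdiv_lt_0_compat; auto; now apply Rmult_lt_0_compat. }
  replace (v * ((r * b - u * a) / v / b) * f2 ^ 2) with (r * f2 ^ 2 - u * a / b * f2 ^ 2)
    by (field; lra).
  replace (u / (a * b) * (b * f1 - a * f2) ^ 2) with
    (u * (b / a) * f1 ^ 2 - 2 * (u * f1 * f2) + u * a / b * f2 ^ 2) in K by (field; lra).
  lra.
Qed.

Lemma strip_int_plus F G : cont F -> cont G ->
  strip_int (fun p => F p + G p) = strip_int F + strip_int G.
Proof.
intros HF HG; assert (W := weight_cont); unfold strip_int.
rewrite <- RInt_plus' by (apply (cont_RInt_param (fun p => _ * weight p)); cts).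
apply RInt_ext'; intros t; rewrite <- RInt_plus' by cts; apply RInt_ext'; intros x; ring.
Qed.

Lemma strip_int_scal c F : cont F ->
  strip_int (fun p => c * F p) = c * strip_int F.
Proof.
intros HF; assert (W := weight_cont); unfold strip_int.
rewrite <- RInt_scal' by (apply (cont_RInt_param (fun p => F p * weight p)); cts).
apply RInt_ext'; intros t; rewrite <- RInt_scal' by cts; apply RInt_ext'; intros x; ring.
Qed.

Lemma strip_int_ge0 F : cont F -> (forall p, 0 < snd p < PI -> 0 <= F p) -> 0 <= strip_int F.
Proof.
intros HF Hp; assert (W := weight_cont); assert (HP := PI_RGT_0); unfold strip_int.
apply cont_RInt_nonneg; [lra| |].
- apply (cont_RInt_param (fun p => F p * weight p)); cts.
- intros t _; apply RInt_ge_0; [lra | apply cont_ex_RInt; cts |].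
  intros x Hx; apply Rmult_le_pos; [apply Hp; auto|].
  unfold weight; apply Rmult_le_pos; [apply Rmult_le_pos; apply Rlt_le, rho_pos|].
  simpl; apply Rlt_le, sin_gt_0; lra.
Qed.

Lemma orbit_comp_cont n F : cont F -> cont (fun p => F (orbit n p)).
Proof. intros HF; apply (cont_comp (orbit n) F); auto; apply orbit_continuous. Qed.

Lemma step_comp_per F : diag_per F -> diag_per (fun p => F (step p)).
Proof.
intros HF t x; rewrite step_per, HF; now destruct (step (t, x)).
Qed.

Lemma strip_int_orbit n : forall F, cont F -> diag_per F ->
  strip_int (fun p => F (orbit n p)) = strip_int F.
Proof.
induction n as [|n IH]; intros F HF HP; [reflexivity|].
rewrite <- (strip_int_step F HF HP).
apply (IH (fun p => F (step p))).
- apply (cont_comp step F step_continuous HF).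
- now apply step_comp_per.
Qed.

Lemma birkhoff_cont F N : cont F -> cont (birkhoff F N).
Proof.
intros HF; induction N as [|N IH]; simpl; [cts|].
apply cont_plus; auto; now apply orbit_comp_cont.
Qed.

Lemma strip_int_birkhoff F N : cont F -> diag_per F ->
  strip_int (birkhoff F N) = INR N * strip_int F.
Proof.
intros HF HP; induction N as [|N IH].
- simpl birkhoff; transitivity (strip_int (fun p => 0 * F p)); [|rewrite strip_int_scal by auto; simpl; ring].
  unfold strip_int; apply RInt_ext'; intros t; apply RInt_ext'; intros x; ring.
- simpl birkhoff.
  rewrite (strip_int_plus (birkhoff F N) (fun p => F (orbit N p))), IH, strip_int_orbit, S_INR;
    auto; [ring | now apply birkhoff_cont | now apply orbit_comp_cont].
Qed.

Lemma diag_term_cont : cont diag_term.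
Proof. assert (W := jacobi_coeff_cont); unfold diag_term; cts. Qed.
Lemma cross_term_cont : cont cross_term.
Proof. unfold cross_term; cts. Qed.

Lemma jacobi_coeff_per : diag_per jacobi_coeff.
Proof.
intros t x; unfold jacobi_coeff; rewrite step_per; set (y := snd (step (t, x))); simpl fst; simpl snd.
replace (t + 2 * PI + x) with (t + x + 2 * PI) by ring.
replace (t + x + 2 * PI + y) with (t + x + y + 2 * PI) by ring.
now rewrite rho_per, !along_per.
Qed.

(** The integral of the form over a segment of length [N] is [N] times that of [excess]
    plus a constant; it is nonnegative for all [N]. *)
Lemma second_variation_mean : no_conjugate_angles ->
  2 * strip_int cross_term <= strip_int diag_term.
Proof.
intros NC.
assert (C1 := diag_term_cont); assert (C2 := cross_term_cont).
assert (CF : cont excess) by (unfold excess; cts).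
assert (PF : diag_per excess).
{ intros t x; unfold excess, diag_term, cross_term; rewrite jacobi_coeff_per; simpl.
  replace (t + 2 * PI + x) with (t + x + 2 * PI) by ring; now rewrite !f_per. }
assert (EF : strip_int excess = strip_int diag_term - 2 * strip_int cross_term).
{ transitivity (strip_int (fun p => diag_term p + -2 * cross_term p)).
  - unfold strip_int, excess; apply RInt_ext'; intros t; apply RInt_ext'; intros x; ring.
  - rewrite (strip_int_plus diag_term (fun p => -2 * cross_term p)), strip_int_scal by cts; ring. }
assert (K : forall N, 0 <= INR (S N) * strip_int excess + 2 * strip_int cross_term).
{ intros N.
  rewrite <- strip_int_birkhoff, <- strip_int_scal, <- strip_int_plus by (cts; now apply birkhoff_cont).
  apply strip_int_ge0; [apply cont_plus; [now apply birkhoff_cont | cts]|].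
  intros p Hp.
  eapply Rle_trans; [|apply (second_variation_bound NC N p Hp)].
  assert (S1 := orbit_sin (S N) p Hp).
  apply Rmult_le_pos; [|apply pow2_ge_0].
  apply Rmult_le_pos; [lra|].
  apply Rlt_le, Rdiv_lt_0_compat; now apply jfield_pos. }
(* a negative mean would violate [K] for large [N] *)
destruct (Rle_dec 0 (strip_int excess)) as [H|H]; [lra|exfalso].
set (c := strip_int excess) in *; set (d := 2 * strip_int cross_term) in *.
destruct (archimed (d / - c)) as [A _].
assert (B : d < IZR (up (d / - c)) * - c).
{ apply (Rmult_lt_compat_r (- c)) in A; [|lra].
  replace (d / - c * - c) with d in A by (field; lra); exact A. }
assert (Z : IZR (up (d / - c)) <= INR (S (Z.to_nat (up (d / - c))))).
{ rewrite INR_IZR_INZ; apply IZR_le; lia. }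
assert (KN := K (Z.to_nat (up (d / - c)))).
assert (IZR (up (d / - c)) * - c <= INR (S (Z.to_nat (up (d / - c)))) * - c)
  by (apply Rmult_le_compat_r; lra).
lra.
Qed.

End Map.

(** ** The mean of the second variation *)

(** The area enclosed by [(gx, gy)], as the line integral of [x dy]. *)
Definition area : R := RInt (fun t => gx t * (rho t * sin t)) 0 (2 * PI).

Lemma gx_2PI : gx (2 * PI) = gx 0.
Proof. rewrite <- (gx_per 0); f_equal; ring. Qed.
Lemma gy_2PI : gy (2 * PI) = gy 0.
Proof. rewrite <- (gy_per 0); f_equal; ring. Qed.

Lemma int_gx_dgx : RInt (fun t => gx t * (rho t * cos t)) 0 (2 * PI) = 0.
Proof.
assert (E := int_product_derive gx gx _ _ (2 * PI) gx_derive gx_derive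
  ltac:(cts) ltac:(cts) gx_2PI gx_2PI); lra.
Qed.
Lemma int_gy_dgy : RInt (fun t => gy t * (rho t * sin t)) 0 (2 * PI) = 0.
Proof.
assert (E := int_product_derive gy gy _ _ (2 * PI) gy_derive gy_derive
  ltac:(cts) ltac:(cts) gy_2PI gy_2PI); lra.
Qed.
Lemma int_gy_dgx : RInt (fun t => gy t * (rho t * cos t)) 0 (2 * PI) = - area.
Proof.
apply (int_product_derive gy gx _ _ (2 * PI) gy_derive gx_derive
  ltac:(cts) ltac:(cts) gy_2PI gx_2PI).
Qed.

Ltac cts' := assert (gx_cont_ := gx_cont); assert (gy_cont_ := gy_cont); cts.

(** The line integral of [x dy] does not depend on the choice of the origin and axes. *)
Lemma area_in_frame t :
  RInt (fun s => along t s * (rho s * sin (s - t))) (t - PI) (t + PI) = area.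
Proof.
replace (t + PI) with (t - PI + 2 * PI) by ring.
rewrite (RInt_periodic (2 * PI)).
- rewrite (RInt_ext' _ (fun s =>
    ((cos t * cos t) * (gx s * (rho s * sin s)) - (cos t * sin t) * (gx s * (rho s * cos s)))
    + ((sin t * cos t) * (gy s * (rho s * sin s)) - (sin t * sin t) * (gy s * (rho s * cos s)))
    - ((cos t * gx t + sin t * gy t) * (cos t * (rho s * sin s))
       - (cos t * gx t + sin t * gy t) * (sin t * (rho s * cos s))))).
  2: { intros s; unfold along; rewrite sin_minus; ring. }
  rewrite RInt_minus', RInt_plus', !RInt_minus', !RInt_scal' by cts'.
  fold area; rewrite int_gx_dgx, int_gy_dgy, int_gy_dgx, closed_x, closed_y.
  assert (Q := sin2_cos2 t); unfold Rsqr in Q.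
  replace (cos t * cos t) with (1 - sin t * sin t) by lra; real_eq; ring.
- assert (W : cont (fun s => along t s)) by (apply (along_cont (fun _ => t)); cts); cts.
- intros s; rewrite along_per_r, rho_per.
  replace (s + 2 * PI - t) with (s - t + 2 * PI) by ring; now rewrite sin_per.
Qed.

Section Mean.

Variable invf : R * R -> R.
Hypothesis invf_cont : cont invf.
Hypothesis fwd_invf : forall t z, fwd (t, invf (t, z)) = z.
Hypothesis invf_fwd : forall t y, invf (t, fwd (t, y)) = y.
Variable f : R -> R.
Hypothesis f_cont : cont f.
Hypothesis f_per : periodic (2 * PI) f.

(** [diag_term] is a sum of contributions of the incoming and of the outgoing chord. By
    invariance of the measure they may be taken at the same point [t]; the chord ends
    then run over the two halves of the curve, and together give the area. *)
Lemma strip_int_diag_term :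
  strip_int (diag_term invf f) = area * RInt (fun t => f t ^ 2) 0 (2 * PI).
Proof.
assert (rho_nz : forall t, rho t <> 0) by (intros t; apply Rgt_not_eq, rho_pos).
set (U := fun q : R * R => along (fst q) (fst q + snd q) / rho (fst q) * f (fst q) ^ 2).
set (W := fun q : R * R => - along (fst q) (fst q - snd q) / rho (fst q) * f (fst q) ^ 2).
assert (CU : cont U).
{ apply cont_mult; [apply cont_div|]; auto; [apply along_cont| |]; cts. }
assert (CW : cont W).
{ apply cont_mult; [apply cont_div|]; auto; [apply cont_opp, along_cont| |]; cts. }
assert (PU : diag_per U).
{ intros t x; unfold U; simpl; replace (t + 2 * PI + x) with (t + x + 2 * PI) by ring.
  now rewrite along_per, rho_per, f_per. }
assert (PW : diag_per W).
{ intros t x; unfold W; simpl; replace (t + 2 * PI - x) with (t - x + 2 * PI) by ring.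
  now rewrite along_per, rho_per, f_per. }
transitivity (strip_int (fun p => U (step invf p) + W (fst p + snd p, snd p))).
{ unfold strip_int; apply RInt_ext'; intros t; apply RInt_ext'; intros x; f_equal.
  unfold diag_term, jacobi_coeff, U, W; simpl.
  replace (t + x - x) with t by ring; field; auto. }
transitivity (strip_int (fun p => U (step invf p)) + strip_int (fun p => W (fst p + snd p, snd p))).
{ apply strip_int_plus; [|cts].
  apply (cont_comp (step invf) U); auto; now apply step_continuous. }
rewrite (strip_int_step invf invf_cont fwd_invf invf_fwd U CU PU), (strip_int_shear W CW PW).
unfold strip_int.
rewrite <- RInt_plus'.
2: { apply (cont_RInt_param (fun p => U p * weight p)); assert (CX := weight_cont); cts. }
2: { apply (cont_RInt_param (fun p => W p * (rho (fst p) * (rho (fst p - snd p) * sin (snd p))))); cts. }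
rewrite <- RInt_scal' by cts; apply RInt_ext'; intros t.
rewrite <- (area_in_frame t), Rmult_comm.
set (g := fun s => along t s * (rho s * sin (s - t))).
assert (Cg : cont g).
{ apply cont_mult; [apply (along_cont (fun _ => t))|]; cts. }
rewrite <- (RInt_Chasles' g (t - PI) t (t + PI) Cg).
rewrite Rmult_plus_distr_l, Rplus_comm; f_equal.
- transitivity (f t ^ 2 * RInt g (t - PI) (t - 0)); [|now rewrite Rminus_0_r].
  rewrite <- (RInt_reflect g 0 PI t Cg), <- RInt_scal' by cts.
  apply RInt_ext'; intros x; unfold W, g; simpl.
  replace (t - x - t) with (- x) by ring; rewrite sin_neg; field; auto.
- transitivity (f t ^ 2 * RInt g (0 + t) (PI + t)).
  2: { now rewrite Rplus_0_l, Rplus_comm with (r1 := PI). }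
  rewrite <- (RInt_shift g 0 PI t Cg), <- RInt_scal' by cts.
  apply RInt_ext'; intros x; unfold U, g, weight; simpl.
  replace (x + t - t) with x by ring; rewrite (Rplus_comm x t); field; auto.
Qed.

(** Exchanging the two points turns the integral over [0 < x < PI] into the one over
    [- PI < x < 0]; twice the integral is thus that of [h (t) h (s) sin (s - t) ^ 2] over
    all pairs. *)
Lemma strip_int_cross_term :
  let h := fun t => f t * rho t in
  2 * strip_int (cross_term f) =
  (RInt h 0 (2 * PI) ^ 2 - RInt (fun t => h t * cos (2 * t)) 0 (2 * PI) ^ 2
    - RInt (fun t => h t * sin (2 * t)) 0 (2 * PI) ^ 2) / 2.
Proof.
intros h.
assert (Ch : cont h) by (unfold h; cts).
assert (Ph : periodic (2 * PI) h) by (intros t; unfold h; now rewrite f_per, rho_per).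
set (F := fun q : R * R => h (fst q - snd q) * h (fst q) * sin (snd q) ^ 2).
assert (E1 : strip_int (cross_term f) =
  RInt (fun t => RInt (fun x => h t * (h (t + x) * sin x ^ 2)) 0 PI) 0 (2 * PI)).
{ unfold strip_int; apply RInt_ext'; intros t; apply RInt_ext'; intros x.
  unfold cross_term, weight, h; simpl; ring. }
assert (E2 : strip_int (cross_term f) =
  RInt (fun t => RInt (fun x => h t * (h (t - x) * sin x ^ 2)) 0 PI) 0 (2 * PI)).
{ rewrite E1.
  transitivity (RInt (fun t => RInt (fun x => F (t + x, x)) 0 PI) 0 (2 * PI)).
  - apply RInt_ext'; intros t; apply RInt_ext'; intros x; unfold F; simpl.
    replace (t + x - x) with t by ring; ring.
  - rewrite strip_shear.
    + apply RInt_ext'; intros t; apply RInt_ext'; intros x; unfold F; simpl; ring.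
    + unfold F; cts.
    + intros t x; unfold F; simpl; replace (t + 2 * PI - x) with (t - x + 2 * PI) by ring.
      now rewrite !Ph. }
replace (2 * strip_int (cross_term f)) with (strip_int (cross_term f) + strip_int (cross_term f)) by ring.
rewrite E1 at 1; rewrite E2.
rewrite <- RInt_plus'.
2: apply (cont_RInt_param (fun p => h (fst p) * (h (fst p + snd p) * sin (snd p) ^ 2))); cts.
2: apply (cont_RInt_param (fun p => h (fst p) * (h (fst p - snd p) * sin (snd p) ^ 2))); cts.
set (I0 := RInt h 0 (2 * PI)); set (Ic := RInt (fun t => h t * cos (2 * t)) 0 (2 * PI));
set (Is := RInt (fun t => h t * sin (2 * t)) 0 (2 * PI)).
transitivity (RInt (fun t => (I0 / 2) * h t - ((Ic / 2) * (h t * cos (2 * t))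
   + (Is / 2) * (h t * sin (2 * t)))) 0 (2 * PI)).
2: { rewrite RInt_minus', RInt_plus', !RInt_scal' by cts; fold I0 Ic Is; field. }
apply RInt_ext'; intros t.
set (g := fun s => h t * (h s * sin (s - t) ^ 2)).
assert (Cg : cont g) by (unfold g; cts).
transitivity (RInt g (t - PI) (t - PI + 2 * PI)).
{ rewrite <- (RInt_Chasles' g (t - PI) t _ Cg), Rplus_comm; f_equal.
  - transitivity (RInt g (t - PI) (t - 0)); [|now rewrite Rminus_0_r].
    rewrite <- (RInt_reflect g 0 PI t Cg); apply RInt_ext'; intros x; unfold g.
    replace (t - x - t) with (- x) by ring; rewrite sin_neg; ring.
  - transitivity (RInt g (0 + t) (PI + t)); [|f_equal; ring].
    rewrite <- (RInt_shift g 0 PI t Cg); apply RInt_ext'; intros x; unfold g.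
    replace (x + t - t) with x by ring; now rewrite (Rplus_comm x t). }
rewrite (RInt_periodic (2 * PI) g _ Cg).
2: { intros s; unfold g; replace (s + 2 * PI - t) with (s - t + 2 * PI) by ring.
     now rewrite Ph, sin_per. }
rewrite (RInt_ext' _ (fun s => (h t / 2) * h s - ((h t * cos (2 * t) / 2) * (h s * cos (2 * s))
   + (h t * sin (2 * t) / 2) * (h s * sin (2 * s))))).
- rewrite RInt_minus', RInt_plus', !RInt_scal' by cts; fold I0 Ic Is; field.
- intros s; unfold g.
  assert (Q := cos_2a_sin (s - t)); replace (2 * (s - t)) with (2 * s - 2 * t) in Q by ring.
  rewrite cos_minus in Q; simpl.
  replace (sin (s - t) * (sin (s - t) * 1)) with
    ((1 - (cos (2 * s) * cos (2 * t) + sin (2 * s) * sin (2 * t))) / 2) by lra.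
  field.
Qed.

End Mean.

Lemma hopf_inequality (f : R -> R) : cont f -> periodic (2 * PI) f ->
  no_conjugate_angles ->
  let h := fun t => f t * rho t in
  (RInt h 0 (2 * PI) ^ 2 - RInt (fun t => h t * cos (2 * t)) 0 (2 * PI) ^ 2
    - RInt (fun t => h t * sin (2 * t)) 0 (2 * PI) ^ 2) / 2
  <= area * RInt (fun t => f t ^ 2) 0 (2 * PI).
Proof.
intros Hf Hp NC h.
destruct (cont_inverse fwd fwd_cont fwd_incr fwd_onto) as [invf [I1 [I2 I3]]].
rewrite <- (strip_int_diag_term invf I1 I2 I3 f Hf Hp).
assert (E := strip_int_cross_term f Hf Hp); cbv zeta in E; unfold h; rewrite <- E.
now apply second_variation_mean.
Qed.

(** ** An isoperimetric inequality *)

(** On [0 <= x <= 2 PI], [kernel x / (2 PI)] is, up to first harmonics, the periodic Green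
    function of [p |-> p + p''], the operator that sends the support function of a curve
    to its radius of curvature. *)
Definition kernel (x : R) : R := (PI - x) * sin x.

Lemma kernel_cont : cont kernel.
Proof. unfold kernel; cts. Qed.

Lemma kernel_int : RInt kernel 0 (2 * PI) = 2 * PI.
Proof.
rewrite (RInt_of_derive (fun x => - (PI - x) * cos x - sin x)).
- rewrite cos_0, sin_0, cos_2PI, sin_2PI; real_eq; ring.
- intros x; unfold kernel; auto_derive; auto; ring.
- apply kernel_cont.
Qed.

Lemma kernel_nonneg x : 0 <= x <= 2 * PI -> 0 <= kernel x.
Proof.
intros H; unfold kernel; destruct (Rle_dec x PI).
- apply Rmult_le_pos; [lra | apply sin_ge_0; lra].
- assert (sin x <= 0) by (apply sin_le_0; lra); nra.
Qed.

(** Integration by parts: up to the factor [2 PI] this is the height of the centroid of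
    the curve, taken with respect to [dt], over the tangent at [t]. *)
Lemma kernel_rho t : RInt (fun x => rho (t + x) * kernel x) 0 (2 * PI) =
  cos t * (RInt gy 0 (2 * PI) - 2 * PI * gy t) - sin t * (RInt gx 0 (2 * PI) - 2 * PI * gx t).
Proof.
assert (Ca : cont (fun x => above t (t + x))) by (apply (is_derive_cont _ _ (above_fwd_derive t))).
transitivity (RInt (fun x => (rho (t + x) * kernel x - above t (t + x)) + above t (t + x)) 0 (2 * PI)).
{ apply RInt_ext'; intros x; ring. }
assert (Ck := kernel_cont).
rewrite RInt_plus' by cts.
rewrite (RInt_of_derive (fun x => (PI - x) * above t (t + x))).
- rewrite above_per_r, Rplus_0_r, above_self.
  transitivity (RInt (fun x => above t (x + t)) 0 (2 * PI)).
  { transitivity (RInt (fun x => above t (t + x)) 0 (2 * PI)); [real_eq; ring|].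
    apply RInt_ext'; intros x; f_equal; ring. }
  assert (Ca' : cont (above t)) by (apply (is_derive_cont _ _ (above_derive t))).
  rewrite (RInt_shift (above t)), Rplus_0_l, (Rplus_comm _ t), RInt_periodic; auto.
  2: intros s; apply above_per_r.
  rewrite (RInt_ext' _ (fun s => (cos t * gy s - sin t * gx s) + (sin t * gx t - cos t * gy t)))
    by (intros s; unfold above; ring).
  rewrite RInt_plus', RInt_minus', !RInt_scal', RInt_const' by cts'; real_eq; ring.
- intros x; unfold kernel.
  apply (is_derive_eq _ _ (- 1 * above t (t + x) + (PI - x) * (rho (t + x) * sin x))); [|ring].
  apply (is_derive_mult (fun x => PI - x) (fun x => above t (t + x))).
  + auto_derive; auto; ring.
  + apply above_fwd_derive.
  + intros; apply Rmult_comm.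
- cts.
Qed.

(** Expand the square; the mixed term is [rho] times the height of [kernel_rho], whose
    integral is twice the area up to the factor [2 PI]. *)
Lemma isoperimetric_deficit :
  RInt (fun t => RInt (fun x => (rho (t + x) - rho t) ^ 2 * kernel x) 0 (2 * PI)) 0 (2 * PI) =
  4 * PI * (RInt (fun t => rho t ^ 2) 0 (2 * PI) - 2 * area).
Proof.
assert (Ck := kernel_cont).
set (K1 := fun t => RInt (fun x => rho (t + x) ^ 2 * kernel x) 0 (2 * PI)).
assert (CK1 : cont K1) by (apply (cont_RInt_param (fun p => rho (fst p + snd p) ^ 2 * kernel (snd p))); cts).
transitivity (RInt (fun t => K1 t + (2 * PI * rho t ^ 2 - 2 * (rho t *
  (cos t * (RInt gy 0 (2 * PI) - 2 * PI * gy t) - sin t * (RInt gx 0 (2 * PI) - 2 * PI * gx t)))))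
  0 (2 * PI)).
{ apply RInt_ext'; intros t; rewrite <- kernel_rho; unfold K1.
  rewrite (RInt_ext' _ (fun x => rho (t + x) ^ 2 * kernel x + (rho t ^ 2 * kernel x
     - 2 * rho t * (rho (t + x) * kernel x)))) by (intros x; ring).
  rewrite RInt_plus', RInt_minus', !RInt_scal', kernel_int by cts; real_eq; ring. }
set (X := RInt gx 0 (2 * PI)); set (Y := RInt gy 0 (2 * PI)).
rewrite RInt_plus', RInt_minus', !RInt_scal' by cts'.
rewrite (RInt_ext' (fun t => rho t * _) (fun t => (Y * (rho t * cos t) - X * (rho t * sin t))
   + (2 * PI * (gx t * (rho t * sin t)) - 2 * PI * (gy t * (rho t * cos t))))) by (intros t; ring).
rewrite RInt_plus', !RInt_minus', !RInt_scal' by cts'.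
rewrite closed_x, closed_y, int_gy_dgx; fold area.
unfold K1; rewrite (strip_shear (2 * PI) (fun p => rho (fst p) ^ 2 * kernel (snd p))).
- simpl fst; simpl snd.
  rewrite (RInt_ext' (fun t => RInt _ _ _) (fun t => 2 * PI * rho t ^ 2)).
  + rewrite RInt_scal' by cts; real_eq; ring.
  + intros t; rewrite RInt_scal', kernel_int by cts; real_eq; ring.
- cts.
- intros t x; simpl; now rewrite rho_per.
Qed.

(** The integrand of the deficit is nonnegative, so it vanishes and [rho] is constant on
    every half turn. *)
Lemma isoperimetric_rigidity :
  RInt (fun t => rho t ^ 2) 0 (2 * PI) <= 2 * area -> forall t, rho t = rho 0.
Proof.
intros H.
assert (HP := PI_RGT_0); assert (Ck := kernel_cont).
set (J := fun t => RInt (fun x => (rho (t + x) - rho t) ^ 2 * kernel x) 0 (2 * PI)).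
assert (CJ : cont J)
  by (apply (cont_RInt_param (fun p => (rho (fst p + snd p) - rho (fst p)) ^ 2 * kernel (snd p))); cts).
assert (PJ : forall t, 0 <= J t).
{ intros t; apply cont_RInt_nonneg; [lra | cts |].
  intros x Hx; apply Rmult_le_pos; [apply pow2_ge_0 | now apply kernel_nonneg]. }
assert (J0 : RInt J 0 (2 * PI) = 0).
{ apply Rle_antisym.
  - unfold J; rewrite isoperimetric_deficit; nra.
  - apply cont_RInt_nonneg; auto; lra. }
assert (E : forall t x, 0 < t < 2 * PI -> 0 < x < PI -> rho (t + x) = rho t).
{ intros t x Ht Hx.
  assert (Jt := RInt_zero_nonneg J 0 (2 * PI) CJ (fun t _ => PJ t) J0 t Ht).
  assert (Z : (rho (t + x) - rho t) ^ 2 * kernel x = 0).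
  { apply (RInt_zero_nonneg (fun x => (rho (t + x) - rho t) ^ 2 * kernel x) 0 (2 * PI)); auto.
    - cts.
    - intros y Hy; apply Rmult_le_pos; [apply pow2_ge_0 | now apply kernel_nonneg].
    - lra. }
  assert (S := sin_gt_0 x (proj1 Hx) (proj2 Hx)); unfold kernel in Z.
  apply Rmult_integral in Z; destruct Z as [Z|Z]; [nra|].
  apply Rmult_integral in Z; lra. }
(* three half-turn arcs starting at [PI / 2], [PI], [3 * PI / 2] cover a period *)
assert (E2 : rho PI = rho (PI / 2)) by (replace PI with (PI / 2 + PI / 2) at 1 by field; apply E; lra).
assert (E3 : rho (3 * (PI / 2)) = rho (PI / 2))
  by (rewrite <- E2; replace (3 * (PI / 2)) with (PI + PI / 2) by field; apply E; lra).
assert (EC : forall t, PI / 2 <= t < PI / 2 + 2 * PI -> rho t = rho (PI / 2)).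
{ intros t Ht; destruct (Req_dec t (PI / 2)) as [->|N]; auto.
  destruct (Rlt_dec t (3 * (PI / 2))).
  - replace t with (PI / 2 + (t - PI / 2)) by ring; apply E; lra.
  - destruct (Req_dec t (3 * (PI / 2))) as [->|N2]; auto.
    rewrite <- E3; replace t with (3 * (PI / 2) + (t - 3 * (PI / 2))) by ring; apply E; lra. }
assert (EA : forall t, rho t = rho (PI / 2)).
{ intros t; destruct (period_shift (2 * PI) ltac:(lra) (PI / 2) t) as [k Hk].
  rewrite <- (periodic_Z (2 * PI) rho rho_per k t); now apply EC. }
intros t; now rewrite (EA t), (EA 0).
Qed.

Lemma constant_radius : no_conjugate_angles ->
  RInt (fun t => rho t ^ 2 * cos (2 * t)) 0 (2 * PI) = 0 ->
  RInt (fun t => rho t ^ 2 * sin (2 * t)) 0 (2 * PI) = 0 ->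
  forall t, rho t = rho 0.
Proof.
intros NC Hc Hs; apply isoperimetric_rigidity.
assert (HP := PI_RGT_0).
assert (H := hopf_inequality rho rho_cont rho_per NC); cbv zeta in H.
set (J := RInt (fun t => rho t ^ 2) 0 (2 * PI)) in *.
rewrite (RInt_ext' (fun t => rho t * rho t) (fun t => rho t ^ 2)) in H by (intros; ring).
rewrite (RInt_ext' (fun t => rho t * rho t * cos (2 * t)) (fun t => rho t ^ 2 * cos (2 * t))) in H
  by (intros; ring).
rewrite (RInt_ext' (fun t => rho t * rho t * sin (2 * t)) (fun t => rho t ^ 2 * sin (2 * t))) in H
  by (intros; ring).
rewrite Hc, Hs in H; fold J in H.
assert (J0 : 0 < J).
{ apply RInt_gt_0; [lra | intros; apply pow_lt, rho_pos | intros t _].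
  assert (W : cont (fun t => rho t ^ 2)) by cts; apply W. }
apply (Rmult_le_reg_r J); auto; nra.
Qed.

End Oval.

(** * The tangent angle of a closed curve *)

Section Curve.

Variables (x y x1 y1 x2 y2 : R -> R) (ell : R).
Hypothesis ell_pos : 0 < ell.
Hypothesis dx : forall t, is_derive x t (x1 t).
Hypothesis dy : forall t, is_derive y t (y1 t).
Hypothesis dx1 : forall t, is_derive x1 t (x2 t).
Hypothesis dy1 : forall t, is_derive y1 t (y2 t).
Hypothesis cx2 : cont x2.
Hypothesis cy2 : cont y2.
Hypothesis px : periodic ell x.
Hypothesis py : periodic ell y.

Definition bend (t : R) : R := x1 t * y2 t - y1 t * x2 t.
Definition sqspeed (t : R) : R := x1 t ^ 2 + y1 t ^ 2.

Hypothesis bend_pos : forall t, 0 < bend t.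
Hypothesis chord_pos : forall s t, s < t < s + ell ->
  0 < x1 s * (y t - y s) - y1 s * (x t - x s) /\
  0 < x1 t * (y s - y t) - y1 t * (x s - x t).

Let px1 : periodic ell x1 := derive_periodic x x1 ell dx px.
Let py1 : periodic ell y1 := derive_periodic y y1 ell dy py.
Let px2 : periodic ell x2 := derive_periodic x1 x2 ell dx1 px1.
Let py2 : periodic ell y2 := derive_periodic y1 y2 ell dy1 py1.
Let cx1 : cont x1 := is_derive_cont x1 x2 dx1.
Let cy1 : cont y1 := is_derive_cont y1 y2 dy1.

Lemma sqspeed_pos t : 0 < sqspeed t.
Proof.
assert (B := bend_pos t); unfold bend, sqspeed in *.
destruct (Req_dec (x1 t) 0) as [E|E]; [|nra].
destruct (Req_dec (y1 t) 0) as [E'|E']; [|nra].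
rewrite E, E' in B; lra.
Qed.

Definition speed (t : R) : R := sqrt (sqspeed t).
Definition turning (t : R) : R := bend t / sqspeed t.

Lemma speed_pos t : 0 < speed t.
Proof. apply sqrt_lt_R0, sqspeed_pos. Qed.
Lemma speed_sqr t : speed t * speed t = sqspeed t.
Proof. apply sqrt_sqrt, Rlt_le, sqspeed_pos. Qed.
Lemma turning_pos t : 0 < turning t.
Proof. apply Rdiv_lt_0_compat; [apply bend_pos | apply sqspeed_pos]. Qed.
Lemma bend_cont : cont bend. Proof. unfold bend; cts. Qed.
Lemma sqspeed_cont : cont sqspeed. Proof. unfold sqspeed; cts. Qed.
Lemma speed_cont : cont speed.
Proof.
apply (cont_comp1 sqspeed sqrt); [intros u; apply continuous_sqrt | apply sqspeed_cont].
Qed.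
Lemma turning_cont : cont turning.
Proof.
apply cont_div; [apply bend_cont | apply sqspeed_cont | intros t; apply Rgt_not_eq, sqspeed_pos].
Qed.
Lemma turning_per : periodic ell turning.
Proof. intros t; unfold turning, bend, sqspeed; now rewrite px1, py1, px2, py2. Qed.
Lemma speed_per : periodic ell speed.
Proof. intros t; unfold speed, sqspeed; now rewrite px1, py1. Qed.

(** Absence of conjugate points: [u] plays the role of the point opposite to [t n],
    and the last condition is Jacobi's equation with the second derivatives of
    [omega (gamma s) (gamma t)] written out. *)
Definition curve_no_conjugate : Prop :=
  forall t xi : Z -> R,
  (forall n, exists u, t n < t (n + 1)%Z < u /\ u < t n + ell /\
     x1 (t n) * y1 u - y1 (t n) * x1 u = 0) ->
  (forall n, t (n - 1)%Z < t (n + 1)%Z < t (n - 1)%Z + ell) ->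
  (forall n, x1 (t n) * (y (t (n + 1)%Z) - y (t (n - 1)%Z))
     - y1 (t n) * (x (t (n + 1)%Z) - x (t (n - 1)%Z)) = 0) ->
  (forall n, (x1 (t (n - 1)%Z) * y1 (t n) - y1 (t (n - 1)%Z) * x1 (t n)) * xi (n - 1)%Z
     + (x2 (t n) * (y (t (n + 1)%Z) - y (t (n - 1)%Z))
        - y2 (t n) * (x (t (n + 1)%Z) - x (t (n - 1)%Z))) * xi n
     + (x1 (t n) * y1 (t (n + 1)%Z) - y1 (t n) * x1 (t (n + 1)%Z)) * xi (n + 1)%Z = 0) ->
  forall M N, (M < N)%Z -> xi M = 0 -> xi N = 0 -> forall n, xi n = 0.

Section Angle.

Variable ang : R -> R.
Hypothesis ang_derive : forall t, is_derive ang t (turning t).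
Hypothesis ang_0 : x1 0 = speed 0 * cos (ang 0) /\ y1 0 = speed 0 * sin (ang 0).

Lemma ang_cont : cont ang.
Proof. apply (is_derive_cont _ _ ang_derive). Qed.

(** [ang] has the right derivative and the right initial value; it is the tangent angle
    because the components of the velocity along [(cos ang, sin ang)] and normal to
    it solve one and the same linear equation [f' = m f], and the second one starts at
    zero. *)
Lemma velocity_ang t : x1 t = speed t * cos (ang t) /\ y1 t = speed t * sin (ang t).
Proof.
set (m := fun t => (x1 t * x2 t + y1 t * y2 t) / sqspeed t).
assert (Cm : cont m).
{ apply cont_div; [cts | apply sqspeed_cont | intros u; apply Rgt_not_eq, sqspeed_pos]. }
set (X := fun t => x1 t * cos (ang t) + y1 t * sin (ang t)).
set (Y := fun t => - x1 t * sin (ang t) + y1 t * cos (ang t)).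
assert (dc : forall t, is_derive (fun t => cos (ang t)) t (- sin (ang t) * turning t)).
{ intros u; apply (is_derive_chain cos ang u (- sin (ang u)) (turning u)); auto; apply is_derive_cos. }
assert (ds : forall t, is_derive (fun t => sin (ang t)) t (cos (ang t) * turning t)).
{ intros u; apply (is_derive_chain sin ang u (cos (ang u)) (turning u)); auto; apply is_derive_sin. }
assert (dm : forall (f g df dg : R -> R), (forall t, is_derive f t (df t)) ->
   (forall t, is_derive g t (dg t)) ->
   forall t, is_derive (fun t => f t * g t) t (df t * g t + f t * dg t)).
{ intros f g df dg Hf Hg u; apply (is_derive_mult f g u _ _ (Hf u) (Hg u)); intros; apply Rmult_comm. }
assert (dnx1 : forall t, is_derive (fun t => - x1 t) t (- x2 t))
  by (intros u; apply (is_derive_opp x1), dx1).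
assert (HX : forall t, is_derive X t (m t * X t)).
{ intros u; eapply is_derive_eq.
  - apply (is_derive_plus (fun t => x1 t * cos (ang t)) (fun t => y1 t * sin (ang t))).
    + apply (dm _ _ _ _ dx1 dc).
    + apply (dm _ _ _ _ dy1 ds).
  - change plus with Rplus; unfold m, X, turning, bend.
    assert (S := sqspeed_pos u); unfold sqspeed in *; field; lra. }
assert (HY : forall t, is_derive Y t (m t * Y t)).
{ intros u; eapply is_derive_eq.
  - apply (is_derive_plus (fun t => - x1 t * sin (ang t)) (fun t => y1 t * cos (ang t))).
    + apply (dm _ _ _ _ dnx1 ds).
    + apply (dm _ _ _ _ dy1 dc).
  - change plus with Rplus; unfold m, Y, turning, bend.
    assert (S := sqspeed_pos u); unfold sqspeed in *; field; lra. }
destruct ang_0 as [Ex Ey].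
assert (Q0 := sin2_cos2 (ang 0)); assert (Q := sin2_cos2 (ang t)); unfold Rsqr in *.
assert (E0 := exp_pos (RInt m 0 t)).
assert (EX : X 0 = speed 0).
{ unfold X; rewrite Ex, Ey.
  replace (speed 0) with (speed 0 * (sin (ang 0) * sin (ang 0) + cos (ang 0) * cos (ang 0))) at 3
    by (rewrite Q0; ring); ring. }
assert (EY : Y 0 = 0) by (unfold Y; rewrite Ex, Ey; ring).
assert (Xt := linear_ode m X Cm HX t); assert (Yt := linear_ode m Y Cm HY t).
rewrite EX in Xt; rewrite EY, Rmult_0_l in Yt.
assert (XP : 0 < X t) by (rewrite Xt; apply Rmult_lt_0_compat; auto; apply speed_pos).
assert (Ix : x1 t = X t * cos (ang t) - Y t * sin (ang t)).
{ unfold X, Y; transitivity (x1 t * (sin (ang t) * sin (ang t) + cos (ang t) * cos (ang t)));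
    [rewrite Q|]; ring. }
assert (Iy : y1 t = X t * sin (ang t) + Y t * cos (ang t)).
{ unfold X, Y; transitivity (y1 t * (sin (ang t) * sin (ang t) + cos (ang t) * cos (ang t)));
    [rewrite Q|]; ring. }
rewrite Yt in Ix, Iy.
assert (SX : speed t = X t).
{ unfold speed; rewrite <- (sqrt_Rsqr (X t)) by lra; f_equal.
  unfold sqspeed, Rsqr; rewrite Ix, Iy.
  transitivity (X t * X t * (sin (ang t) * sin (ang t) + cos (ang t) * cos (ang t)));
    [ring | rewrite Q; ring]. }
rewrite SX; split; [rewrite Ix at 1 | rewrite Iy at 1]; ring.
Qed.

Lemma ang_incr s t : s < t -> ang s < ang t.
Proof.
intros H; apply (increasing_of_derive ang turning s t ang_derive); try lra.
intros u _; apply turning_pos.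
Qed.

(** A strictly convex curve turns exactly once: tangents at two points of one
    period never point in the same direction. *)
Lemma ang_period t : ang (t + ell) = ang t + 2 * PI.
Proof.
assert (HP := PI_RGT_0).
assert (K : forall t, ang (t + ell) - ang t = ang ell - ang 0).
{ intros u; transitivity (ang (0 + ell) - ang 0); [|now rewrite Rplus_0_l].
  apply (const_of_derive (fun t => ang (t + ell) - ang t)); intros v.
  apply (is_derive_eq _ _ (turning (v + ell) - turning v)); [|rewrite turning_per; ring].
  apply (is_derive_minus (fun t => ang (t + ell)) ang); auto.
  apply (is_derive_chain ang (fun u => u + ell) v (turning (v + ell)) 1); auto;
    [auto_derive; auto | ring]. }
(* [c] is the total turning; it is a positive multiple of [2 PI] *)
set (c := ang ell - ang 0).
assert (c0 : 0 < c) by (assert (A := ang_incr 0 ell ell_pos); unfold c; lra).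
destruct (velocity_ang 0) as [X0 Y0]; destruct (velocity_ang ell) as [Xl Yl].
assert (S0 := speed_pos 0).
assert (P := speed_per 0); rewrite Rplus_0_l in P.
assert (Q1 := px1 0); assert (Q2 := py1 0); rewrite Rplus_0_l in Q1, Q2.
replace (ang ell) with (ang 0 + c) in * by (unfold c; ring).
rewrite P, Q1, X0 in Xl; rewrite P, Q2, Y0 in Yl.
apply Rmult_eq_reg_l in Xl; [|lra]; apply Rmult_eq_reg_l in Yl; [|lra].
assert (cos_c : cos c = 1).
{ replace c with (ang 0 + c - ang 0) by ring; rewrite cos_minus, <- Xl, <- Yl.
  rewrite <- (sin2_cos2 (ang 0)); unfold Rsqr; ring. }
assert (c1 : 2 * PI <= c).
{ destruct (Rle_dec (2 * PI) c) as [L|L]; auto; exfalso.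
  assert (0 < sin (c / 2)) by (apply sin_gt_0; lra).
  assert (E := cos_2a_sin (c / 2)); replace (2 * (c / 2)) with c in E by field; nra. }
assert (c2 : c <= 2 * PI).
{ destruct (Rle_dec c (2 * PI)) as [L|L]; auto; exfalso.
  destruct (IVT_gen ang 0 ell (ang 0 + 2 * PI)) as [s [Hs Es]].
  - intros u; apply continuity_pt_filterlim, ang_cont.
  - rewrite Rmin_left, Rmax_right by (unfold c in *; lra); unfold c in *; lra.
  - rewrite Rmin_left, Rmax_right in Hs by lra.
    assert (s <> 0) by (intros ->; lra).
    assert (s <> ell) by (intros ->; unfold c in *; lra).
    destruct (chord_pos 0 s ltac:(lra)) as [C1 C2].
    destruct (velocity_ang s) as [Xs Ys].
    rewrite Es in Xs, Ys; rewrite cos_per in Xs; rewrite sin_per in Ys.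
    rewrite X0, Y0 in C1; rewrite Xs, Ys in C2.
    assert (Ss := speed_pos s).
    replace (speed 0 * cos (ang 0) * (y s - y 0) - speed 0 * sin (ang 0) * (x s - x 0))
      with (speed 0 * (cos (ang 0) * (y s - y 0) - sin (ang 0) * (x s - x 0))) in C1 by ring.
    replace (speed s * cos (ang 0) * (y 0 - y s) - speed s * sin (ang 0) * (x 0 - x s))
      with (speed s * - (cos (ang 0) * (y s - y 0) - sin (ang 0) * (x s - x 0))) in C2 by ring.
    assert (A1 : 0 < cos (ang 0) * (y s - y 0) - sin (ang 0) * (x s - x 0)).
    { apply (Rmult_lt_reg_l (speed 0)); auto; lra. }
    assert (A2 : 0 < - (cos (ang 0) * (y s - y 0) - sin (ang 0) * (x s - x 0))).
    { apply (Rmult_lt_reg_l (speed s)); auto; lra. }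
    lra. }
assert (Kt := K t); unfold c in *; lra.
Qed.

Lemma ang_onto phi : exists t, ang t = phi.
Proof.
assert (HP := PI_RGT_0).
destruct (period_shift (2 * PI) ltac:(lra) (ang 0) phi) as [k Hk].
assert (E := ang_period 0); rewrite Rplus_0_l in E.
destruct (IVT_gen ang 0 ell (phi + IZR k * (2 * PI))) as [s [_ Es]].
- intros u; apply continuity_pt_filterlim, ang_cont.
- rewrite Rmin_left, Rmax_right by lra; lra.
- exists (s + IZR (- k) * ell).
  assert (P : periodic ell (fun t => ang t - 2 * PI / ell * t)).
  { intros t; rewrite ang_period; field; lra. }
  assert (W := periodic_Z ell _ P (- k) s); simpl in W.
  rewrite opp_IZR in *.
  replace (2 * PI / ell * (s + - IZR k * ell)) with (2 * PI / ell * s - IZR k * (2 * PI)) in W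
    by (field; lra).
  lra.
Qed.

Variable par : R -> R.
Hypothesis par_cont : cont par.
Hypothesis ang_par : forall phi, ang (par phi) = phi.
Hypothesis par_ang : forall t, par (ang t) = t.

Lemma par_per phi : par (phi + 2 * PI) = par phi + ell.
Proof. rewrite <- (par_ang (par phi + ell)), ang_period, ang_par; reflexivity. Qed.

Lemma par_incr a b : a < b -> par a < par b.
Proof.
intros H; destruct (Rtotal_order (par a) (par b)) as [L|[L|L]]; auto; exfalso.
- apply (f_equal ang) in L; rewrite !ang_par in L; lra.
- apply ang_incr in L; rewrite !ang_par in L; lra.
Qed.

(** Arc length per unit of tangent angle. *)
Definition radius (phi : R) : R := speed (par phi) / turning (par phi).

Lemma radius_cont : cont radius.
Proof.
assert (W1 := speed_cont); assert (W2 := turning_cont).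
apply cont_div; [cts | cts | intros; apply Rgt_not_eq, turning_pos].
Qed.
Lemma radius_pos phi : 0 < radius phi.
Proof. apply Rdiv_lt_0_compat; [apply speed_pos | apply turning_pos]. Qed.
Lemma radius_per : periodic (2 * PI) radius.
Proof. intros phi; unfold radius; now rewrite par_per, speed_per, turning_per. Qed.
Lemma radius_ang t : radius (ang t) = speed t / turning t.
Proof. unfold radius; now rewrite par_ang. Qed.

Lemma x_gx s t : x s - x t = gx radius (ang s) - gx radius (ang t).
Proof.
assert (E : x s - gx radius (ang s) = x t - gx radius (ang t)); [|lra].
apply (const_of_derive (fun t => x t - gx radius (ang t))); intros u.
apply (is_derive_eq _ _ (x1 u - radius (ang u) * cos (ang u) * turning u)).
- apply (is_derive_minus x (fun t => gx radius (ang t))); auto.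
  apply (is_derive_chain (gx radius) ang u (radius (ang u) * cos (ang u)) (turning u)); auto.
  apply gx_derive, radius_cont.
- rewrite radius_ang, (proj1 (velocity_ang u)); field; apply Rgt_not_eq, turning_pos.
Qed.

Lemma y_gy s t : y s - y t = gy radius (ang s) - gy radius (ang t).
Proof.
assert (E : y s - gy radius (ang s) = y t - gy radius (ang t)); [|lra].
apply (const_of_derive (fun t => y t - gy radius (ang t))); intros u.
apply (is_derive_eq _ _ (y1 u - radius (ang u) * sin (ang u) * turning u)).
- apply (is_derive_minus y (fun t => gy radius (ang t))); auto.
  apply (is_derive_chain (gy radius) ang u (radius (ang u) * sin (ang u)) (turning u)); auto.
  apply gy_derive, radius_cont.
- rewrite radius_ang, (proj2 (velocity_ang u)); field; apply Rgt_not_eq, turning_pos.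
Qed.

Lemma radius_closed_x : RInt (fun u => radius u * cos u) 0 (2 * PI) = 0.
Proof.
assert (E := x_gx (par 0 + ell) (par 0)).
rewrite px, ang_period, ang_par, Rplus_0_l in E.
assert (E0 : gx radius 0 = 0) by apply (RInt_point (V := R_CompleteNormedModule)).
change (gx radius (2 * PI) = 0); lra.
Qed.
Lemma radius_closed_y : RInt (fun u => radius u * sin u) 0 (2 * PI) = 0.
Proof.
assert (E := y_gy (par 0 + ell) (par 0)).
rewrite py, ang_period, ang_par, Rplus_0_l in E.
assert (E0 : gy radius 0 = 0) by apply (RInt_point (V := R_CompleteNormedModule)).
change (gy radius (2 * PI) = 0); lra.
Qed.

(** Substitution of [phi = ang t]. *)
Lemma radius_moment (g : R -> R) : cont g -> periodic (2 * PI) g ->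
  RInt (fun phi => radius phi ^ 2 * g phi) 0 (2 * PI) =
  RInt (fun t => sqspeed t ^ 2 / bend t * g (ang t)) 0 ell.
Proof.
intros Cg Pg.
assert (Cr := radius_cont).
assert (C : cont (fun phi => radius phi ^ 2 * g phi)) by cts.
transitivity (RInt (fun phi => radius phi ^ 2 * g phi) (ang 0) (ang 0 + 2 * PI)).
{ symmetry; apply RInt_periodic; [exact C | intros u; now rewrite radius_per, Pg]. }
rewrite <- ang_period, Rplus_0_l.
rewrite <- (RInt_comp (fun phi => radius phi ^ 2 * g phi) ang turning).
- apply RInt_ext'; intros t; change scal with Rmult; cbv beta; rewrite radius_ang.
  replace ((speed t / turning t) ^ 2) with (sqspeed t / turning t ^ 2)
    by (rewrite <- speed_sqr; field; apply Rgt_not_eq, turning_pos).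
  unfold turning; field.
  split; apply Rgt_not_eq; [apply bend_pos | apply sqspeed_pos].
- intros t _; apply C.
- intros t _; split; [apply ang_derive | apply turning_cont].
Qed.

Hypothesis no_conj : curve_no_conjugate.

Lemma cross_velocity s t :
  x1 s * y1 t - y1 s * x1 t = speed s * speed t * sin (ang t - ang s).
Proof.
destruct (velocity_ang s) as [-> ->]; destruct (velocity_ang t) as [-> ->].
rewrite sin_minus; ring.
Qed.

(** A field [eta] in arc length is the field [eta / speed] in the parameter [t]. Since the
    chord from the first to the third point is parallel to the tangent at the second, only
    the normal component of the acceleration enters Jacobi's equation. *)
Lemma radius_no_conjugate : no_conjugate_angles radius.
Proof.
assert (HP := PI_RGT_0).
intros th eta Hth Hconf Hjac M N HMN HM HN.
set (t := fun n => par (th n)).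
assert (At : forall n, ang (t n) = th n) by (intros n; apply ang_par).
assert (V : forall n, speed (t n) <> 0) by (intros n; apply Rgt_not_eq, speed_pos).
assert (Eta0 : forall n, eta n / speed (t n) = 0).
2: { intros n; assert (E := Eta0 n).
     replace (eta n) with (eta n / speed (t n) * speed (t n)) by (field; apply V).
     rewrite E; ring. }
assert (Hm : forall n, 0 < th n - th (n - 1)%Z < PI).
{ intros n; assert (A := Hth (n - 1)%Z); now replace (n - 1 + 1)%Z with n in A by ring. }
assert (Cross : forall n,
  cos (th n) * (gy radius (th (n + 1)%Z) - gy radius (th (n - 1)%Z))
  - sin (th n) * (gx radius (th (n + 1)%Z) - gx radius (th (n - 1)%Z)) = 0).
{ intros n; assert (A := Hconf n); unfold above in A; lra. }
unfold curve_no_conjugate in no_conj.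
apply (no_conj t (fun n => eta n / speed (t n))) with (M := M) (N := N); auto.
- intros n; exists (par (th n + PI)); assert (A := Hth n); unfold t; repeat split.
  + apply par_incr; lra.
  + apply par_incr; lra.
  + rewrite <- par_per; apply par_incr; lra.
  + rewrite cross_velocity, !ang_par.
    replace (th n + PI - th n) with PI by ring; rewrite sin_PI; ring.
- intros n; assert (A := Hth n); assert (B := Hm n); unfold t; split.
  + apply par_incr; lra.
  + rewrite <- par_per; apply par_incr; lra.
- intros n; rewrite x_gx, y_gy, !At.
  destruct (velocity_ang (t n)) as [-> ->]; rewrite At.
  assert (A := Cross n).
  transitivity (speed (t n) *
    (cos (th n) * (gy radius (th (n + 1)%Z) - gy radius (th (n - 1)%Z))
     - sin (th n) * (gx radius (th (n + 1)%Z) - gx radius (th (n - 1)%Z)))); [ring|].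
  rewrite A; ring.
- intros n; rewrite x_gx, y_gy, !cross_velocity, !At.
  assert (A := Cross n); assert (J := Hjac n).
  rewrite <- (At n), radius_ang, (At n) in J.
  set (DX := gx radius (th (n + 1)%Z) - gx radius (th (n - 1)%Z)) in *.
  set (DY := gy radius (th (n + 1)%Z) - gy radius (th (n - 1)%Z)) in *.
  (* the chord [(DX, DY)] is [lam] times the unit tangent *)
  set (lam := cos (th n) * DX + sin (th n) * DY).
  assert (Q := sin2_cos2 (th n)); unfold Rsqr in Q.
  assert (EX : DX = lam * cos (th n)).
  { transitivity (DX * (sin (th n) * sin (th n) + cos (th n) * cos (th n))
       + sin (th n) * (cos (th n) * DY - sin (th n) * DX)); [rewrite Q, A; ring | unfold lam; ring]. }
  assert (EY : DY = lam * sin (th n)).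
  { transitivity (DY * (sin (th n) * sin (th n) + cos (th n) * cos (th n))
       - cos (th n) * (cos (th n) * DY - sin (th n) * DX)); [rewrite Q, A; ring | unfold lam; ring]. }
  replace (along radius (th n) (th (n + 1)%Z) - along radius (th n) (th (n - 1)%Z)) with lam in J
    by (unfold along, lam, DX, DY; ring).
  assert (ES : x2 (t n) * DY - y2 (t n) * DX = - lam * turning (t n) * speed (t n)).
  { rewrite EX, EY.
    assert (B : bend (t n) = speed (t n) * (cos (th n) * y2 (t n) - sin (th n) * x2 (t n))).
    { unfold bend; rewrite (proj1 (velocity_ang (t n))), (proj2 (velocity_ang (t n))), At; ring. }
    unfold turning; rewrite B, <- speed_sqr; field; apply V. }
  rewrite ES.
  assert (T := turning_pos (t n)).
  transitivity (speed (t n) * (sin (th n - th (n - 1)%Z) * eta (n - 1)%Z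
     + sin (th (n + 1)%Z - th n) * eta (n + 1)%Z
     - lam / (speed (t n) / turning (t n)) * eta n)).
  + field; repeat split; try apply V; lra.
  + rewrite J; ring.
- rewrite HM; unfold Rdiv; ring.
- rewrite HN; unfold Rdiv; ring.
Qed.

Hypothesis moment_cos : RInt (fun t => (x1 t ^ 2 - y1 t ^ 2) * sqspeed t / bend t) 0 ell = 0.
Hypothesis moment_sin : RInt (fun t => x1 t * y1 t * sqspeed t / bend t) 0 ell = 0.

Lemma radius_const phi : radius phi = radius 0.
Proof.
assert (N : forall t, bend t <> 0) by (intros t; apply Rgt_not_eq, bend_pos).
apply constant_radius.
- apply radius_cont.
- apply radius_pos.
- apply radius_per.
- apply radius_closed_x.
- apply radius_closed_y.
- apply radius_no_conjugate.
- rewrite (radius_moment (fun u => cos (2 * u))).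
  + transitivity (RInt (fun t => (x1 t ^ 2 - y1 t ^ 2) * sqspeed t / bend t) 0 ell);
      [|exact moment_cos].
    apply RInt_ext'; intros t.
    rewrite (proj1 (velocity_ang t)), (proj2 (velocity_ang t)), cos_2a.
    rewrite <- (speed_sqr t); field; auto.
  + cts.
  + intros u; replace (2 * (u + 2 * PI)) with (2 * u + 2 * PI + 2 * PI) by ring.
    now rewrite !cos_per.
- rewrite (radius_moment (fun u => sin (2 * u))).
  + transitivity (2 * RInt (fun t => x1 t * y1 t * sqspeed t / bend t) 0 ell);
      [|rewrite moment_sin; real_eq; ring].
    rewrite <- RInt_scal'.
    * apply RInt_ext'; intros t.
      rewrite (proj1 (velocity_ang t)), (proj2 (velocity_ang t)), sin_2a.
      rewrite <- (speed_sqr t); field; auto.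
    * assert (W := sqspeed_cont); apply cont_div; [cts | apply bend_cont | auto].
  + cts.
  + intros u; replace (2 * (u + 2 * PI)) with (2 * u + 2 * PI + 2 * PI) by ring.
    now rewrite !sin_per.
Qed.

(** For the last clause, test with the tangent line on the far side of [q] as seen from
    the centre. *)
Lemma curve_is_circle_aux : exists cx cy r, 0 < r /\
  (forall t, (x t - cx) ^ 2 + (y t - cy) ^ 2 = r ^ 2) /\
  (forall qx qy, (forall t, 0 < x1 t * (qy - y t) - y1 t * (qx - x t)) ->
     (qx - cx) ^ 2 + (qy - cy) ^ 2 < r ^ 2).
Proof.
set (r := radius 0).
assert (r0 : 0 < r) by apply radius_pos.
assert (Ex : forall t, gx radius (ang t) = r * sin (ang t)).
{ intros t; unfold gx.
  rewrite (RInt_ext' _ (fun u => r * cos u)) by (intros u; now rewrite radius_const).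
  transitivity (r * sin (ang t) - r * sin 0); [|rewrite sin_0; ring].
  apply (RInt_of_derive (fun u => r * sin u)); [intros u; auto_derive; auto; real_eq; ring | cts]. }
assert (Ey : forall t, gy radius (ang t) = r * (1 - cos (ang t))).
{ intros t; unfold gy.
  rewrite (RInt_ext' _ (fun u => r * sin u)) by (intros u; now rewrite radius_const).
  transitivity (- r * cos (ang t) - - r * cos 0); [|rewrite cos_0; ring].
  apply (RInt_of_derive (fun u => - r * cos u)); [intros u; auto_derive; auto; real_eq; ring | cts]. }
set (cx := x (par 0)); set (cy := y (par 0) + r).
assert (Xt : forall t, x t = cx + r * sin (ang t)).
{ intros t; assert (E := x_gx t (par 0)); rewrite !Ex, ang_par, sin_0 in E; unfold cx; lra. }
assert (Yt : forall t, y t = cy - r * cos (ang t)).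
{ intros t; assert (E := y_gy t (par 0)); rewrite !Ey, ang_par, cos_0 in E; unfold cy; lra. }
exists cx, cy, r; split; [auto|split].
- intros t; rewrite Xt, Yt.
  transitivity (r ^ 2 * ((sin (ang t))² + (cos (ang t))²)); [unfold Rsqr; ring|].
  rewrite sin2_cos2; ring.
- intros qx qy H.
  destruct (polar_form (qx - cx) (qy - cy)) as [d [a [d0 [Ea Eb]]]].
  rewrite Ea, Eb.
  replace ((d * cos a) ^ 2 + (d * sin a) ^ 2) with (d ^ 2)
    by (transitivity (d ^ 2 * ((sin a)² + (cos a)²)); [rewrite sin2_cos2; ring | unfold Rsqr; ring]).
  (* the tangent with outer normal [(cos a, sin a)] *)
  assert (K := H (par (a + PI / 2))).
  rewrite Xt, Yt, (proj1 (velocity_ang _)), (proj2 (velocity_ang _)), ang_par in K.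
  rewrite cos_plus, sin_plus, cos_PI2, sin_PI2 in K.
  set (v := speed _) in K; assert (v0 : 0 < v) by apply speed_pos.
  replace qx with (cx + d * cos a) in K by lra; replace qy with (cy + d * sin a) in K by lra.
  assert (Q := sin2_cos2 a); unfold Rsqr in Q.
  assert (d < r).
  { apply (Rmult_lt_reg_l v); auto.
    apply Rminus_lt_0.
    replace (v * r - v * d) with ((v * r - v * d) * (sin a * sin a + cos a * cos a)) by (rewrite Q; ring).
    eapply Rlt_le_trans; [exact K | right; ring]. }
  nra.
Qed.

End Angle.

Lemma curve_is_circle : curve_no_conjugate ->
  RInt (fun t => (x1 t ^ 2 - y1 t ^ 2) * sqspeed t / bend t) 0 ell = 0 ->
  RInt (fun t => x1 t * y1 t * sqspeed t / bend t) 0 ell = 0 ->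
  exists cx cy r, 0 < r /\
  (forall t, (x t - cx) ^ 2 + (y t - cy) ^ 2 = r ^ 2) /\
  (forall qx qy, (forall t, 0 < x1 t * (qy - y t) - y1 t * (qx - x t)) ->
     (qx - cx) ^ 2 + (qy - cy) ^ 2 < r ^ 2).
Proof.
intros NC Mc Ms.
destruct (polar_form (x1 0) (y1 0)) as [r [phi [r0 [Ex Ey]]]].
set (ang := fun t => phi + RInt turning 0 t).
assert (A0 : ang 0 = phi).
{ unfold ang; rewrite (RInt_point (V := R_CompleteNormedModule)); apply Rplus_0_r. }
assert (dA : forall t, is_derive ang t (turning t)).
{ intros t; apply (is_derive_eq _ _ (0 + turning t)); [|ring].
  apply (is_derive_plus (fun _ => phi) (fun t => RInt turning 0 t)).
  - apply (is_derive_const phi t).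
  - apply cont_RInt_derive, turning_cont. }
assert (E0 : speed 0 = r).
{ transitivity (sqrt (Rsqr r)); [|now apply sqrt_Rsqr].
  unfold speed, sqspeed; rewrite Ex, Ey; f_equal; unfold Rsqr at 1.
  transitivity (r ^ 2 * ((sin phi)² + (cos phi)²)); [unfold Rsqr; ring | rewrite sin2_cos2; ring]. }
assert (HA : x1 0 = speed 0 * cos (ang 0) /\ y1 0 = speed 0 * sin (ang 0)).
{ rewrite E0, A0; auto. }
assert (CA := ang_cont ang dA).
destruct (cont_inverse (fun p => ang (snd p))) as [inv [I1 [I2 I3]]].
- cts.
- intros t a b; apply (ang_incr ang dA).
- intros t; apply (ang_onto ang dA HA).
- apply (curve_is_circle_aux ang dA HA (fun phi => inv (0, phi))); auto.
  + cts.
  + intros z; apply (I2 0 z).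
  + intros t; apply (I3 0 t).
Qed.

End Curve.

(** * Strictly convex domains *)

Section Domain.

Variables (D : point -> Prop).
Hypothesis hD : strictly_convex_domain D.

Lemma closure_of_mem p : D p -> closure D p.
Proof. intros H L; apply locally_singleton in L; auto. Qed.

Lemma boundary_not_mem p : boundary D p -> ~ D p.
Proof. intros [_ H] Hp; apply H; now apply (proj1 hD). Qed.

Lemma mem_comb p q a : D p -> closure D q -> 0 < a < 1 ->
  D ((1 - a) * fst p + a * fst q, (1 - a) * snd p + a * snd q).
Proof.
intros Hp Hq Ha; destruct hD as [_ [_ HC]].
assert (E : {p = q} + {p <> q}) by apply excluded_middle_informative.
destruct E as [<-|N].
- replace (_, _) with p; auto; destruct p; simpl; f_equal; ring.
- apply (HC p q a); auto; now apply closure_of_mem.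
Qed.

Lemma mem_triangle p q r g (a b c : R) : D p -> D q -> closure D r ->
  0 < a -> 0 < b -> 0 < c ->
  a * (fst p - fst g) + b * (fst q - fst g) + c * (fst r - fst g) = 0 ->
  a * (snd p - snd g) + b * (snd q - snd g) + c * (snd r - snd g) = 0 ->
  D g.
Proof.
intros Hp Hq Hr Ha Hb Hc E1 E2.
assert (C1 : 0 < c / (b + c) < 1).
{ split; [apply Rdiv_lt_0_compat; lra|].
  apply (Rmult_lt_reg_r (b + c)); [lra|]; replace (c / (b + c) * (b + c)) with c by (field; lra); lra. }
assert (C2 : 0 < a / (a + b + c) < 1).
{ split; [apply Rdiv_lt_0_compat; lra|].
  apply (Rmult_lt_reg_r (a + b + c)); [lra|].
  replace (a / (a + b + c) * (a + b + c)) with a by (field; lra); lra. }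
assert (M := mem_comb q r _ Hq Hr C1).
assert (M2 := mem_comb _ p _ M (closure_of_mem p Hp) C2); simpl in M2.
replace g with
  ((1 - a / (a + b + c)) * ((1 - c / (b + c)) * fst q + c / (b + c) * fst r) + a / (a + b + c) * fst p,
   (1 - a / (a + b + c)) * ((1 - c / (b + c)) * snd q + c / (b + c) * snd r) + a / (a + b + c) * snd p);
  auto.
destruct g as [g1 g2]; simpl in *; f_equal.
- replace g1 with ((a * fst p + b * fst q + c * fst r) / (a + b + c)).
  + field; lra.
  + apply (Rmult_eq_reg_r (a + b + c)); [|lra]; field_simplify; lra.
- replace g2 with ((a * snd p + b * snd q + c * snd r) / (a + b + c)).
  + field; lra.
  + apply (Rmult_eq_reg_r (a + b + c)); [|lra]; field_simplify; lra.
Qed.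

(** Walk from a point of [D] towards [p]: the last point before leaving [D] is
    a boundary point. *)
Lemma boundary_on_segment o p : D o -> ~ D p ->
  exists s, 0 <= s <= 1 /\
    boundary D ((1 - s) * fst o + s * fst p, (1 - s) * snd o + s * snd p).
Proof.
intros Ho Hp.
set (z := fun s => ((1 - s) * fst o + s * fst p, (1 - s) * snd o + s * snd p) : point).
assert (Cz : forall s, continuous z s).
{ intros s; apply (continuous_pair (fun s => (1 - s) * fst o + s * fst p)
    (fun s => (1 - s) * snd o + s * snd p)).
  - assert (W : cont (fun s : R => (1 - s) * fst o + s * fst p)) by cts; apply W.
  - assert (W : cont (fun s : R => (1 - s) * snd o + s * snd p)) by cts; apply W. }
assert (z0 : z 0 = o) by (unfold z; destruct o; simpl; f_equal; ring).
assert (z1 : z 1 = p) by (unfold z; destruct p; simpl; f_equal; ring).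
destruct (completeness (fun s => 0 <= s <= 1 /\ D (z s))) as [m [U L]].
- exists 1; intros s [Hs _]; lra.
- exists 0; split; [lra | now rewrite z0].
- assert (m0 : 0 <= m) by (apply U; split; [lra | now rewrite z0]).
  assert (m1 : m <= 1) by (apply L; intros s [Hs _]; lra).
  exists m; split; [lra|]; split.
  + intros N; apply (Cz m) in N; destruct N as [e He].
    assert (e0 := cond_pos e).
    assert (m <= m - e); [|lra].
    apply L; intros s [Hs Ds].
    destruct (Rle_dec s (m - e)) as [|G]; auto; exfalso.
    assert (s <= m) by (apply U; auto).
    apply (He s); auto; apply Rabs_lt_between'; lra.
  + intros N; apply (Cz m) in N; destruct N as [e He].
    assert (e0 := cond_pos e).
    destruct (Rlt_dec m 1) as [G|G].
    * set (s := Rmin 1 (m + e / 2)).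
      assert (s <= 1) by apply Rmin_l.
      assert (s <= m + e / 2) by apply Rmin_r.
      assert (m < s) by (apply Rmin_glb_lt; lra).
      assert (s <= m); [|lra].
      apply U; split; [lra|]; apply He; apply Rabs_lt_between'; lra.
    * assert (E : m = 1) by lra.
      apply Hp; rewrite <- z1, <- E; apply He, ball_center.
Qed.

Variables (ell : R) (gamma : R -> point).
Hypothesis hell : 0 < ell.
Hypothesis hgamma : boundary_param D ell gamma.
Hypothesis hcurv : forall t : R, 0 < curvature gamma t.

Let g1 (t : R) : R := fst (gamma t).
Let g2 (t : R) : R := snd (gamma t).
Let a1 : R -> R := Derive_n g1 1.
Let a2 : R -> R := Derive_n g2 1.
Let b1 : R -> R := Derive_n g1 2.
Let b2 : R -> R := Derive_n g2 2.

Lemma d_g1 t : is_derive g1 t (a1 t).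
Proof. apply Derive_correct; apply (proj1 (bp_smooth _ _ _ hgamma 1%nat t)). Qed.
Lemma d_g2 t : is_derive g2 t (a2 t).
Proof. apply Derive_correct; apply (proj2 (bp_smooth _ _ _ hgamma 1%nat t)). Qed.
Lemma d_a1 t : is_derive a1 t (b1 t).
Proof. apply Derive_correct; apply (proj1 (bp_smooth _ _ _ hgamma 2%nat t)). Qed.
Lemma d_a2 t : is_derive a2 t (b2 t).
Proof. apply Derive_correct; apply (proj2 (bp_smooth _ _ _ hgamma 2%nat t)). Qed.
Lemma c_b1 : cont b1.
Proof.
intros t; apply (ex_derive_continuous b1); apply (proj1 (bp_smooth _ _ _ hgamma 3%nat t)).
Qed.
Lemma c_b2 : cont b2.
Proof.
intros t; apply (ex_derive_continuous b2); apply (proj2 (bp_smooth _ _ _ hgamma 3%nat t)).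
Qed.

Lemma gamma_per t : gamma (t + ell) = gamma t.
Proof. apply (bp_inj _ _ _ hgamma); exists 1%Z; simpl; ring. Qed.

Lemma gamma_neq s t : s < t < s + ell -> gamma t <> gamma s.
Proof.
intros H E; apply (bp_inj _ _ _ hgamma) in E; destruct E as [k Hk].
assert (K1 : 0 < IZR k * ell) by lra; assert (K2 : IZR k * ell < 1 * ell) by lra.
apply Rmult_lt_reg_r in K2; auto; apply (lt_IZR k 1) in K2.
assert (K3 : 0 < IZR k) by (apply (Rmult_lt_reg_r ell); lra).
apply (lt_IZR 0) in K3; lia.
Qed.

Lemma gamma_boundary t : boundary D (gamma t).
Proof. apply (bp_image _ _ _ hgamma); now exists t. Qed.

Lemma bend_gamma_pos t : 0 < a1 t * b2 t - a2 t * b1 t.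
Proof.
assert (H := hcurv t).
change (0 < (a1 t * b2 t - a2 t * b1 t) / norm (velocity gamma t) ^ 3) in H.
assert (N : 0 < norm (velocity gamma t) ^ 3).
{ apply pow_lt, norm_gt_0, (bp_regular _ _ _ hgamma). }
set (k := a1 t * b2 t - a2 t * b1 t) in *.
replace k with (k / norm (velocity gamma t) ^ 3 * norm (velocity gamma t) ^ 3)
  by (field; intros Z; rewrite Z in N; simpl in N; lra).
now apply Rmult_lt_0_compat.
Qed.

Lemma velocity_sqr_pos t : 0 < a1 t ^ 2 + a2 t ^ 2.
Proof.
assert (B := bend_gamma_pos t).
destruct (Req_dec (a1 t) 0) as [E|E]; [|nra].
destruct (Req_dec (a2 t) 0) as [E'|E']; [|nra].
rewrite E, E' in B; lra.
Qed.

Lemma inner_normal t : exists e, 0 < e /\ D (g1 t - e * a2 t, g2 t + e * a1 t).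
Proof.
destruct (bp_ccw _ _ _ hgamma t) as [d Hd]; assert (d0 := cond_pos d).
exists (d / 2); split; [lra|].
assert (H := Hd (d / 2) ltac:(apply Rabs_lt_between'; lra) ltac:(lra)).
replace (_, _) with (plus (gamma t) (scal (d / 2) (rot90 (velocity gamma t)))); auto.
change ((g1 t + d / 2 * - a2 t, g2 t + d / 2 * a1 t) =
  (g1 t - d / 2 * a2 t, g2 t + d / 2 * a1 t)).
f_equal; ring.
Qed.

(** If [q] were strictly outside the tangent, then, since the curve crosses the line
    through [q] and [gamma t], a nearby point of the curve, a point on the inner normal
    and [q] would span a triangle (a segment, if [q] is on the normal) around [gamma t],
    which would then lie in [D]. *)
Lemma tangent_support_weak t q : D q ->
  0 <= a1 t * (snd q - g2 t) - a2 t * (fst q - g1 t).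
Proof.
intros Hq.
destruct (Rle_dec 0 (a1 t * (snd q - g2 t) - a2 t * (fst q - g1 t))) as [L|L]; auto; exfalso.
apply (boundary_not_mem _ (gamma_boundary t)).
destruct (inner_normal t) as [e [e0 He]].
set (u1 := fst q - g1 t) in *; set (u2 := snd q - g2 t) in *.
assert (N := velocity_sqr_pos t).
assert (dF : forall l m : R, is_derive (fun s => l * (g2 s - g2 t) - m * (g1 s - g1 t)) t
   (l * a2 t - m * a1 t)).
{ intros l m; apply (is_derive_eq _ _ (l * (a2 t - 0) - m * (a1 t - 0))); [|ring].
  apply (is_derive_minus (fun s => l * (g2 s - g2 t)) (fun s => m * (g1 s - g1 t))).
  - apply (is_derive_scal (fun s => g2 s - g2 t)), (is_derive_minus g2 (fun _ => g2 t));
      [apply d_g2 | apply (is_derive_const (g2 t) t)].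
  - apply (is_derive_scal (fun s => g1 s - g1 t)), (is_derive_minus g1 (fun _ => g1 t));
      [apply d_g1 | apply (is_derive_const (g1 t) t)]. }
destruct (sign_near_zero _ t _ (dF u1 u2) ltac:(cbv beta; ring) ltac:(lra)) as [d [d0 [F1 F2]]].
destruct (sign_near_zero _ t _ (dF (a2 t) (- a1 t)) ltac:(cbv beta; ring) ltac:(nra)) as [d' [d0' [G1 G2]]].
set (h := Rmin d d' / 2).
assert (hd : h < d) by (assert (A := Rmin_l d d'); unfold h; lra).
assert (hd' : h < d') by (assert (A := Rmin_r d d'); unfold h; lra).
assert (h0 : 0 < h) by (assert (A := Rmin_glb_lt d d' 0 d0 d0'); unfold h; lra).
assert (Cl : forall s, closure D (gamma s)) by (intros s; apply gamma_boundary).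
destruct (Rtotal_order (a1 t * u1 + a2 t * u2) 0) as [T|[T|T]].
- assert (F := F1 (t + h) ltac:(lra)); assert (G := G1 (t + h) ltac:(lra)).
  apply (mem_triangle (g1 t - e * a2 t, g2 t + e * a1 t) q (gamma (t + h)) (gamma t)
    (u1 * (g2 (t + h) - g2 t) - u2 * (g1 (t + h) - g1 t))
    (e * (a2 t * (g2 (t + h) - g2 t) - - a1 t * (g1 (t + h) - g1 t)))
    (e * - (a1 t * u1 + a2 t * u2))); auto; try (apply Rmult_lt_0_compat; lra); simpl;
    fold (g1 t) (g2 t) (g1 (t + h)) (g2 (t + h)); unfold u1, u2; ring.
- set (k := - (a1 t * u2 - a2 t * u1)) in *.
  assert (k0 : 0 < k) by (unfold k; lra).
  apply (mem_triangle q q (g1 t - e * a2 t, g2 t + e * a1 t) (gamma t)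
    (e * (a1 t ^ 2 + a2 t ^ 2)) (e * (a1 t ^ 2 + a2 t ^ 2)) (2 * k)); auto;
    try (apply Rmult_lt_0_compat; lra).
  + now apply closure_of_mem.
  + simpl fst; fold (g1 t); fold u1; unfold k.
    transitivity (2 * e * a1 t * (a1 t * u1 + a2 t * u2)); [ring | rewrite T; ring].
  + simpl snd; fold (g2 t); fold u2; unfold k.
    transitivity (2 * e * a2 t * (a1 t * u1 + a2 t * u2)); [ring | rewrite T; ring].
- assert (F := F2 (t - h) ltac:(lra)); assert (G := G2 (t - h) ltac:(lra)).
  apply (mem_triangle (g1 t - e * a2 t, g2 t + e * a1 t) q (gamma (t - h)) (gamma t)
    (- (u1 * (g2 (t - h) - g2 t) - u2 * (g1 (t - h) - g1 t)))
    (e * - (a2 t * (g2 (t - h) - g2 t) - - a1 t * (g1 (t - h) - g1 t)))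
    (e * (a1 t * u1 + a2 t * u2))); auto; try (apply Rmult_lt_0_compat; lra); try lra; simpl;
    fold (g1 t) (g2 t) (g1 (t - h)) (g2 (t - h)); unfold u1, u2; ring.
Qed.

(** [D] is open, so [q] may be moved a little towards the outside of the tangent. *)
Lemma tangent_support t q : D q ->
  0 < a1 t * (snd q - g2 t) - a2 t * (fst q - g1 t).
Proof.
intros Hq.
assert (N := velocity_sqr_pos t).
destruct (proj1 hD q Hq) as [e He]; assert (e0 := cond_pos e).
set (m := 1 + Rabs (a1 t) + Rabs (a2 t)).
assert (A1 := Rabs_pos (a1 t)); assert (A2 := Rabs_pos (a2 t)).
assert (m0 : 0 < m) by (unfold m; lra).
assert (em : 0 < e / m) by (apply Rdiv_lt_0_compat; auto).
assert (B : forall v, Rabs v < m -> Rabs (e / m * v) < e).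
{ intros v Hv; rewrite Rabs_mult, (Rabs_pos_eq (e / m)) by lra.
  apply (Rmult_lt_compat_l (e / m)) in Hv; auto.
  now replace (e / m * m) with (pos e) in Hv by (field; lra). }
assert (Hq' : D (fst q + e / m * a2 t, snd q - e / m * a1 t)).
{ apply He; split.
  - change (Rabs (fst q + e / m * a2 t - fst q) < e).
    replace (fst q + e / m * a2 t - fst q) with (e / m * a2 t) by ring; apply B; unfold m; lra.
  - change (Rabs (snd q - e / m * a1 t - snd q) < e).
    replace (snd q - e / m * a1 t - snd q) with (e / m * - a1 t) by ring; apply B.
    rewrite Rabs_Ropp; unfold m; lra. }
assert (W := tangent_support_weak t _ Hq'); simpl in W.
assert (0 < e / m * (a1 t ^ 2 + a2 t ^ 2)) by (apply Rmult_lt_0_compat; auto).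
lra.
Qed.

Lemma tangent_chord s t : gamma s <> gamma t ->
  0 < a1 t * (g2 s - g2 t) - a2 t * (g1 s - g1 t).
Proof.
intros H; destruct hD as [_ [_ HC]].
assert (M : D (plus (scal (1 - / 2) (gamma s)) (scal (/ 2) (gamma t)))).
{ apply HC; auto; try apply gamma_boundary; lra. }
assert (K := tangent_support t _ M).
change (0 < a1 t * ((1 - / 2) * g2 s + / 2 * g2 t - g2 t)
   - a2 t * ((1 - / 2) * g1 s + / 2 * g1 t - g1 t)) in K.
lra.
Qed.

(** ** The variational equations in terms of the curve *)

Lemma ex_g1 t : ex_derive g1 t. Proof. eexists; apply d_g1. Qed.
Lemma ex_g2 t : ex_derive g2 t. Proof. eexists; apply d_g2. Qed.
Lemma ex_a1 t : ex_derive (Derive g1) t. Proof. eexists; apply d_a1. Qed.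
Lemma ex_a2 t : ex_derive (Derive g2) t. Proof. eexists; apply d_a2. Qed.

Lemma L12_eq s t : L12 gamma s t = a1 s * a2 t - a2 s * a1 t.
Proof.
assert (X1 := ex_g1); assert (X2 := ex_g2).
unfold L12, partial_derive.
transitivity (Derive (fun z => a2 t * g1 z - a1 t * g2 z) s).
- apply Derive_ext; intros z.
  transitivity (Derive (fun w => g1 z * g2 w - g2 z * g1 w) t); [reflexivity|].
  rewrite Derive_comb by auto; change (Derive g1 t) with (a1 t); change (Derive g2 t) with (a2 t); ring.
- rewrite Derive_comb by auto; change (Derive g1 s) with (a1 s); change (Derive g2 s) with (a2 s); ring.
Qed.

Lemma L11_eq s t : L11 gamma s t = b1 s * g2 t - b2 s * g1 t.
Proof.
assert (X1 := ex_g1); assert (X2 := ex_g2); assert (X3 := ex_a1); assert (X4 := ex_a2).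
transitivity (Derive_n (fun z => g2 t * g1 z - g1 t * g2 z) 2 s).
- apply Derive_n_ext; intros z; unfold gen_fun, omega; simpl; unfold g1, g2; ring.
- rewrite Derive_n2_comb by auto; fold (b1 s) (b2 s); ring.
Qed.

Lemma L22_eq s t : L22 gamma s t = g1 s * b2 t - g2 s * b1 t.
Proof.
assert (X1 := ex_g1); assert (X2 := ex_g2); assert (X3 := ex_a1); assert (X4 := ex_a2).
transitivity (Derive_n (fun z => g1 s * g2 z - g2 s * g1 z) 2 t); [reflexivity|].
now rewrite Derive_n2_comb by auto.
Qed.

Hypothesis hconj : without_conjugate_points ell gamma.

(** With the values of [L12], [L11 + L22] inserted, [curve_no_conjugate] is the absence
    of conjugate points. *)
Lemma jacobi_vanish : curve_no_conjugate g1 g2 a1 a2 b1 b2 ell.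
Proof.
intros t xi H1 H2 H3 H4 M N HMN HM HN n.
destruct (Req_dec (xi n) 0) as [E|E]; auto; exfalso.
assert (PS : forall k, phase_space ell gamma (gamma (t k), gamma (t (k + 1)%Z))).
{ intros k; destruct (H1 k) as [u [Hu1 [Hu2 Hu3]]].
  exists (t k), (t (k + 1)%Z), u; split; [reflexivity|]; split.
  - split; [apply gamma_neq; lra | exact Hu3].
  - exists (t (k + 1)%Z), u; repeat split; try lra; exists 0%Z; simpl; ring. }
apply (hconj t) with (M := M) (N := N); auto.
- intros k; split; [apply PS|]; split.
  + assert (P := PS (k - 1)%Z); now replace (k - 1 + 1)%Z with k in P by ring.
  + exists (t (k - 1)%Z), (t k), (t (k + 1)%Z); repeat split.
    * apply gamma_neq, H2.
    * apply H3.
- exists xi; split; [|now eauto].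
  intros k; rewrite !L12_eq, L11_eq, L22_eq.
  rewrite <- (H4 k); ring.
Qed.

(** ** Normalising the curve by a linear map *)

Let rx (p t : R) : R := cos p * a1 t + sin p * a2 t.
Let ry (p t : R) : R := - sin p * a1 t + cos p * a2 t.
Let bend0 (t : R) : R := a1 t * b2 t - a2 t * b1 t.

Let moment (i j : nat) (p : R) : R :=
  RInt (fun t => rx p t ^ i * ry p t ^ j / bend0 t) 0 ell.

Lemma c_a1 : cont a1. Proof. apply (is_derive_cont _ _ d_a1). Qed.
Lemma c_a2 : cont a2. Proof. apply (is_derive_cont _ _ d_a2). Qed.
Lemma c_bend0 : cont bend0.
Proof.
assert (X1 := c_a1); assert (X2 := c_a2); assert (X3 := c_b1); assert (X4 := c_b2).
unfold bend0; cts.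
Qed.
Lemma bend0_neq t : bend0 t <> 0.
Proof. apply Rgt_not_eq, bend_gamma_pos. Qed.

Lemma moment_integrand_cont i j : cont (fun q : R * R =>
  rx (fst q) (snd q) ^ i * ry (fst q) (snd q) ^ j / bend0 (snd q)).
Proof.
assert (X1 := c_a1); assert (X2 := c_a2); assert (X3 := c_bend0).
unfold rx, ry; apply cont_div; [cts | cts | intros q; apply bend0_neq].
Qed.

Lemma moment_integrand_cont1 i j p : cont (fun t => rx p t ^ i * ry p t ^ j / bend0 t).
Proof.
assert (X1 := c_a1); assert (X2 := c_a2); assert (X3 := c_bend0).
unfold rx, ry; apply cont_div; [cts | cts | intros q; apply bend0_neq].
Qed.

Lemma moment_cont i j : cont (moment i j).
Proof. apply (cont_RInt_param _ 0 ell (moment_integrand_cont i j)). Qed.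

(** A vector normal to the velocity on an interval is normal to the acceleration too. *)
Lemma not_straight (u v : R) : (forall t, 0 < t < ell -> u * a1 t + v * a2 t = 0) ->
  u = 0 /\ v = 0.
Proof.
intros H.
set (t := ell / 2).
assert (E : u * b1 t + v * b2 t = 0).
{ assert (d1 : is_derive (fun t => u * a1 t + v * a2 t) t (u * b1 t + v * b2 t)).
  { apply (is_derive_plus (fun t => u * a1 t) (fun t => v * a2 t)).
    - apply (is_derive_scal a1), d_a1.
    - apply (is_derive_scal a2), d_a2. }
  assert (d2 : is_derive (fun t => u * a1 t + v * a2 t) t 0).
  { apply (is_derive_ext_loc (fun _ => 0)); [|apply (is_derive_const 0 t)].
    exists (mkposreal (ell / 2) ltac:(lra)); intros s Hs; symmetry; apply H.
    change (Rabs (s - t) < ell / 2) in Hs; apply Rabs_lt_between' in Hs; unfold t in Hs; split; lra. }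
  rewrite <- (is_derive_unique _ _ _ d1); apply is_derive_unique, d2. }
assert (F := H t ltac:(unfold t; lra)).
assert (B := bend0_neq t); unfold bend0 in B.
split; apply (Rmult_eq_reg_r (a1 t * b2 t - a2 t * b1 t)); auto.
- transitivity ((u * a1 t + v * a2 t) * b2 t - (u * b1 t + v * b2 t) * a2 t); [ring|].
  rewrite E, F; ring.
- transitivity ((u * b1 t + v * b2 t) * a1 t - (u * a1 t + v * a2 t) * b1 t); [ring|].
  rewrite E, F; ring.
Qed.

Lemma fourth_moment_pos (f : R -> R) : cont f -> ~ (forall t, 0 < t < ell -> f t = 0) ->
  0 < RInt (fun t => f t ^ 4 / bend0 t) 0 ell.
Proof.
intros Cf N; assert (CB := c_bend0).
assert (C : cont (fun t => f t ^ 4 / bend0 t)) by (apply cont_div; [cts | cts | apply bend0_neq]).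
assert (P : forall t, 0 <= f t ^ 4 / bend0 t).
{ intros t; apply Rmult_le_pos; [replace (f t ^ 4) with ((f t ^ 2) ^ 2) by ring; apply pow2_ge_0|].
  apply Rlt_le, Rinv_0_lt_compat, bend_gamma_pos. }
assert (I0 := cont_RInt_nonneg _ 0 ell (Rlt_le _ _ hell) C (fun t _ => P t)).
destruct (Req_dec (RInt (fun t => f t ^ 4 / bend0 t) 0 ell) 0) as [Z|Z].
2: { destruct I0 as [L|L]; [exact L | now elim Z]. }
exfalso; apply N; intros t Ht.
assert (E := RInt_zero_nonneg _ 0 ell C (fun t _ => P t) Z t Ht); cbv beta in E.
assert (E4 : f t ^ 4 = 0).
{ replace (f t ^ 4) with (f t ^ 4 / bend0 t * bend0 t) by (field; apply bend0_neq).
  rewrite E; ring. }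
destruct (Req_dec (f t) 0) as [|K]; auto; exfalso; now apply (pow_nonzero _ 4 K).
Qed.

Lemma moment40_pos p : 0 < moment 4 0 p.
Proof.
assert (X1 := c_a1); assert (X2 := c_a2).
unfold moment; rewrite (RInt_ext' _ (fun t => rx p t ^ 4 / bend0 t))
  by (intros t; simpl; field; apply bend0_neq).
apply fourth_moment_pos; [unfold rx; cts|].
intros H; destruct (not_straight _ _ H) as [C S].
assert (Q := sin2_cos2 p); rewrite C, S in Q; unfold Rsqr in Q; lra.
Qed.

Lemma moment04_pos p : 0 < moment 0 4 p.
Proof.
assert (X1 := c_a1); assert (X2 := c_a2).
unfold moment; rewrite (RInt_ext' _ (fun t => ry p t ^ 4 / bend0 t))
  by (intros t; simpl; field; apply bend0_neq).
apply fourth_moment_pos; [unfold ry; cts|].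
intros H; destruct (not_straight _ _ H) as [S C].
assert (Q := sin2_cos2 p); rewrite C in Q; unfold Rsqr in Q; nra.
Qed.

(** After rotating by [p] and scaling the axes by [al] and [be] with
    [al ^ 4 = moment 0 4 p] and [be ^ 4 = moment 4 0 p], the moment
    [int rho^2 cos 2theta] vanishes, and [int rho^2 sin 2theta] vanishes if [p] is a zero
    of this function. Under a rotation by [PI / 2] the axes are exchanged and the function
    changes sign. *)
Lemma good_rotation : exists p,
  sqrt (moment 0 4 p) * moment 3 1 p + sqrt (moment 4 0 p) * moment 1 3 p = 0.
Proof.
set (G := fun p => sqrt (moment 0 4 p) * moment 3 1 p + sqrt (moment 4 0 p) * moment 1 3 p).
assert (Cs : cont sqrt) by (intros u; apply continuous_sqrt).
assert (C1 := moment_cont 0 4); assert (C2 := moment_cont 3 1).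
assert (C3 := moment_cont 4 0); assert (C4 := moment_cont 1 3).
assert (CG : cont G) by (unfold G; cts).
assert (ER : forall t, rx (PI / 2) t = ry 0 t).
{ intros t; unfold rx, ry; rewrite cos_PI2, sin_PI2, cos_0, sin_0; ring. }
assert (EY : forall t, ry (PI / 2) t = - rx 0 t).
{ intros t; unfold rx, ry; rewrite cos_PI2, sin_PI2, cos_0, sin_0; ring. }
assert (E1 : moment 0 4 (PI / 2) = moment 4 0 0).
{ apply RInt_ext'; intros t; rewrite ER, EY; field; apply bend0_neq. }
assert (E2 : moment 4 0 (PI / 2) = moment 0 4 0).
{ apply RInt_ext'; intros t; rewrite ER, EY; field; apply bend0_neq. }
assert (E3 : moment 3 1 (PI / 2) = - moment 1 3 0).
{ unfold moment; rewrite <- RInt_opp' by apply moment_integrand_cont1.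
  apply RInt_ext'; intros t; rewrite ER, EY; field; apply bend0_neq. }
assert (E4 : moment 1 3 (PI / 2) = - moment 3 1 0).
{ unfold moment; rewrite <- RInt_opp' by apply moment_integrand_cont1.
  apply RInt_ext'; intros t; rewrite ER, EY; field; apply bend0_neq. }
assert (EG : G (PI / 2) = - G 0) by (unfold G; rewrite E1, E2, E3, E4; ring).
destruct (IVT_gen G 0 (PI / 2) 0) as [p [_ Hp]].
- intros u; apply continuity_pt_filterlim, CG.
- rewrite EG; unfold Rmin, Rmax; repeat destruct Rle_dec; lra.
- now exists p.
Qed.

(** [curve_is_circle] applied to the image of [gamma] under the normalising linear map;
    [omega] is multiplied by its determinant [al * be], and all conditions are homogeneous
    in [omega]. *)
Lemma boundary_on_ellipse : exists al be p cx cy r, 0 < al /\ 0 < be /\ 0 < r /\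
  let E := fun q : point => (al * (cos p * fst q + sin p * snd q) - cx) ^ 2
    + (be * (- sin p * fst q + cos p * snd q) - cy) ^ 2 in
  (forall t, E (gamma t) = r ^ 2) /\ (forall q, D q -> E q < r ^ 2).
Proof.
destruct good_rotation as [p Hp].
assert (M1 := moment40_pos p); assert (M2 := moment04_pos p).
set (al := sqrt (sqrt (moment 0 4 p))); set (be := sqrt (sqrt (moment 4 0 p))).
assert (S1 := sqrt_lt_R0 _ M1); assert (S2 := sqrt_lt_R0 _ M2).
assert (al0 : 0 < al) by now apply sqrt_lt_R0.
assert (be0 : 0 < be) by now apply sqrt_lt_R0.
assert (al2 : al ^ 2 = sqrt (moment 0 4 p)) by (apply pow2_sqrt; lra).
assert (be2 : be ^ 2 = sqrt (moment 4 0 p)) by (apply pow2_sqrt; lra).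
assert (al4 : al ^ 4 = moment 0 4 p)
  by (replace (al ^ 4) with ((al ^ 2) ^ 2) by ring; rewrite al2; apply pow2_sqrt; lra).
assert (be4 : be ^ 4 = moment 4 0 p)
  by (replace (be ^ 4) with ((be ^ 2) ^ 2) by ring; rewrite be2; apply pow2_sqrt; lra).
set (lx := fun u v : R => al * (cos p * u + sin p * v)).
set (ly := fun u v : R => be * (- sin p * u + cos p * v)).
assert (Q := sin2_cos2 p); unfold Rsqr in Q.
assert (cross : forall u v u' v', lx u v * ly u' v' - ly u v * lx u' v' = al * be * (u * v' - v * u')).
{ intros; unfold lx, ly.
  transitivity (al * be * (u * v' - v * u') * (sin p * sin p + cos p * cos p)); [ring | rewrite Q; ring]. }
assert (lin : forall u v u' v', lx (u - u') (v - v') = lx u v - lx u' v' /\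
  ly (u - u') (v - v') = ly u v - ly u' v') by (intros; unfold lx, ly; split; ring).
assert (dl : forall (c d : R) (f g df dg : R -> R), (forall t, is_derive f t (df t)) ->
  (forall t, is_derive g t (dg t)) -> forall t, is_derive (fun t => c * f t + d * g t) t (c * df t + d * dg t)).
{ intros c d f g df dg Hf Hg t; apply (is_derive_plus (fun t => c * f t) (fun t => d * g t));
    [apply (is_derive_scal f), Hf | apply (is_derive_scal g), Hg]. }
assert (dlx : forall (f g df dg : R -> R), (forall t, is_derive f t (df t)) ->
  (forall t, is_derive g t (dg t)) -> forall t, is_derive (fun t => lx (f t) (g t)) t (lx (df t) (dg t))).
{ intros f g df dg Hf Hg t.
  apply (is_derive_scal (fun t => cos p * f t + sin p * g t)), (dl _ _ f g df dg); auto. }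
assert (dly : forall (f g df dg : R -> R), (forall t, is_derive f t (df t)) ->
  (forall t, is_derive g t (dg t)) -> forall t, is_derive (fun t => ly (f t) (g t)) t (ly (df t) (dg t))).
{ intros f g df dg Hf Hg t.
  apply (is_derive_scal (fun t => - sin p * f t + cos p * g t)), (dl _ _ f g df dg); auto. }
assert (alb : 0 < al * be) by now apply Rmult_lt_0_compat.
assert (CI := fun i j => moment_integrand_cont1 i j p).
assert (Xb1 := c_b1); assert (Xb2 := c_b2).
destruct (curve_is_circle (fun t => lx (g1 t) (g2 t)) (fun t => ly (g1 t) (g2 t))
  (fun t => lx (a1 t) (a2 t)) (fun t => ly (a1 t) (a2 t))
  (fun t => lx (b1 t) (b2 t)) (fun t => ly (b1 t) (b2 t)) ell)
  as [cx [cy [r [r0 [HE HD]]]]].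
- exact hell.
- apply dlx; [apply d_g1 | apply d_g2].
- apply dly; [apply d_g1 | apply d_g2].
- apply dlx; [apply d_a1 | apply d_a2].
- apply dly; [apply d_a1 | apply d_a2].
- unfold lx; cts.
- unfold ly; cts.
- intros t; unfold g1, g2; now rewrite gamma_per.
- intros t; unfold g1, g2; now rewrite gamma_per.
- intros t; unfold bend; rewrite cross.
  apply Rmult_lt_0_compat; auto; apply bend_gamma_pos.
- intros s t H; cbv beta.
  rewrite <- !(proj1 (lin _ _ _ _)), <- !(proj2 (lin _ _ _ _)), !cross.
  assert (N := gamma_neq s t H).
  split; apply Rmult_lt_0_compat; auto; apply tangent_chord; auto.
- intros t xi H1 H2 H3 H4.
  apply (jacobi_vanish t xi); auto.
  + intros n; destruct (H1 n) as [u [U1 [U2 U3]]]; exists u; repeat split; try lra.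
    rewrite cross in U3; apply (Rmult_eq_reg_l (al * be)); lra.
  + intros n; assert (K := H3 n); cbv beta in K.
    rewrite <- (proj1 (lin _ _ _ _)), <- (proj2 (lin _ _ _ _)), cross in K.
    apply (Rmult_eq_reg_l (al * be)); lra.
  + intros n; assert (K := H4 n); cbv beta in K.
    rewrite <- (proj1 (lin _ _ _ _)), <- (proj2 (lin _ _ _ _)), !cross in K.
    apply (Rmult_eq_reg_l (al * be)); lra.
- transitivity (al ^ 4 / (al * be) * moment 4 0 p - be ^ 4 / (al * be) * moment 0 4 p).
  + unfold moment; rewrite <- !RInt_scal', <- RInt_minus' by (auto; apply cont_mult; auto; apply cont_const).
    apply RInt_ext'; intros t; unfold bend, sqspeed; rewrite cross.
    fold (bend0 t); unfold lx, ly; fold (rx p t) (ry p t).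
    field; repeat split; try apply bend0_neq; lra.
  + rewrite al4, be4; real_eq; field; lra.
- transitivity (al ^ 2 * moment 3 1 p + be ^ 2 * moment 1 3 p).
  + unfold moment; rewrite <- !RInt_scal', <- RInt_plus' by (auto; apply cont_mult; auto; apply cont_const).
    apply RInt_ext'; intros t; unfold bend, sqspeed; rewrite cross.
    fold (bend0 t); unfold lx, ly; fold (rx p t) (ry p t).
    field; repeat split; try apply bend0_neq; lra.
  + rewrite al2, be2; exact Hp.
- exists al, be, p, cx, cy, r; repeat split; auto.
  intros q Hq; apply HD; intros t; cbv beta.
  fold (lx (fst q) (snd q)) (ly (fst q) (snd q)).
  rewrite <- (proj1 (lin _ _ _ _)), <- (proj2 (lin _ _ _ _)), cross.
  apply Rmult_lt_0_compat; auto; now apply tangent_support.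
Qed.

Hypothesis h0 : D (0, 0).

(** [D] lies in the open disc, and cannot miss a point of it: the segment from [(0, 0)] to
    a missing point would contain a boundary point in the interior of the disc. *)
Lemma domain_is_ellipse : is_ellipse D.
Proof.
destruct boundary_on_ellipse as [al [be [p [cx [cy [r [al0 [be0 [r0 [HB HD]]]]]]]]]].
cbv zeta in HB, HD.
assert (Q := sin2_cos2 p); unfold Rsqr in Q.
exists (cos p * (cx / al) - sin p * (cy / be), sin p * (cx / al) + cos p * (cy / be)),
  (r / al), (r / be), p.
split; [now apply Rdiv_lt_0_compat|]; split; [now apply Rdiv_lt_0_compat|].
intros q; simpl fst; simpl snd.
set (E := fun q : point => (al * (cos p * fst q + sin p * snd q) - cx) ^ 2
    + (be * (- sin p * fst q + cos p * snd q) - cy) ^ 2) in *.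
assert (EE : forall q : point,
  ((cos p * (fst q - (cos p * (cx / al) - sin p * (cy / be))) +
   sin p * (snd q - (sin p * (cx / al) + cos p * (cy / be)))) / (r / al)) ^ 2 +
  ((- sin p * (fst q - (cos p * (cx / al) - sin p * (cy / be))) +
   cos p * (snd q - (sin p * (cx / al) + cos p * (cy / be)))) / (r / be)) ^ 2 = E q / r ^ 2).
{ intros [u v]; unfold E; simpl fst; simpl snd.
  replace (cos p * (u - (cos p * (cx / al) - sin p * (cy / be))) +
    sin p * (v - (sin p * (cx / al) + cos p * (cy / be)))) with
    (cos p * u + sin p * v - (sin p * sin p + cos p * cos p) * (cx / al)) by ring.
  replace (- sin p * (u - (cos p * (cx / al) - sin p * (cy / be))) +
    cos p * (v - (sin p * (cx / al) + cos p * (cy / be)))) with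
    (- sin p * u + cos p * v - (sin p * sin p + cos p * cos p) * (cy / be)) by ring.
  rewrite Q; field; lra. }
rewrite EE.
assert (r2 : 0 < r ^ 2) by now apply pow_lt.
assert (Iff : E q / r ^ 2 < 1 <-> E q < r ^ 2).
{ split; intros H.
  - apply (Rmult_lt_compat_r (r ^ 2)) in H; auto.
    replace (E q / r ^ 2 * r ^ 2) with (E q) in H by (field; lra); lra.
  - apply (Rmult_lt_reg_r (r ^ 2)); auto.
    replace (E q / r ^ 2 * r ^ 2) with (E q) by (field; lra); lra. }
rewrite Iff; split; [apply HD|].
intros Hq; destruct (classic (D q)) as [|N]; auto; exfalso.
destruct (boundary_on_segment (0, 0) q h0 N) as [s [Hs B]]; simpl in B.
apply (bp_image _ _ _ hgamma) in B; destruct B as [t Ht].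
assert (K := HB t); rewrite Ht in K.
assert (H0 := HD _ h0).
revert K H0 Hq; unfold E; simpl fst; simpl snd.
set (U := al * (cos p * fst q + sin p * snd q)); set (V := be * (- sin p * fst q + cos p * snd q)).
replace (al * (cos p * ((1 - s) * 0 + s * fst q) + sin p * ((1 - s) * 0 + s * snd q)) - cx)
  with ((1 - s) * (- cx) + s * (U - cx)) by (unfold U; ring).
replace (be * (- sin p * ((1 - s) * 0 + s * fst q) + cos p * ((1 - s) * 0 + s * snd q)) - cy)
  with ((1 - s) * (- cy) + s * (V - cy)) by (unfold V; ring).
replace (al * (cos p * 0 + sin p * 0) - cx) with (- cx) by ring.
replace (be * (- sin p * 0 + cos p * 0) - cy) with (- cy) by ring.
intros K H0 Hq.
set (A := U - cx) in *; set (C := V - cy) in *.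
(* the squared norm is convex along the segment *)
assert (J : ((1 - s) * - cx + s * A) ^ 2 + ((1 - s) * - cy + s * C) ^ 2 =
  (1 - s) * ((- cx) ^ 2 + (- cy) ^ 2) + s * (A ^ 2 + C ^ 2)
  - (1 - s) * s * ((- cx - A) ^ 2 + (- cy - C) ^ 2)) by ring.
assert (0 <= (1 - s) * s * ((- cx - A) ^ 2 + (- cy - C) ^ 2)).
{ apply Rmult_le_pos; [apply Rmult_le_pos; lra|].
  apply Rplus_le_le_0_compat; apply pow2_ge_0. }
assert (K1 := proj1 (Rminus_lt_0 _ _) H0); assert (K2 := proj1 (Rminus_lt_0 _ _) Hq).
assert (K3 : 0 < (1 - s) * (r ^ 2 - ((- cx) ^ 2 + (- cy) ^ 2)) + s * (r ^ 2 - (A ^ 2 + C ^ 2))).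
{ clear - Hs K1 K2; destruct (Req_dec s 0) as [->|N]; [lra|].
  apply Rplus_le_lt_0_compat; [apply Rmult_le_pos; lra | apply Rmult_lt_0_compat; lra]. }
rewrite J in K; lra.
Qed.

End Domain.

Theorem theorem1p2 (D : R * R -> Prop) (ell : R) (gamma : R -> R * R)
  (hD : strictly_convex_domain D)
  (h0 : D (0, 0))
  (hell : 0 < ell)
  (hgamma : boundary_param D ell gamma)
  (hcurv : forall t : R, 0 < curvature gamma t)
  (hconj : without_conjugate_points ell gamma) :
  is_ellipse D.
Proof. exact (domain_is_ellipse D hD ell gamma hell hgamma hcurv hconj h0). Qed.
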